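(* Let $R=\mathbb{k}[x_1,\dots,x_d]$ be a polynomial ring over a field $\mathbb{k}$ of characteristic zero, $\mathfrak m=(x_1,\dots,x_d)$ the maximal homogeneous ideal of $R$, and $L$ a lex-segment ideal generated in degree $\delta\geqslant2$. Assume $d\geqslant3$ and that $L$ has height $g=d-1$. Then $$\operatorname{core}(L)=L\,\mathfrak m^{d(\delta-2)+g-\delta+1}.$$
   Context: Lex-segment ideal: a monomial ideal $L=\bigoplus_{i\geqslant 0}L_i$ of $R$ such that, for every $i$, $L_i$ is spanned by the $\dim_{\mathbb{k}}L_i$ largest monomials of degree $i$ in the lexicographic order with $x_1>x_2>\cdots>x_d$. ''Generated in degree $\delta$'' means all minimal monomial generators have degree $\delta$. A subideal $J\subseteq L$ is a reduction of $L$ if $L^{m+1}=JL^m$ for $m\gg0$; $\operatorname{core}(L)$ is the intersection of all reductions of $L$. *)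

(* Defs.v *)
From mathcomp Require Import all_boot all_order all_algebra.
From mathcomp.multinomials Require Export mpoly.

Set Implicit Arguments.
Unset Strict Implicit.
Unset Printing Implicit Defensive.

Import GRing.Theory.
Local Open Scope ring_scope.

(* Ideals are Prop-valued predicates: the ideals of [ring_quotient] are boolean
   and proper, whereas the core is an intersection over an arbitrary family. *)
Section Ideals.
Variable R : comNzRingType.
Implicit Types (A I J P : R -> Prop) (n : nat).

Definition is_ideal I : Prop :=
  [/\ I 0, (forall f g, I f -> I g -> I (f + g))
    & forall a f, I f -> I (a * f)].

Definition subideal I J : Prop := forall f, I f -> J f.

Definition eq_ideal I J : Prop := forall f, I f <-> J f.

Definition ideal_gen A : R -> Prop :=
  fun f => forall I, is_ideal I -> (forall g, A g -> I g) -> I f.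

Definition ideal_mul I J : R -> Prop :=
  ideal_gen (fun h => exists f g, [/\ I f, J g & h = f * g]).

Fixpoint ideal_exp I n : R -> Prop :=
  if n is n'.+1 then ideal_mul I (ideal_exp I n') else fun=> True.

Definition is_prime_ideal P : Prop :=
  [/\ is_ideal P, ~ P 1 & forall f g, P (f * g) -> P f \/ P g].

(* [c 0 < c 1 < ... < c n = P] is a strictly increasing chain of primes. *)
Definition prime_chain P n : Prop :=
  exists c : nat -> R -> Prop,
    [/\ forall i, (i <= n)%N -> is_prime_ideal (c i),
        forall i, (i < n)%N ->
          subideal (c i) (c i.+1) /\ ~ subideal (c i.+1) (c i)
      & eq_ideal (c n) P].

Definition prime_height P n : Prop :=
  prime_chain P n /\ forall m, prime_chain P m -> (m <= n)%N.

(* The least height of a prime containing [I]; primes of infinite height do not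
   affect the minimum, and the unit ideal has no height in [nat]. *)
Definition ideal_height I n : Prop :=
  (exists P, [/\ is_prime_ideal P, subideal I P & prime_height P n]) /\
  (forall P m, is_prime_ideal P -> subideal I P -> prime_height P m ->
     (n <= m)%N).

Definition is_reduction J I : Prop :=
  [/\ is_ideal J, subideal J I
    & exists m0 : nat, forall m, (m0 <= m)%N ->
        eq_ideal (ideal_exp I m.+1) (ideal_mul J (ideal_exp I m))].

Definition core I : R -> Prop :=
  fun f => forall J, is_reduction J I -> J f.

End Ideals.

Section LexSegment.
Variables (k : fieldType) (d : nat).
Implicit Types (L V : {mpoly k[d]} -> Prop) (m : 'X_{1..d}).

Definition max_homog_ideal : {mpoly k[d]} -> Prop :=
  ideal_gen (fun f => exists i : 'I_d, f = 'X_i).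

Definition is_monomial_ideal L : Prop :=
  exists S : 'X_{1..d} -> Prop,
    eq_ideal L (ideal_gen (fun f => exists2 m, S m & f = 'X_[m])).

Definition graded_piece L (i : nat) : {mpoly k[d]} -> Prop :=
  fun f => L f /\ f \is i.-homog.

Definition has_dim V (n : nat) : Prop :=
  exists b : 'I_n -> {mpoly k[d]},
    (forall f, V f <-> exists c : 'I_n -> k, f = \sum_(j < n) c j *: b j) /\
    (forall c : 'I_n -> k, \sum_(j < n) c j *: b j = 0 -> forall j, c j = 0).

Definition monomial_span (s : seq 'X_{1..d}) : {mpoly k[d]} -> Prop :=
  fun f => exists c : 'X_{1..d} -> k, f = \sum_(m <- s) c m *: 'X_[m].

(* Index 0 carries the largest variable. *)
Definition lex_lt m1 m2 : Prop :=
  exists i : 'I_d, (forall j : 'I_d, (j < i)%N -> m1 j = m2 j) /\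
                   (m1 i < m2 i)%N.

Definition largest_monomials (i n : nat) (s : seq 'X_{1..d}) : Prop :=
  [/\ uniq s, size s = n, (forall m, m \in s -> mdeg m = i)
    & forall m1 m2, m1 \in s -> mdeg m2 = i -> m2 \notin s -> lex_lt m2 m1].

(* The decomposition of [L] as the direct sum of its graded pieces is automatic
   for a monomial ideal. *)
Definition is_lex_segment L : Prop :=
  is_monomial_ideal L /\
  forall i : nat, exists (n : nat) (s : seq 'X_{1..d}),
    [/\ has_dim (graded_piece L i) n, largest_monomials i n s
      & forall f, graded_piece L i f <-> monomial_span s f].

Definition is_minimal_generator L m : Prop :=
  L 'X_[m] /\ forall m', L 'X_[m'] -> (m' <= m)%MM -> m' = m.

Definition generated_in_degree L (delta : nat) : Prop :=
  forall m, is_minimal_generator L m -> mdeg m = delta.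

End LexSegment.

Arguments max_homog_ideal {k d}.

(* Main.v *)
(* Call the variables x_0, ..., x_(d-3), y, z. The height hypothesis forces [L] to
   be the part of degree >= delta of C = (x_0, ..., x_(d-3), y^a) for some
   1 <= a <= delta, so the core is to be identified with the part of degree
   >= D := d (delta - 1) of C.

   Every reduction J contains C_{>= D}. Let V be the space of degree-delta
   components of the elements of J. Restricting L^(N+1) = J L^N to arcs in the
   zero set of L with z invertible shows that the coefficients of x_i z^(delta-1)
   and y^a z^(delta-a) can be prescribed in V. Start from the regular sequence
   x_0^delta, ..., x_(d-3)^delta, y^delta, z and replace its members other than z
   one by one by elements of V: the quotients of two multiplications in the top
   degree are commuting matrices, so a generic replacement keeps the sequence
   regular, and the Cramer determinant keeps spanning the socle. For the final
   sequence, multiplication by z and by this determinant gives C_D in (V), and a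
   descending argument on initial forms gives C_{>= D} in J.

   The core has no element with a component of degree < D. There is an explicit
   reduction J0 and a linear functional on degree D - 1 that kills J0 but not
   x_0^(D-1). The automorphisms x_i -> t x_i + c_i x_0 preserve L and degenerate,
   as t tends to 0, a form f of degree D - 1 to f(c) x_0^(D-1); hence f is outside
   the preimage of J0 under one of them, and this preimage is again a reduction. *)

Require Import Defs.
From mathcomp Require Import all_boot all_order all_algebra.
From mathcomp Require Import zify ring.
From Stdlib Require Import Classical FunctionalExtensionality PropExtensionality.

Set Implicit Arguments.
Unset Strict Implicit.
Unset Printing Implicit Defensive.

Import GRing.Theory.
Local Open Scope ring_scope.

(** * Ideals and monomial supports *)

(** The bound [d (delta - 1)] is [sigma + (delta - 1)] with [sigma = (d - 1)(delta - 1)], the socle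
    degree of a complete intersection of z and [d - 1] forms of degree [delta]. Multiplying a form
    of degree D by z gives degree [sigma + delta], where the coefficients of elements of V have the
    socle degree; the Cramer determinant maps C into the ideal of the [d - 1] forms, and z, regular
    modulo that ideal, cancels. The obstacle is that L is not primary to the maximal ideal: a
    regular sequence from V could lose C along the zero set of L. So each replacement must also
    preserve a second determinant, that of the coefficients of x_i z^(delta-1) and y^a z^(delta-a);
    this is why they have to be prescribable in V. Both conditions are open and hold together for a
    generic element. The functional is a truncated geometric series in the quotient of the tail by
    x_0^delta, so it kills multiples of their difference; its weights are chosen so that multiples
    of y^a z^(delta-a) miss them by one degree. Characteristic zero supplies generic parameters and
    keeps a positive integer nonzero in [k]. *)

Section IdealTheory.
Variable R : comNzRingType.
Implicit Types (A I J K P : R -> Prop) (f g h : R).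

Lemma ideal0 I : is_ideal I -> I 0. Proof. by case. Qed.

Lemma idealD I f g : is_ideal I -> I f -> I g -> I (f + g).
Proof. by case=> _ + _; apply. Qed.

Lemma ideal_mulL I f g : is_ideal I -> I g -> I (f * g).
Proof. by case=> _ _; apply. Qed.

Lemma ideal_mulR I f g : is_ideal I -> I f -> I (f * g).
Proof. by rewrite mulrC; apply: ideal_mulL. Qed.

Lemma idealN I f : is_ideal I -> I f -> I (- f).
Proof. by rewrite -mulN1r; apply: ideal_mulL. Qed.

Lemma idealB I f g : is_ideal I -> I f -> I g -> I (f - g).
Proof. by move=> hI hf hg; apply: idealD => //; apply: idealN. Qed.

Lemma ideal_sum (T : Type) (r : seq T) (Q : pred T) (F : T -> R) I :
  is_ideal I -> (forall i, Q i -> I (F i)) -> I (\sum_(i <- r | Q i) F i).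
Proof.
move=> hI hF; apply: big_ind => //; first exact: ideal0.
by move=> ? ?; apply: idealD.
Qed.

Lemma ideal_sum_seq (T : eqType) (r : seq T) (F : T -> R) I :
  is_ideal I -> (forall i, i \in r -> I (F i)) -> I (\sum_(i <- r) F i).
Proof. by move=> hI hF; rewrite big_seq; apply: ideal_sum. Qed.

Lemma ideal_gen_ideal A : is_ideal (ideal_gen A).
Proof.
split=> [I hI _|f g hf hg I hI hA|a f hf I hI hA]; first exact: ideal0.
  by apply: idealD => //; [apply: hf | apply: hg].
by apply: ideal_mulL => //; apply: hf.
Qed.

Lemma ideal_gen_sub A f : A f -> ideal_gen A f.
Proof. by move=> hf I hI; apply. Qed.

Lemma ideal_mul_ideal I J : is_ideal (ideal_mul I J).
Proof. exact: ideal_gen_ideal. Qed.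

Lemma ideal_mul_in I J f g : I f -> J g -> ideal_mul I J (f * g).
Proof. by move=> hf hg; apply: ideal_gen_sub; exists f, g. Qed.

Lemma ideal_mul_ind I J K : is_ideal K ->
  (forall f g, I f -> J g -> K (f * g)) -> subideal (ideal_mul I J) K.
Proof. by move=> hK h f; apply=> // _ [g] [g'] [? ? ->]; apply: h. Qed.

Lemma ideal_exp_ideal I n : is_ideal (ideal_exp I n).
Proof. by case: n => [|n] //=; apply: ideal_mul_ideal. Qed.

Lemma ideal_colon I f : is_ideal I -> is_ideal (fun g => I (f * g)).
Proof.
move=> hI; split=> [|g h hg hh|a g hg]; first by rewrite mulr0; apply: ideal0.
  by rewrite mulrDr; apply: idealD.
by rewrite mulrCA; apply: ideal_mulL.
Qed.

Lemma ideal_expD I m n f g :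
  ideal_exp I m f -> ideal_exp I n g -> ideal_exp I (m + n) (f * g).
Proof.
elim: m f => [|m IH] f /=.
  by move=> _ hg; apply: ideal_mulL => //; apply: ideal_exp_ideal.
move=> hf hg; have hcol := ideal_colon g (ideal_exp_ideal I (m + n).+1).
rewrite mulrC; apply: (ideal_mul_ind hcol) hf => u v hu hv.
rewrite mulrCA; apply: ideal_mul_in => //.
by rewrite mulrC; apply: IH.
Qed.

Lemma ideal_expX I n f : I f -> ideal_exp I n (f ^+ n).
Proof.
by move=> hf; elim: n => // n IH; rewrite exprS; apply: ideal_mul_in.
Qed.

Lemma ideal_mul_expD I J m n f g :
  ideal_mul J (ideal_exp I m) f -> ideal_exp I n g ->
  ideal_mul J (ideal_exp I (m + n)) (f * g).
Proof.
move=> hf hg.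
have hcol := ideal_colon g (ideal_mul_ideal J (ideal_exp I (m + n))).
rewrite mulrC; apply: (ideal_mul_ind hcol) hf => u v hu hv.
by rewrite mulrCA; apply: ideal_mul_in => //; rewrite mulrC; apply: ideal_expD.
Qed.

Lemma ideal_mulS I J K : subideal I J -> subideal (ideal_mul I K) (ideal_mul J K).
Proof.
move=> hIJ; apply: ideal_mul_ind; first exact: ideal_mul_ideal.
by move=> f g /hIJ hf hg; apply: ideal_mul_in.
Qed.

Lemma subideal_exp1 I n : is_ideal I -> subideal (ideal_exp I n.+1) I.
Proof.
by move=> hI; apply: ideal_mul_ind => // f g hf _; apply: ideal_mulR.
Qed.

Lemma core_sub I : is_ideal I -> subideal (core I) I.
Proof.
by move=> hI f; apply; split=> //; exists 0%N => m _ g; split.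
Qed.

Lemma core_ideal I : is_ideal (core I).
Proof.
split=> [J|f g hf hg J|a f hf J] [hJ ? ?]; first exact: ideal0.
  by apply: idealD => //; [apply: hf | apply: hg].
by apply: ideal_mulL => //; apply: hf.
Qed.

End IdealTheory.

(** * Reductions under ring automorphisms *)

Section Automorphism.
Variable R : comNzRingType.
Variables (phi psi : {rmorphism R -> R}) (L J : R -> Prop).
Hypothesis psiK : cancel psi phi.
Hypothesis phiK : cancel phi psi.
Hypothesis phiL : forall f, L f -> L (phi f).
Hypothesis psiL : forall f, L f -> L (psi f).

Lemma preim_ideal (I : R -> Prop) (chi : {rmorphism R -> R}) :
  is_ideal I -> is_ideal (fun f => I (chi f)).
Proof.
move=> hI; split=> [|f g hf hg|a f hf]; first by rewrite rmorph0; apply: ideal0.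
  by rewrite rmorphD; apply: idealD.
by rewrite rmorphM; apply: ideal_mulL.
Qed.

Lemma rmorph_exp (chi : {rmorphism R -> R}) n f :
  (forall g, L g -> L (chi g)) -> ideal_exp L n f -> ideal_exp L n (chi f).
Proof.
move=> hchi; elim: n f => // n IH f /=.
apply: (ideal_mul_ind (preim_ideal chi (ideal_mul_ideal L (ideal_exp L n)))).
by move=> u v hu hv; rewrite rmorphM; apply: ideal_mul_in; [apply: hchi | apply: IH].
Qed.

Lemma preim_reduction : is_reduction J L -> is_reduction (fun f => J (phi f)) L.
Proof.
case=> hJ hJL [m0 hm]; split; first exact: preim_ideal.
  by move=> f /hJL /psiL; rewrite phiK.
exists m0 => m /hm hred f; split; last first.
  apply: ideal_mulS => g /hJL /psiL; by rewrite phiK.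
move=> /(rmorph_exp phiL) /hred hf.
rewrite -[f]phiK; move: (phi f) hf => g.
have hI := ideal_mul_ideal (fun f => J (phi f)) (ideal_exp L m).
apply: (ideal_mul_ind (preim_ideal psi hI)) => u v hu hv.
rewrite rmorphM; apply: ideal_mul_in; first by rewrite psiK.
exact: (rmorph_exp psiL).
Qed.

Lemma core_automorphism f : is_reduction J L -> core L f -> J (phi f).
Proof. by move=> hJ hf; apply: (hf _ (preim_reduction hJ)). Qed.

End Automorphism.

(** * Supports and homogeneous components *)

Section Monomials.
Variables (d : nat) (k : fieldType).
Local Notation R := {mpoly k[d]}.
Implicit Types (f g h : R) (m : 'X_{1..d}).

(** Monomial ideals, weight filtrations and graded pieces all take this form, so that membership is
    checked one monomial at a time. *)
Definition supported (P : pred 'X_{1..d}) f : Prop := forall m, f@_m != 0 -> P m.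

Definition upclosed (P : pred 'X_{1..d}) : Prop := forall m m', P m -> P (m + m')%MM.

Lemma mnm_neq0 m : m != 0%MM -> exists i, (0 < m i)%N.
Proof.
move=> hm; apply: NNPP => hn; case/eqP: hm; apply/mnmP => i; rewrite mnm0E.
by apply/eqP; rewrite -leqn0 leqNgt; apply/negP => h; apply: hn; exists i.
Qed.

Lemma supported0 P : supported P 0.
Proof. by move=> m; rewrite mcoeff0 eqxx. Qed.

Lemma supportedD P f g : supported P f -> supported P g -> supported P (f + g).
Proof.
move=> hf hg m; rewrite mcoeffD => hm.
have [h0|/hf //] := eqVneq f@_m 0.
by apply: hg; move: hm; rewrite h0 add0r.
Qed.

Lemma supportedX (P : pred 'X_{1..d}) m : P m -> supported P 'X_[m].
Proof. by move=> hm m'; rewrite mcoeffX; have [<-//|_] := eqVneq m m'; rewrite eqxx. Qed.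

Lemma supportedM (P Q S : pred 'X_{1..d}) f g :
  (forall m m', P m -> Q m' -> S (m + m')%MM) ->
  supported P f -> supported Q g -> supported S (f * g).
Proof.
move=> hPQ hf hg m; rewrite -mcoeff_msupp => /msuppM_le.
case/allpairsP=> -[m1 m2] [/= h1 h2 ->].
by apply: hPQ; [apply: hf | apply: hg]; rewrite -mcoeff_msupp.
Qed.

Lemma supported_ideal P : upclosed P -> is_ideal (supported P).
Proof.
move=> hP; split; [exact: supported0 | exact: supportedD |] => a f hf.
apply: (@supportedM predT P) => // m m' _; rewrite addmC; exact: hP.
Qed.

Lemma idealZ (I : R -> Prop) c f : is_ideal I -> I f -> I (c *: f).
Proof. by move=> hI hf; rewrite -mul_mpolyC; apply: ideal_mulL. Qed.

Lemma supported_sub (I : R -> Prop) (P : pred 'X_{1..d}) f : is_ideal I ->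
  (forall m, P m -> I 'X_[m]) -> supported P f -> I f.
Proof.
move=> hI hP hf; rewrite (mpolyE f); apply: ideal_sum_seq => // m hm.
by apply: idealZ => //; apply/hP/hf; rewrite -mcoeff_msupp.
Qed.

Lemma supported_sum (T : Type) (r : seq T) (Q : pred T) (F : T -> R) P :
  (forall i, Q i -> supported P (F i)) -> supported P (\sum_(i <- r | Q i) F i).
Proof.
by move=> hF; apply: big_ind => //; [exact: supported0 | exact: supportedD].
Qed.

Local Notation hcomp e f := (pihomog (@mdeg d) e f).

Lemma mcoeff_comp e f m : (hcomp e f)@_m = if mdeg m == e then f@_m else 0.
Proof.
rewrite {2}(mpolyE f) pihomogE raddf_sum [in RHS]raddf_sum /=.
rewrite big_mkcond /=; case: ifP => he.
  apply: eq_bigr => m' _; case: ifP => // hne.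
  rewrite mcoeffZ mcoeffX; case: eqP => [E|]; last by rewrite mulr0.
  by rewrite E he in hne.
apply: big1 => m' _; case: ifP => // he'.
rewrite mcoeffZ mcoeffX; case: eqP => [E|]; last by rewrite mulr0.
by rewrite -E he' in he.
Qed.

Lemma comp_homog e f : hcomp e f \is e.-homog.
Proof. exact: pihomogP. Qed.

Lemma homogP e f : (f \is e.-homog) <-> supported (fun m => mdeg m == e) f.
Proof.
split=> [/dhomogP h m|h]; first by rewrite -mcoeff_msupp => /h ->.
by apply/dhomogP => m; rewrite mcoeff_msupp => /h /eqP.
Qed.

Lemma supported_comp P e f : supported P f -> supported P (hcomp e f).
Proof. by move=> hf m; rewrite mcoeff_comp; case: ifP => _; [apply: hf | rewrite eqxx]. Qed.

Lemma comp_sum f : f = \sum_(e < msize f) hcomp e f.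
Proof. exact: pihomog_partitionE. Qed.

Lemma comp_ideal (I : R -> Prop) f :
  is_ideal I -> (forall e, I (hcomp e f)) -> I f.
Proof. by move=> hI hf; rewrite (comp_sum f); apply: ideal_sum. Qed.

Lemma compM_homog e e' f g : g \is e'.-homog ->
  hcomp (e + e')%N (f * g) = hcomp e f * g.
Proof.
move=> hg; have cut p q : p \is q.-homog -> hcomp (e + e')%N (p * g) = hcomp e p * g.
  move=> hp; have hpg := dhomogM hp hg.
  have [E|hne] := eqVneq q e; first by rewrite -E !pihomog_dE.
  rewrite (pihomog_ne0 hne hp) mul0r (pihomog_ne0 _ hpg) //.
  by rewrite eqn_add2r.
rewrite {1}(comp_sum f) mulr_suml raddf_sum /= [in RHS](comp_sum f) raddf_sum /= mulr_suml.
apply: eq_bigr => i _; apply: cut; exact: comp_homog.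
Qed.

Lemma compM_homog_lt e e' f g : g \is e'.-homog -> (e < e')%N ->
  hcomp e (f * g) = 0.
Proof.
move=> /homogP hg hlt; apply/mpolyP => m; rewrite mcoeff_comp mcoeff0.
case: eqP => // he; apply/eqP; apply/negPn/negP => hne.
have: supported (fun m => (e' <= mdeg m)%N) (f * g).
  apply: (@supportedM predT (fun m => mdeg m == e')) => //.
  by move=> m1 m2 _ /eqP <-; rewrite mdegD leq_addl.
by move=> /(_ m hne); rewrite he leqNgt hlt.
Qed.

Definition hom_ideal (I : R -> Prop) : Prop :=
  is_ideal I /\ forall e f, I f -> I (hcomp e f).

End Monomials.
Notation hcomp e f := (pihomog mdeg e f).

(** * The lex-segment ideals of height [d - 1] *)

Section LexIdeal.
Variables (n a delta : nat) (k : fieldType).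
Local Notation d := n.+3.
Local Notation R := {mpoly k[d]}.
Implicit Types (f g h : R) (m : 'X_{1..d}).

Lemma vy_subproof : (n.+1 < d)%N. Proof. by []. Qed.
Definition vy : 'I_d := Ordinal vy_subproof.
Definition vz : 'I_d := ord_max.
Definition low (i : 'I_d) : bool := (i < n.+1)%N.

Definition lowdeg m : nat := (\sum_(i < d | low i) m i)%N.
(** For positive [a], the largest [j] such that the monomial lies in [C ^ j], where C is generated
    by the low variables and y^a. *)
Definition lord m : nat := (lowdeg m + m vy %/ a)%N.

Lemma mdeg_lord m : mdeg m = (lowdeg m + m vy + m vz)%N.
Proof.
rewrite mdegE (bigID low) /= -addnA; congr addn.
rewrite (bigD1 vy) /=; last by rewrite /low /=; lia.
rewrite (bigD1 vz) /=; last by rewrite /low -!val_eqE /=; lia.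
rewrite big1 ?addn0 // => i /andP[/andP[h1 h2] h3].
case: i h1 h2 h3 => i hi; rewrite /low -!val_eqE /=; lia.
Qed.

Lemma lowdegD m m' : lowdeg (m + m')%MM = (lowdeg m + lowdeg m')%N.
Proof. by rewrite /lowdeg -big_split; apply: eq_bigr => i _; rewrite mnmDE. Qed.

Lemma lowdegU i : lowdeg U_(i)%MM = low i.
Proof.
rewrite /lowdeg; case hi: (low i).
  rewrite (bigD1 i) //= mnm1E eqxx big1 // => j /andP[_ hj].
  by rewrite mnm1E eq_sym (negbTE hj).
rewrite big1 // => j hj; rewrite mnm1E; case: eqP => // E.
by rewrite -E hi in hj.
Qed.

Lemma lowdeg_ge m i : low i -> (m i <= lowdeg m)%N.
Proof. by move=> hi; rewrite /lowdeg (bigD1 i) //= leq_addr. Qed.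

Lemma lowdeg_gt0 m : (0 < lowdeg m)%N -> exists2 i, low i & (0 < m i)%N.
Proof.
move=> h; case: (boolP [exists i, low i && (0 < m i)%N]) => [/existsP[i /andP[]]|].
  by exists i.
rewrite negb_exists => /forallP h0; move: h; rewrite /lowdeg big1 // => i hi.
by move: (h0 i); rewrite hi -eqn0Ngt => /eqP.
Qed.

Hypotheses (a_gt0 : (0 < a)%N) (a_le : (a <= delta)%N).

Lemma lordD m m' : (lord m + lord m' <= lord (m + m')%MM)%N.
Proof.
rewrite /lord lowdegD mnmDE addnACA leq_add2l leq_divRL // mulnDl.
by apply: leq_add; apply: leq_divM.
Qed.

Lemma lord_geD m m' : (lord m <= lord (m + m')%MM)%N.
Proof. by apply: leq_trans (lordD _ _); apply: leq_addr. Qed.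

Lemma lordU m i : (lord (m + U_(i))%MM <= (lord m).+1)%N.
Proof.
rewrite /lord lowdegD lowdegU mnmDE mnm1E.
case hi: (low i).
  have -> : (i == vy) = false by apply/eqP => E; rewrite E /low /= ltnn in hi.
  rewrite addn0; lia.
rewrite /= addn0 -addnS leq_add2l.
apply: (@leq_trans ((m vy + a) %/ a)).
  by apply: leq_div2r; rewrite leq_add2l (leq_trans (leq_b1 _)).
by rewrite divnDr // divnn a_gt0 addn1.
Qed.

(** The monomials of [C ^ j] of degree at least [j * delta]; [LI_exp] identifies them with those of
    [L ^ j]. *)
Definition Lmon j m : bool := (j <= lord m)%N && (j * delta <= mdeg m)%N.
Definition LI : R -> Prop := supported (Lmon 1).

Lemma Lmon_up j : upclosed (Lmon j).
Proof.
move=> m m' /andP[h1 h2]; apply/andP; split; first exact: leq_trans h1 (lord_geD _ _).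
by rewrite mdegD; apply: leq_trans h2 (leq_addr _ _).
Qed.

Lemma LmonD i j m m' : Lmon i m -> Lmon j m' -> Lmon (i + j) (m + m')%MM.
Proof.
move=> /andP[h1 h2] /andP[h3 h4]; apply/andP; split.
  by apply: leq_trans (lordD _ _); apply: leq_add.
by rewrite mdegD mulnDl leq_add.
Qed.

Lemma LI_ideal : is_ideal LI.
Proof. exact/supported_ideal/Lmon_up. Qed.

Lemma mnm_subK i m : (0 < m i)%N -> (m - U_(i) + U_(i))%MM = m.
Proof. by move=> h; rewrite submK // lep1mP -lt0n. Qed.

(* A variable can be removed from [m] without lowering its order below [j]:
   if [m] has neither [z] nor spare powers of [y], then its degree is at most
   [lord m * delta], because [a <= delta]. *)
Lemma Lmon_remove j m : Lmon j m -> (j * delta < mdeg m)%N ->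
  exists2 i, (0 < m i)%N & Lmon j (m - U_(i))%MM.
Proof.
move=> /andP[h1 h2] h3.
have aux i : (0 < m i)%N -> (j <= lord (m - U_(i))%MM)%N ->
    exists2 i, (0 < m i)%N & Lmon j (m - U_(i))%MM.
  move=> hi hj; exists i; rewrite // /Lmon hj /=.
  by move: h3; rewrite -{1}(mnm_subK hi) mdegD mdeg1 addn1 ltnS.
have [h4|h4] := ltnP j (lord m).
  have: (0 < mdeg m)%N by lia.
  rewrite lt0n mdeg_eq0 => hm.
  have [i hi] := mnm_neq0 hm.
  apply: (aux i hi); rewrite -ltnS; apply: leq_trans h4 _.
  by rewrite -{1}(mnm_subK hi); apply: lordU.
have [hz|hz] := posnP (m vz); last first.
  apply: (aux vz hz); apply: leq_trans h1 _; rewrite /lord.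
  rewrite -{1 2}(mnm_subK hz) lowdegD lowdegU mnmDE mnm1E /=.
  have -> : low vz = false by rewrite /low /=; lia.
  have -> : (vz == vy) = false by rewrite -val_eqE /=; lia.
  by rewrite !addn0.
have [hy|hy] := posnP (m vy %% a); last first.
  have hy' : (0 < m vy)%N by case: (m vy) hy => //; rewrite mod0n.
  apply: (aux vy hy'); apply: leq_trans h1 _; rewrite /lord.
  rewrite -{1}(mnm_subK hy') lowdegD lowdegU.
  have -> : low vy = false by rewrite /low /=; lia.
  rewrite addn0 leq_add2l mnmBE mnm1E eqxx.
  rewrite leq_divRL //; have := divn_eq (m vy) a; lia.
move: h2 h3; rewrite mdeg_lord hz addn0 (divn_eq (m vy) a) hy addn0.
move: h1 h4; rewrite /lord; set q := (_ %/ a)%N; set l := lowdeg m => h1 h4 h2 h3.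
suff : (l + q * a <= j * delta)%N by lia.
have -> : j = (l + q)%N by lia.
rewrite mulnDl; apply: leq_add; last by rewrite leq_mul2l a_le orbT.
by rewrite leq_pmulr //; lia.
Qed.

Lemma Lmon_remove_many j r m : Lmon j m -> (j * delta + r <= mdeg m)%N ->
  exists m1 m2, [/\ m = (m1 + m2)%MM, mdeg m1 = r & Lmon j m2].
Proof.
elim: r m => [|r IH] m h1 h2; first by exists 0%MM, m; rewrite add0m mdeg0.
have [|i hi hm] := Lmon_remove h1; first by lia.
have hd : mdeg m = (mdeg (m - U_(i))%MM).+1.
  by rewrite -{1}(mnm_subK hi) mdegD mdeg1 addn1.
have [|m1 [m2 [E1 E2 E3]]] := IH _ hm; first by lia.
exists (m1 + U_(i))%MM, m2; split=> //; last by rewrite mdegD mdeg1 E2 addn1.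
by rewrite -(mnm_subK hi) E1 -!addmA [(U_(i) + m2)%MM]addmC.
Qed.

Lemma lord_generator j m : (j.+1 <= lord m)%N ->
  exists m1 m2, [/\ m = (m1 + m2)%MM, (0 < lord m1)%N, (mdeg m1 <= delta)%N & (j <= lord m2)%N].
Proof.
move=> h; have [hl|] := posnP (lowdeg m); last first.
  move=> /lowdeg_gt0[i li hi]; exists U_(i)%MM, (m - U_(i))%MM.
  rewrite addmC mnm_subK // /lord lowdegU li mdeg1; split=> //; first lia.
  rewrite -ltnS; apply: leq_trans h _.
  by rewrite -{1}(mnm_subK hi); apply: lordU.
have hy : (a <= m vy)%N.
  by rewrite leqNgt; apply/negP => /divn_small E; move: h; rewrite /lord hl E.
have E : m = (U_(vy) *+ a + (m - U_(vy) *+ a))%MM.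
  rewrite addmC submK //; apply/mnm_lepP => i; rewrite mulmnE mnm1E.
  by have [<-|] := eqVneq; rewrite ?mul1n.
exists (U_(vy) *+ a)%MM, (m - U_(vy) *+ a)%MM; split=> //.
- by rewrite /lord mulmnE mnm1E eqxx mul1n divnn a_gt0 addn1.
- by rewrite mdegMn mdeg1 mul1n.
move: h; rewrite /lord hl {1}E mnmDE mulmnE mnm1E eqxx mul1n divnDl ?dvdnn //.
rewrite divnn a_gt0; lia.
Qed.

(** A generator of C, of degree at most [delta], is split off; the cofactor has enough removable
    variables to bring it to degree exactly [delta]. *)
Lemma Lmon_split j m : Lmon j.+1 m ->
  exists m1 m2, [/\ m = (m1 + m2)%MM, mdeg m1 = delta, Lmon 1 m1 & Lmon j m2].
Proof.
move=> /andP[h1 h2]; have [m1 [m2 [E h3 h4 h5]]] := lord_generator h1.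
have hd : mdeg m = (mdeg m1 + mdeg m2)%N by rewrite E mdegD.
have h6 : Lmon j m2 by rewrite /Lmon h5 /=; move: h2; rewrite mulSn; lia.
have [|m3 [m4 [E1 E2 E3]]] := @Lmon_remove_many j (delta - mdeg m1) m2 h6.
  by move: h2; rewrite mulSn; lia.
have E4 : mdeg (m1 + m3)%MM = delta by rewrite mdegD E2 subnKC.
exists (m1 + m3)%MM, m4; split=> //; first by rewrite E E1 addmA.
rewrite /Lmon mul1n E4 leqnn andbT.
exact: leq_trans h3 (lord_geD _ _).
Qed.

Lemma LI_X m : Lmon 1 m -> LI 'X_[m].
Proof. exact: supportedX. Qed.

Lemma LI_exp j f : ideal_exp LI j f <-> supported (Lmon j) f.
Proof.
split.
  elim: j f => [|j IH] f /=; first by move=> _ m _; rewrite /Lmon mul0n.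
  have hI := supported_ideal k (@Lmon_up j.+1).
  apply: (ideal_mul_ind hI) => u v hu /IH hv.
  by apply: supportedM hu hv => m m'; apply: (@LmonD 1).
apply: supported_sub; first exact: ideal_exp_ideal.
move=> {f} m; elim: j m => // j IH m /Lmon_split[m1 [m2 [-> _ h1 h2]]].
by rewrite mpolyXD; apply: ideal_mul_in; [apply: LI_X | apply: IH].
Qed.

Lemma max_homog_exp j f : ideal_exp (@max_homog_ideal k d) j f <-> supported (fun m => (j <= mdeg m)%N) f.
Proof.
have up i : upclosed (fun m : 'X_{1..d} => (i <= mdeg m)%N).
  by move=> m m' h; rewrite mdegD; apply: leq_trans h (leq_addr _ _).
split.
  elim: j f => [|j IH] f //=.
  apply: (ideal_mul_ind (supported_ideal k (up j.+1))) => u v hu /IH hv.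
  apply: (@supportedM _ _ (fun m => (1 <= mdeg m)%N) (fun m => (j <= mdeg m)%N)) => //.
    by move=> m m'; rewrite mdegD; lia.
  apply: hu; first exact: supported_ideal.
  by move=> _ [i ->]; apply: supportedX; rewrite mdeg1.
apply: supported_sub; first exact: ideal_exp_ideal.
move=> {f} m; elim: j m => // j IH m h.
have [|i hi] := @mnm_neq0 d m; first by rewrite -mdeg_eq0; lia.
have hd : mdeg m = (mdeg (m - U_(i))%MM).+1.
  by rewrite -{1}(mnm_subK hi) mdegD mdeg1 addn1.
rewrite -(mnm_subK hi) addmC mpolyXD; apply: ideal_mul_in.
  by apply: ideal_gen_sub; exists i.
by apply: IH; lia.
Qed.

(** Turns the right-hand side of the theorem into a truncation of C: surplus variables of a monomial
    of C can be removed without leaving [L]. *)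
Lemma LI_mul_max j f :
  ideal_mul LI (ideal_exp max_homog_ideal j) f <->
  supported (fun m => (0 < lord m)%N && (delta + j <= mdeg m)%N) f.
Proof.
split.
  have up : upclosed (fun m => (0 < lord m)%N && (delta + j <= mdeg m)%N).
    move=> m m' /andP[h1 h2]; apply/andP; split; first exact: leq_trans h1 (lord_geD _ _).
    by rewrite mdegD; apply: leq_trans h2 (leq_addr _ _).
  apply: (ideal_mul_ind (supported_ideal k up)) => u v hu /max_homog_exp hv.
  apply: supportedM hu hv => m m' /andP[h1 h2] h3.
  rewrite (leq_trans h1 (lord_geD _ _)) mdegD; lia.
apply: supported_sub; first exact: ideal_mul_ideal.
move=> m /andP[h1 h2].
have hm : Lmon 1 m by rewrite /Lmon h1; lia.
have [|m1 [m2 [E E1 E2]]] := @Lmon_remove_many 1 j m hm; first by lia.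
rewrite E addmC mpolyXD; apply: ideal_mul_in; first exact: LI_X.
by apply/max_homog_exp/supportedX; rewrite E1.
Qed.

End LexIdeal.

(** * Exchanging elements of a regular sequence *)

Lemma nonroot_exists (k : fieldType) (char0 : [pchar k] =i pred0) (q : {poly k}) :
  q != 0 -> exists t, q.[t] != 0.
Proof.
move=> hq; pose s := [seq (i%:R : k) | i <- iota 0 (size q)].
case: (boolP (all (root q) s)) => hs; last first.
  by case/allPn: hs => t _ ht; exists t.
have: (size s < size q)%N.
  apply: max_poly_roots => //.
  rewrite map_inj_in_uniq ?iota_uniq // => i j _ _ /eqP.
  wlog hij : i j / (i <= j)%N.
    by move=> h; case/orP: (leq_total i j) => /h; [apply | rewrite eq_sym => h' /h' ->].
  rewrite eq_sym -subr_eq0 -natrB // => /eqP h0.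
  apply/eqP; rewrite eqn_leq hij /= -subn_eq0.
  by move/pcharf0P: char0 => /(_ (j - i)%N); rewrite h0 eqxx => <-.
by rewrite size_map size_iota ltnn.
Qed.

Lemma max_nat_exists (P : nat -> Prop) b : (exists i, P i) -> (forall i, P i -> (i <= b)%N) ->
  exists2 i, P i & forall j, P j -> (j <= i)%N.
Proof.
move=> [i0 h0] hb; elim: b hb => [|b IH] hb.
  exists i0 => // j /hb; have := hb _ h0; lia.
case: (classic (P b.+1)) => [h|h]; first by exists b.+1.
apply: IH => i hi; have := hb _ hi; rewrite leq_eqVlt => /orP[/eqP E|//].
by rewrite E in hi.
Qed.

Lemma min_nat_exists (P : nat -> Prop) : (exists i, P i) ->
  exists2 i, P i & forall j, P j -> (i <= j)%N.
Proof.
move=> [i0 h0]; elim: i0 {-2}i0 (leqnn i0) h0 => [|b IH] i hi h0.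
  by exists i => // j _; lia.
case: (classic (exists2 j, P j & (j < i)%N)) => [[j hj hji]|hn].
  by apply: (IH j) => //; lia.
exists i => // j hj; rewrite leqNgt; apply/negP => hji; apply: hn; by exists j.
Qed.

(** * Linear families of commuting matrices *)

Section CommutingMatrices.
Variable k : fieldType.
Hypothesis char0 : [pchar k] =i pred0.

Lemma det_pencil r (A B : 'M[k]_r) : A \in unitmx ->
  exists2 q : {poly k}, q != 0 & forall t, q.[t] != 0 -> A + t *: B \in unitmx.
Proof.
move=> hA; pose F := map_mx polyC A + 'X *: map_mx polyC B.
have ev t : (\det F).[t] = \det (A + t *: B).
  rewrite -horner_evalE -det_map_mx; congr (\det _).
  by apply/matrixP => i j; rewrite !mxE /= horner_evalE !hornerE.
exists (\det F) => [|t]; last by rewrite ev unitmxE unitfE.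
apply/eqP => h0; have := ev 0; rewrite h0 horner0 scale0r addr0 => /esym/eqP.
by move: hA; rewrite unitmxE unitfE => /negbTE ->.
Qed.

(** In the coordinates where [F0] is [pid_mx], its leading block stays invertible for generic [t];
    [copid_mx] completes this block to a square matrix, to which [det_pencil] applies. *)
Lemma rank_pencil r (F0 F1 : 'M[k]_r) :
  exists2 q : {poly k}, q != 0 & forall t, q.[t] != 0 ->
    (\rank F0 <= \rank (F0 + t *: F1)%R)%N.
Proof.
set rho := \rank F0; have hrho : (rho <= r)%N := rank_leq_row _.
pose p : 'M[k]_r := pid_mx rho.
pose G := invmx (col_ebase F0) *m F1 *m invmx (row_ebase F0).
have hpp : p *m p = p by rewrite pid_mx_id.
have h1 : p *m p *m p + copid_mx rho = 1%:M by rewrite !hpp /copid_mx addrC subrK.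
have hun : p *m p *m p + copid_mx rho \in unitmx by rewrite h1 unitmx1.
have [q q0 hq] := det_pencil (p *m G *m p) hun.
exists q => // t /hq.
set W := _ + _ => /mxrank_unit hW.
have EW : W = p *m (p + t *: G) *m p + copid_mx rho.
  by rewrite /W mulmxDr mulmxDl -scalemxAr -scalemxAl addrAC.
have E : invmx (col_ebase F0) *m (F0 + t *: F1) *m invmx (row_ebase F0) = p + t *: G.
  rewrite mulmxDr mulmxDl -scalemxAr -scalemxAl; congr (_ + _).
  rewrite -{2}(mulmx_ebase F0) !mulmxA mulVmx ?col_ebase_unit // mul1mx.
  by rewrite -mulmxA mulmxV ?row_ebase_unit // mulmx1.
have h2 : (\rank (p + t *: G)%R <= \rank (F0 + t *: F1)%R)%N.
  rewrite -E.
  by apply: leq_trans (mxrankM_maxl _ _) _; exact: mxrankM_maxr.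
have h3 : (r <= \rank (p *m (p + t *: G) *m p)%R + \rank (copid_mx rho : 'M[k]_r))%N.
  by rewrite -{1}hW EW; apply: mxrank_add.
have h4 : (\rank (p *m (p + t *: G) *m p)%R <= \rank (p + t *: G)%R)%N.
  by apply: leq_trans (mxrankM_maxl _ _) _; exact: mxrankM_maxr.
move: h3; rewrite rank_copid_mx // => h3; lia.
Qed.

Variables (r : nat) (Phi : 'M[k]_r -> Prop).
Hypothesis Phi_lin : forall A B c, Phi A -> Phi B -> Phi (A + c *: B).
Hypothesis Phi_inh : exists A, Phi A.
Hypothesis Phi_comm : forall A B, Phi A -> Phi B -> A *m B = B *m A.
Hypothesis Phi_ker : forall xi : 'rV[k]_r, (forall A, Phi A -> xi *m A = 0) -> xi = 0.

Let pw (A : 'M[k]_r) N : 'M[k]_r := iter N (mulmx A) 1%:M.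

Let pwS A N : pw A N.+1 = A *m pw A N. Proof. by []. Qed.

Let pwD A M N : pw A (M + N) = pw A M *m pw A N.
Proof. by elim: M => [|M IH]; rewrite ?mul1mx // addSn !pwS IH mulmxA. Qed.

Let pw_comm A B N : A *m B = B *m A -> pw A N *m B = B *m pw A N.
Proof.
move=> h; elim: N => [|N IH]; first by rewrite mul1mx mulmx1.
by rewrite pwS -mulmxA IH !mulmxA h.
Qed.

Let srank A rho := exists N, forall M, (N <= M)%N -> \rank (pw A M) = rho.

Let srank_exists A : exists rho, srank A rho.
Proof.
have [rho [N hN] hmin] := @min_nat_exists (fun rho => exists N, \rank (pw A N) = rho)
  (ex_intro _ _ (ex_intro _ 0%N erefl)).
exists rho, N => M hM; apply/eqP; rewrite eqn_leq; apply/andP; split; last first.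
  by apply: hmin; exists M.
by rewrite -hN -(subnK hM) pwD mxrankM_maxr.
Qed.

(** Take a member of maximal stable rank. If singular, it is nilpotent on the kernel of a high
    power, hence zero on a minimal invariant subspace there; adding a generic multiple of a member
    acting nontrivially on this subspace raises the stable rank. Minimal invariant subspaces replace
    common eigenvectors, since [k] need not be algebraically closed. *)
Lemma commuting_unit : exists2 A, Phi A & A \in unitmx.
Proof.
have [||rho [A [hA [N0 hN0]]] hmax] :=
    @max_nat_exists (fun rho => exists A, Phi A /\ srank A rho) r.
- have [A hA] := Phi_inh; have [rho h] := srank_exists A; by exists rho, A.
- by move=> i [A [_ [N hN]]]; rewrite -(hN N) // rank_leq_row.
(* The exponent is positive, so that [A] is a factor of [P] and is a unit as soon as [P] is. *)
exists A => //; set N := N0.+1; set P := pw A N.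
have rP : \rank P = rho by apply: hN0; rewrite /N.
case: (eqVneq (kermx P) 0) => hK.
  have : row_free P by rewrite -kermx_eq0 hK.
  by rewrite row_free_unit /P pwS unitmx_mul => /andP[].
have Pcomm B : Phi B -> P *m B = B *m P by move=> hB; apply: pw_comm; apply: Phi_comm.
pose good (E : 'M[k]_r) := [/\ E != 0, (E <= kermx P)%MS & forall B, Phi B -> (E *m B <= E)%MS].
have [|rE [E [gE rkE]] Emin] := @min_nat_exists (fun i => exists E, good E /\ \rank E = i).
  exists (\rank (kermx P)), (kermx P); split=> //; split=> // B hB.
  by apply/sub_kermxP; rewrite -mulmxA -Pcomm // mulmxA mulmx_ker mul0mx.
case: gE => E0 EK Est.
(* By minimality of [E], a member of the family either kills [E] or maps it onto itself. *)
have stab B : Phi B -> E *m B != 0 -> (E <= E *m B)%MS.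
  move=> hB h; rewrite -(mxrank_leqif_sup (Est B hB)).
  rewrite eqn_leq mxrankM_maxl /= rkE; apply: Emin; exists (E *m B); split=> //; split=> //.
    exact: submx_trans (Est _ hB) EK.
  by move=> C hC; rewrite -mulmxA (Phi_comm hB hC) mulmxA submxMr // Est.
have EA : E *m A = 0.
  apply/eqP; apply/negP => /negP h; case/negP: E0.
  have h1 M : (E <= E *m pw A M)%MS.
    elim: M => [|M IH]; first by rewrite mulmx1.
    by rewrite pwS mulmxA; apply: submx_trans IH _; rewrite submxMr // stab.
  move: (h1 N); rewrite -/P; have/sub_kermxP -> := EK; by rewrite submx0.
have [u hu Eu] : exists2 u, Phi u & E *m u != 0.
  apply: NNPP => hn; case/negP: E0; apply/eqP/row_matrixP => i; rewrite row0.
  apply: Phi_ker => B hB; rewrite -row_mul.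
  have -> : E *m B = 0 by apply/eqP; apply/negPn/negP => h; apply: hn; exists B.
  by rewrite row0.
(* For generic [t], [A + t *: u] is bijective both on the row space of [P] and on [E], so its stable
   rank is at least the sum of the two ranks. *)
have [q q0 hq] := rank_pencil (P *m A) (P *m u).
have [t] := nonroot_exists char0 (mulf_neq0 (monic_neq0 (monicX k)) q0).
rewrite hornerM hornerX mulf_eq0 negb_or => /andP[t0 /hq].
have -> : \rank (P *m A) = rho.
  by rewrite /P (pw_comm _ erefl) -pwS; apply: hN0; rewrite /N; lia.
set B := A + t *: u.
rewrite scalemxAr -mulmxDr -/B => rPB.
have hB : Phi B by apply: Phi_lin.
have YB : (P <= P *m B)%MS.
  have h : (P *m B <= P)%MS by rewrite Pcomm // submxMl.
  by rewrite -(mxrank_leqif_sup h) eqn_leq mxrankS //= rP.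
have YBM M : (P <= pw B M)%MS.
  elim: M => [|M IH]; first exact: submx1.
  rewrite pwS -(pw_comm M erefl); apply: submx_trans YB _; exact: submxMr.
have EB : (E <= E *m B)%MS.
  have E1 : E *m B = t *: (E *m u) by rewrite /B mulmxDr EA add0r scalemxAr.
  by rewrite E1; apply: submx_trans (stab _ hu Eu) _; rewrite eqmx_scale.
have EBM M : (E <= pw B M)%MS.
  elim: M => [|M IH]; first exact: submx1.
  rewrite pwS -(pw_comm M erefl); apply: submx_trans EB _; exact: submxMr.
have capK : (P :&: kermx P)%MS = 0.
  apply/eqP; rewrite -mxrank_eq0; have := mxrank_mul_ker P P.
  rewrite -{1}pwD hN0 ?rP; last by rewrite /N; lia.
  move=> h; apply/eqP; lia.
have capE : (P :&: E)%MS = 0.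
  by apply/eqP; rewrite -submx0 -capK capmxS.
have [rB [NB hNB]] := srank_exists B.
have : (rB <= rho)%N by apply: hmax; exists B; split=> //; exists NB.
have : (rho + \rank E <= rB)%N.
  rewrite -rP -(hNB NB) // -mxrank_disjoint_sum //.
  by apply: mxrankS; rewrite addsmx_sub YBM EBM.
have : (0 < \rank E)%N by rewrite lt0n mxrank_eq0.
lia.
Qed.

End CommutingMatrices.

(** * Regular sequences of forms *)

Section RegularSequences.
Variables (d : nat) (k : fieldType).
Local Notation R := {mpoly k[d]}.
Implicit Types (I B : R -> Prop) (f g h u v w : R).

Definition adj I g : R -> Prop := fun u => exists h, I (u - h * g).

Definition reg I g : Prop := forall u, I (g * u) -> I u.

Lemma adj_ideal I g : is_ideal I -> is_ideal (adj I g).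
Proof.
move=> hI; split=> [|f f' [h hh] [h' hh']|b f [h hh]].
- by exists 0; rewrite mul0r subr0; apply: ideal0.
- exists (h + h').
  have -> : f + f' - (h + h') * g = (f - h * g) + (f' - h' * g) by ring.
  exact: idealD.
- exists (b * h); have -> : b * f - b * h * g = b * (f - h * g) by ring.
  exact: ideal_mulL.
Qed.

Lemma sub_adj I g u : I u -> adj I g u.
Proof. by exists 0; rewrite mul0r subr0. Qed.

Lemma adj_mem I g : is_ideal I -> adj I g g.
Proof. by exists 1; rewrite mul1r subrr; apply: ideal0. Qed.

Lemma adj_min I J g u : is_ideal J -> subideal I J -> J g -> adj I g u -> J u.
Proof.
move=> hJ hIJ hg [h /hIJ hh]; rewrite -[u](subrK (h * g)); apply: idealD => //.
exact: ideal_mulL.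
Qed.

Lemma adj_hom I e g : hom_ideal I -> g \is e.-homog -> hom_ideal (adj I g).
Proof.
move=> [hI hc] hg; split=> [|j u [h hh]]; first exact: adj_ideal.
have [hj|hj] := leqP e j.
  exists (hcomp (j - e)%N h); rewrite -(compM_homog (j - e)%N h hg) subnK // -raddfB.
  exact: hc.
by apply: sub_adj; have := hc j _ hh; rewrite raddfB /= (compM_homog_lt _ hg hj) subr0.
Qed.

Lemma adjC I g v : is_ideal I -> adj (adj I g) v = adj (adj I v) g.
Proof.
move=> hI; apply: functional_extensionality => u; apply: propositional_extensionality.
by split=> -[h [h' hh]]; exists h', h; rewrite addrAC.
Qed.

(** A graded Krull intersection argument: if [v * u] lies in [I], then [u] is divisible modulo [I]
    by every power of [g], and in a fixed degree a high power of [g] contributes nothing. *)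
Lemma reg_swap I e e' g v : hom_ideal I -> g \is e.-homog -> (0 < e)%N ->
  v \is e'.-homog -> reg I g -> reg (adj I g) v -> reg I v /\ reg (adj I v) g.
Proof.
move=> [hI hc] hg e0 hv rg rv; split=> u.
  move=> hu; apply: comp_ideal => // j.
  have {}hu : I (v * hcomp j u).
    by rewrite mulrC -(compM_homog j u hv) mulrC; apply: hc.
  have: forall N, exists w, I (hcomp j u - g ^+ N * w) /\ I (v * w).
    elim=> [|N [w [h1 h2]]].
      by exists (hcomp j u); rewrite expr0 mul1r subrr; split=> //; apply: ideal0.
    have [h hh] : adj I g w by apply: rv; apply: sub_adj.
    exists h; split.
      have -> : hcomp j u - g ^+ N.+1 * h = hcomp j u - g ^+ N * w + g ^+ N * (w - h * g).
        by rewrite exprS; ring.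
      by apply: idealD => //; apply: ideal_mulL.
    apply: rg; have -> : g * (v * h) = v * w - v * (w - h * g) by ring.
    by apply: idealB => //; apply: ideal_mulL.
  move=> /(_ j.+1) [w [/(hc j) h1 _]]; move: h1.
  rewrite raddfB /= pihomog_id mulrC.
  by rewrite (@compM_homog_lt _ _ j _ w _ (dhomogMn j.+1 hg)) ?subr0 //; nia.
move=> [h hh].
have [h' hh'] : adj I g h.
  apply: rv; exists u; have -> : v * h - u * g = - (g * u - h * v) by ring.
  exact: idealN.
exists h'; apply: rg.
have -> : g * (u - h' * v) = (g * u - h * v) + v * (h - h' * g) by ring.
by apply: idealD => //; apply: ideal_mulL.
Qed.

Fixpoint adjs I (s : seq R) : R -> Prop := if s is g :: s' then adjs (adj I g) s' else I.

Fixpoint regseq I (s : seq R) : Prop :=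
  if s is g :: s' then reg I g /\ regseq (adj I g) s' else True.

Definition pos_homog f : Prop := exists2 e, (0 < e)%N & f \is e.-homog.

Lemma regseq_front I s1 x s2 : hom_ideal I ->
  (forall f, f \in s1 ++ x :: s2 -> pos_homog f) ->
  regseq I (s1 ++ x :: s2) -> regseq I (x :: s1 ++ s2).
Proof.
elim: s1 I => //= g s1 IH I hI hs [rg hreg].
have [e e0 hg] : pos_homog g by apply: hs; rewrite inE eqxx.
have [e' e'0 hx] : pos_homog x by apply: hs; rewrite inE mem_cat inE eqxx !orbT.
have [|rx hr] := IH _ (adj_hom hI hg) _ hreg.
  by move=> f hf; apply: hs; rewrite inE hf orbT.
have [h1 h2] := reg_swap hI hg e0 hx rg rx.
by split=> //; split=> //; rewrite adjC //; case: hI.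
Qed.

Lemma adjs_front I s1 x s2 : is_ideal I -> adjs I (s1 ++ x :: s2) = adjs I (x :: s1 ++ s2).
Proof.
elim: s1 I => //= g s1 IH I hI; rewrite IH /=; last exact: adj_ideal.
by rewrite adjC.
Qed.

Lemma regseq_perm I s t : hom_ideal I -> (forall f, f \in s -> pos_homog f) ->
  perm_eq s t -> regseq I s -> regseq I t /\ adjs I s = adjs I t.
Proof.
elim: t s I => [|x t IH] s I hI hs hst hreg.
  by move/perm_nilP: hst => ->.
have xs : x \in s by rewrite (perm_mem hst) inE eqxx.
case/splitPr: xs hst hs hreg => s1 s2 hst hs /(regseq_front hI hs) /= [rx hreg].
have [e e0 hx] : pos_homog x by apply: hs; rewrite mem_cat inE eqxx orbT.
have [||h1 h2] := IH (s1 ++ s2) _ (adj_hom hI hx) _ _ hreg.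
- by move=> f hf; apply: hs; move: hf; rewrite !mem_cat inE => /orP[->|->]; rewrite ?orbT.
- by move: hst; rewrite perm_catC /= perm_cons perm_catC.
by split=> //; rewrite adjs_front //=; case: hI.
Qed.

Lemma regseq_rcons I s x : regseq I (rcons s x) <-> regseq I s /\ reg (adjs I s) x.
Proof. by elim: s I => [|g s IH] I /=; [split=> [[]|[]] | rewrite IH; split=> [[? []]|[[]]]]. Qed.

Lemma adjs_rcons I s x : adjs I (rcons s x) = adj (adjs I s) x.
Proof. by elim: s I => /=. Qed.

Lemma adjs_hom I s : hom_ideal I -> (forall f, f \in s -> pos_homog f) -> hom_ideal (adjs I s).
Proof.
elim: s I => //= g s IH I hI hs.
have [e _ hg] : pos_homog g by apply: hs; rewrite inE eqxx.
apply: IH; first exact: adj_hom hg.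
by move=> f hf; apply: hs; rewrite inE hf orbT.
Qed.

Lemma sub_adjs I s u : I u -> adjs I s u.
Proof. by elim: s I => //= g s IH I hu; apply/IH/sub_adj. Qed.

Lemma adjs_mem I s g : is_ideal I -> g \in s -> adjs I s g.
Proof.
elim: s I => //= x s IH I hI; rewrite inE => /orP[/eqP ->|].
  exact/sub_adjs/adj_mem.
by apply: IH; apply: adj_ideal.
Qed.

Lemma adjs_min I J s u : is_ideal J -> subideal I J -> (forall g, g \in s -> J g) ->
  adjs I s u -> J u.
Proof.
elim: s I => //= [|x s IH] I hJ hIJ hs; first exact: hIJ.
apply: IH => //; last by move=> g hg; apply: hs; rewrite inE hg orbT.
by move=> f; apply: adj_min => //; apply: hs; rewrite inE eqxx.
Qed.

Lemma hom_ideal0 : hom_ideal (fun f : R => f = 0).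
Proof.
split; last by move=> e f ->; rewrite raddf0.
by split=> // [f g -> ->|b f ->]; rewrite ?addr0 ?mulr0.
Qed.

Lemma reg_exp I g N : reg I g -> reg I (g ^+ N).
Proof.
move=> rg; elim: N => [|N IH] u; first by rewrite mul1r.
by rewrite exprS -mulrA => /rg /IH.
Qed.

(** Provides coordinates on a finite-dimensional piece of the quotient by [B], while [B] stays a
    mere predicate. *)
Lemma basis_mod (B : R -> Prop) (s : seq R) : is_ideal B ->
  exists r (e : 'I_r -> R),
   [/\ forall i, e i \in s,
       forall c : 'rV[k]_r, B (\sum_i c 0 i *: e i) -> c = 0
     & forall x, x \in s -> exists c : 'rV[k]_r, B (x - \sum_i c 0 i *: e i)].
Proof.
move=> hB; elim: s => [|x s [r [e [es ind span]]]].
  exists 0%N, (fun=> 0); split=> // [[] //|c _]; exact: thinmx0.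
case: (classic (exists c : 'rV[k]_r, B (x - \sum_i c 0 i *: e i))) => hx.
  exists r, e; split=> // [i|y]; first by rewrite inE es orbT.
  by rewrite inE => /orP[/eqP ->|/span].
exists r.+1, (fun i => oapp e x (unlift ord0 i)); split.
- by move=> i; case: unliftP => [j|] _ /=; rewrite inE ?es ?orbT ?eqxx.
- move=> c; rewrite big_ord_recl /= unlift_none /=.
  under eq_bigr do rewrite liftK /=.
  have [c0|c0] := eqVneq (c 0 ord0) 0.
    rewrite c0 scale0r add0r => h.
    have := ind (\row_j c 0 (lift ord0 j)).
    under eq_bigr do rewrite mxE.
    move=> /(_ h) /rowP h'; apply/rowP => j; rewrite mxE.
    by case: (unliftP ord0 j) => [j'|] -> //; have := h' j'; rewrite !mxE.
  move=> h; case: hx; exists (\row_j (- (c 0 ord0)^-1 * c 0 (lift ord0 j))).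
  have := idealZ (c 0 ord0)^-1 hB h.
  rewrite scalerDr scalerA mulVf // scale1r scaler_sumr -sumrN => h2.
  rewrite (eq_bigr (fun i => (c 0 ord0)^-1 *: (c 0 (lift ord0 i) *: e i))) // => i _.
  by rewrite mxE scalerA -scaleNr mulNr opprK.
move=> y; rewrite inE => /orP[/eqP ->|/span [c hc]].
  exists (\row_j (j == ord0)%:R); rewrite big_ord_recl /= unlift_none /= mxE eqxx scale1r.
  rewrite big1 ?addr0 ?subrr; first exact: ideal0.
  by move=> i _; rewrite mxE scale0r.
exists (\row_j oapp (fun i => c 0 i) 0 (unlift ord0 j)).
rewrite big_ord_recl /= mxE unlift_none /= scale0r add0r.
by under eq_bigr do rewrite mxE liftK /=.
Qed.

End RegularSequences.

(** * Replacing the last member of a regular sequence *)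

Section Exchange.
Variables (d : nat) (k : fieldType).
Local Notation R := {mpoly k[d]}.
Implicit Types (f g h u v w : R).
Hypothesis char0 : [pchar k] =i pred0.

Lemma homogX m : ('X_[m] : R) \is (mdeg m).-homog.
Proof. by rewrite dhomogX. Qed.

Lemma finite_monomials j : exists s : seq R,
  (forall f, f \in s -> f \is j.-homog) /\
  (forall m, mdeg m = j -> 'X_[m] \in s).
Proof.
exists [seq 'X_[val m] | m <- enum {: 'X_{1..d < j.+1}} & mdeg (val m) == j]; split.
  by move=> f /mapP[m]; rewrite mem_filter => /andP[/eqP hm _] ->; rewrite -[X in X.-homog]hm; apply: homogX.
move=> m hm; have hlt : (mdeg m < j.+1)%N by rewrite hm.
apply/mapP; exists (BMultinom hlt) => //.
by rewrite mem_filter /= hm eqxx mem_enum.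
Qed.

Lemma mnm_split_deg (m : 'X_{1..d}) e : (e <= mdeg m)%N ->
  exists m1 m2, m = (m1 + m2)%MM /\ mdeg m1 = e.
Proof.
elim: e => [|e IH] h; first by exists 0%MM, m; rewrite add0m mdeg0.
have [|m1 [m2 [E1 E2]]] := IH; first exact: ltnW.
have [|i hi] := @mnm_neq0 d m2.
  by rewrite -mdeg_eq0; move: h; rewrite E1 mdegD E2; lia.
exists (m1 + U_(i))%MM, (m2 - U_(i))%MM; split; last by rewrite mdegD mdeg1 E2 addn1.
by rewrite E1 -addmA [(U_(i) + _)%MM]addmC submK // lep1mP -lt0n.
Qed.

Lemma homog_sub_ideal (I : R -> Prop) e f : is_ideal I ->
  (forall m, mdeg m = e -> I 'X_[m]) -> forall j, (e <= j)%N -> f \is j.-homog -> I f.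
Proof.
move=> hI hm j hj /homogP; apply: supported_sub => // m /eqP E.
have [|m1 [m2 [-> E1]]] := @mnm_split_deg m e; first by rewrite E.
by rewrite mpolyXD; apply: (ideal_mulR _ hI); apply: hm.
Qed.

Variables (B : R -> Prop) (delta sigma tau : nat) (g : R) (V : R -> Prop).
Hypothesis hB : hom_ideal B.
Hypothesis delta_gt0 : (0 < delta)%N.
Hypothesis tauE : (tau + delta = sigma.+1)%N.
Hypothesis g_homog : g \is delta.-homog.
Hypothesis g_reg : reg B g.
Hypothesis g_bound : forall j u, (sigma < j)%N -> u \is j.-homog -> adj B g u.
Hypothesis V_homog : forall v, V v -> v \is delta.-homog.
Hypothesis V_lin : forall v w c, V v -> V w -> V (v + c *: w).
Variable j0 : nat.
Hypothesis V_big : forall j u, (j0 <= j)%N -> u \is j.-homog ->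
  ideal_gen (fun f => B f \/ V f) u.
Variable eta : R -> k.
Hypothesis eta_lin : forall v w c, eta (v + c *: w) = eta v + c * eta w.
Variable h0 : R.
Hypothesis V_h0 : V h0.
Hypothesis eta_h0 : eta h0 != 0.

Let idB : is_ideal B. Proof. by case: hB. Qed.

(* Multiplication by [g] is bijective from degree [tau] to degree [tau + delta]
   modulo [B]; composing its inverse with multiplication by the elements of [V]
   gives commuting matrices, one of which is invertible. *)
Lemma exchange : exists v, [/\ V v, eta v != 0, reg B v
  & forall j u, (sigma < j)%N -> u \is j.-homog -> adj B v u].
Proof.
have [s [hs1 hs2]] := finite_monomials tau.
have [r [e [es ind span]]] := basis_mod s idB.
pose comb (c : 'rV[k]_r) : R := \sum_i c 0 i *: e i.
have combD c c' : comb (c + c') = comb c + comb c'.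
  by rewrite /comb -big_split; apply: eq_bigr => i _; rewrite mxE scalerDl.
have combZ x c : comb (x *: c) = x *: comb c.
  by rewrite /comb scaler_sumr; apply: eq_bigr => i _; rewrite mxE scalerA.
have combB c c' : comb (c - c') = comb c - comb c'.
  by rewrite combD -scaleN1r combZ scaleN1r.
have combH c : comb c \is tau.-homog.
  by apply: rpred_sum => i _; apply: rpredZ; apply/hs1/es.
have comb_inj c c' : B (comb c - comb c') -> c = c'.
  by rewrite -combB => /ind /eqP; rewrite subr_eq0 => /eqP.
have comb_surj u : u \is tau.-homog -> exists c, B (u - comb c).
  move=> hu; pose I f := exists c, B (f - comb c).
  have I0 : I 0.
    exists 0; rewrite sub0r /comb big1 ?oppr0; first exact: ideal0.
    by move=> i _; rewrite mxE scale0r.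
  have ID f f' : I f -> I f' -> I (f + f').
    move=> [c h] [c' h']; exists (c + c'); rewrite combD.
    have -> : f + f' - (comb c + comb c') = (f - comb c) + (f' - comb c') by ring.
    exact: idealD.
  have IZ x f : I f -> I (x *: f).
    by move=> [c h]; exists (x *: c); rewrite combZ -scalerBr; apply: idealZ.
  rewrite -/(I u) (mpolyE u) big_seq; apply: (big_ind I) => // m hm.
  apply: IZ; apply: span; apply: hs2.
  by move/dhomogP: hu => /(_ m hm).
have step j u : u \is (tau + delta + j).-homog ->
    exists2 w, w \is (tau + j).-homog & B (u - g * w).
  move=> hu; have [|h hh] := g_bound _ hu; first by rewrite -tauE; lia.
  exists (hcomp (tau + j) h); first exact: pihomogP.
  have := (proj2 hB) (tau + delta + j)%N _ hh; rewrite raddfB /= pihomog_dE //.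
  by rewrite addnAC (compM_homog _ _ g_homog) mulrC.
have comb_pow q u : u \is (tau + q * delta).-homog -> exists c, B (u - g ^+ q * comb c).
  elim: q u => [|q IH] u hu; first by rewrite mul0n addn0 in hu; have [c hc] := comb_surj _ hu; exists c; rewrite expr0 mul1r.
  have [|w hw hBw] := step (q * delta)%N u; first by rewrite -addnA -mulSn.
  have [c hc] := IH _ hw; exists c.
  have -> : u - g ^+ q.+1 * comb c = (u - g * w) + g * (w - g ^+ q * comb c).
    by rewrite exprS; ring.
  by apply: idealD => //; apply: ideal_mulL.
(* [A] is the matrix of the quotient [v / g], acting on degree [tau] modulo [B]. *)
pose rel v (A : 'M[k]_r) := forall c, B (v * comb c - g * comb (c *m A)).
have rel_exists v : V v -> exists A, rel v A.
  move=> hv; have h1 (i : 'I_r) : exists c, B (v * e i - g * comb c).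
    have hu : v * e i \is (tau + delta + 0)%N.-homog.
      by rewrite addn0 addnC; apply: dhomogM; [apply: V_homog | apply/hs1/es].
    have [w hw hBw] := step 0%N _ hu; rewrite addn0 in hw.
    have [c hc] := comb_surj _ hw; exists c.
    have -> : v * e i - g * comb c = (v * e i - g * w) + g * (w - comb c) by ring.
    by apply: idealD => //; apply: ideal_mulL.
  have [F hF] := fin_all_exists h1; exists (\matrix_i F i) => c.
  have -> : comb (c *m \matrix_i F i) = \sum_i c 0 i *: comb (F i).
    rewrite mulmx_sum_row /comb; under [RHS]eq_bigr do rewrite scaler_sumr.
    rewrite exchange_big /=; apply: eq_bigr => j _.
    rewrite summxE scaler_suml; apply: eq_bigr => i _.
    by rewrite rowK mxE scalerA.
  rewrite mulr_sumr mulr_sumr -sumrB; apply: ideal_sum => // i _.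
  by rewrite -!scalerAr -scalerBr; apply: idealZ.
have rel_lin v w A A' x : rel v A -> rel w A' -> rel (v + x *: w) (A + x *: A').
  move=> h h' c; rewrite mulmxDr -scalemxAr combD combZ mulrDl -scalerAl mulrDr -scalerAr.
  have -> : v * comb c + x *: (w * comb c) - (g * comb (c *m A) + x *: (g * comb (c *m A')))
     = (v * comb c - g * comb (c *m A)) + x *: (w * comb c - g * comb (c *m A')).
    by rewrite scalerBr; ring.
  by apply: idealD => //; apply: idealZ.
have rel_comm v w A A' : rel v A -> rel w A' -> A *m A' = A' *m A.
  move=> h h'; apply/row_matrixP => i; rewrite !rowE.
  apply: comb_inj; apply: g_reg; apply: g_reg; set c := delta_mx 0 i.
  have -> : g * (g * (comb (c *m (A *m A')) - comb (c *m (A' *m A)))) =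
     v * (w * comb c - g * comb (c *m A')) + g * (v * comb (c *m A') - g * comb (c *m A' *m A))
     - w * (v * comb c - g * comb (c *m A)) - g * (w * comb (c *m A) - g * comb (c *m A *m A')).
    by rewrite !mulmxA; ring.
  by apply: idealB => //; [apply: idealB => //; [apply: idealD => //|]|]; apply: ideal_mulL.
have pow_inj q c c' : B (g ^+ q * comb c - g ^+ q * comb c') -> c = c'.
  by rewrite -mulrBr => /(reg_exp g_reg) /comb_inj.
(* The transposes enter because [commuting_unit] asks for the absence of a common row kernel,
   whereas here the images of the matrices are shown to span, so that no nonzero column is killed by
   all of them. *)
have [||||A [v [hv hrel]] hA] := @commuting_unit k char0 r (fun A => exists v, V v /\ rel v A^T).
- move=> A A' x [v [hv hr]] [w [hw hr']]; exists (v + x *: w); split; first exact: V_lin.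
  by rewrite raddfD /= linearZ; apply: rel_lin.
- by have [A hA] := rel_exists _ V_h0; exists A^T, h0; rewrite trmxK.
- move=> A A' [v [hv hr]] [w [hw hr']]; apply: trmx_inj; rewrite !trmx_mul.
  exact: rel_comm hr' hr.
- move=> xi hxi; suff h (c : 'rV[k]_r) : c *m xi^T = 0.
    by apply: trmx_inj; rewrite trmx0 -[xi^T]mul1mx; apply/row_matrixP => i; rewrite row_mul h row0.
  (* [Q] is an ideal containing [B] and [V], hence all forms of large degree; applied to
     [g ^+ q.+1 * comb c] it forces [c] into the kernel of [xi^T]. *)
  pose Q f := forall q h, exists c, c *m xi^T = 0 /\
    B (hcomp (tau + q.+1 * delta) (h * f) - g ^+ q.+1 * comb c).
  have hQ : is_ideal Q.
    split.
    - move=> q h; exists 0; rewrite mul0mx mulr0 raddf0 sub0r; split=> //.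
      have -> : comb 0 = 0 by rewrite -(scale0r 0) combZ scale0r.
      by rewrite mulr0 oppr0; apply: ideal0.
    - move=> f f' h1 h2 q h; have [c1 [E1 B1]] := h1 q h; have [c2 [E2 B2]] := h2 q h.
      exists (c1 + c2); rewrite mulmxDl E1 E2 addr0; split=> //.
      rewrite combD mulrDr raddfD /= [g ^+ _ * _]mulrDr opprD addrACA; exact: idealD.
    - move=> b f h1 q h; have [c1 h2] := h1 q (h * b); exists c1.
      by rewrite -mulrA in h2.
  pose q := j0; have hu : g ^+ q.+1 * comb c \is (tau + q.+1 * delta).-homog.
    by rewrite addnC mulnC; apply: dhomogM => //; apply: dhomogMn.
  have: Q (g ^+ q.+1 * comb c).
    apply: (V_big _ hu) => //; first by nia.
    move=> f [hf|hf] q' h.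
      exists 0; rewrite mul0mx; split=> //.
      have -> : comb 0 = 0 by rewrite -(scale0r 0) combZ scale0r.
      by rewrite mulr0 subr0; apply: (proj2 hB); apply: ideal_mulL.
    rewrite (_ : (tau + q'.+1 * delta)%N = (tau + q' * delta + delta)%N); last by lia.
    rewrite (compM_homog _ _ (V_homog hf)).
    have [c' hc'] := comb_pow q' _ (pihomogP mdeg (tau + q' * delta)%N h).
    have [A hA] := rel_exists _ hf.
    exists (c' *m A); split.
      rewrite -mulmxA -[A *m _]trmxK trmx_mul trmxK hxi ?trmx0 ?mulmx0 //.
      by exists f; rewrite trmxK.
    set w := hcomp _ h in hc' *.
    have -> : w * f - g ^+ q'.+1 * comb (c' *m A) =
       f * (w - g ^+ q' * comb c') + g ^+ q' * (f * comb c' - g * comb (c' *m A)).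
      by rewrite exprS; ring.
    by apply: idealD => //; apply: ideal_mulL.
  move=> /(_ q 1) [c' [E]]; rewrite mul1r pihomog_dE // => /pow_inj ->.
  exact: E.
have [A' hA'] := rel_exists _ V_h0.
have hA2 : A^T \in unitmx by rewrite unitmx_tr.
(* The unit just found may have [eta v = 0]; a generic combination with [h0] avoids this and stays
   invertible. *)
have [qq qq0 hqq] := det_pencil A' hA2.
have lin0 : (eta v)%:P + (eta h0) *: 'X != 0.
  apply/eqP => /(congr1 (fun p : {poly k} => p`_1)).
  rewrite coefD coefC coefZ coefX add0r mulr1 coef0 => /eqP.
  by rewrite (negbTE eta_h0).
have [t] := nonroot_exists char0 (mulf_neq0 qq0 lin0).
rewrite hornerM mulf_eq0 negb_or => /andP[/hqq ht1 ht2].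
set v' := v + t *: h0; set A1 := A^T + t *: A'; rewrite -/A1 in ht1.
have hr : rel v' A1 by apply: rel_lin.
have hV : V v' by apply: V_lin.
exists v'; split=> //.
- by move: ht2; rewrite !hornerE /v' eta_lin mulrC.
- move=> u hu; apply: comp_ideal => // j.
  have {}hu : B (v' * hcomp j u).
    by rewrite mulrC -(compM_homog j u (V_homog hV)) mulrC; apply: (proj2 hB).
  have injq q w : w \is (tau + q * delta).-homog -> B (v' * w) -> B w.
    move=> hw hBw; have [c hc] := comb_pow q w hw.
    have: B (g ^+ q.+1 * comb (c *m A1) - g ^+ q.+1 * comb 0).
      have -> : comb 0 = 0 by rewrite -(scale0r 0) combZ scale0r.
      have -> : g ^+ q.+1 * comb (c *m A1) - g ^+ q.+1 * 0 =
         v' * w - v' * (w - g ^+ q * comb c) - g ^+ q * (v' * comb c - g * comb (c *m A1)).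
        by rewrite exprS; ring.
      by apply: idealB => //; [apply: idealB => //|]; apply: ideal_mulL.
    move=> /pow_inj hc0.
    have c0 : c = 0 by rewrite -(mulmxK ht1 c) hc0 mul0mx.
    by move: hc; rewrite c0 (_ : comb 0 = 0) ?mulr0 ?subr0 // -(scale0r 0) combZ scale0r.
  (* Injectivity of [v'] is known only in degrees [tau + q * delta]. The monomials of degree [e0]
     lead to such a degree, and the ideal they generate contains a power of the regular element
     [g]. *)
  pose q := j; pose e0 := (tau + q * delta - j)%N.
  have hj : (j + e0 = tau + q * delta)%N by rewrite /e0 subnKC //; rewrite /q; nia.
  have hk (m : 'X_{1..d}) : mdeg m = e0 -> B (hcomp j u * 'X_[m]).
    move=> hm; apply: (injq q); last by rewrite mulrA; apply: ideal_mulR.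
    by rewrite -hj; apply: dhomogM; [apply: pihomogP | rewrite -hm; apply: homogX].
  apply: (reg_exp (N := e0) g_reg); rewrite mulrC.
  apply: (homog_sub_ideal (ideal_colon (hcomp j u) idB) hk (j := (delta * e0)%N)).
    by rewrite leq_pmull.
  exact: dhomogMn.
move=> j u hj hu.
apply: (homog_sub_ideal (adj_ideal v' idB) _ hj hu) => m hm.
have hX : ('X_[m] : R) \is (tau + 1 * delta).-homog by rewrite mul1n tauE -hm; apply: homogX.
have [c hc] := comb_pow 1%N _ hX.
exists (comb (c *m invmx A1)).
have := hr (c *m invmx A1); rewrite mulmxKV // => h.
have -> : 'X_[m] - comb (c *m invmx A1) * v' =
   ('X_[m] - g ^+ 1 * comb c) - (v' * comb (c *m invmx A1) - g * comb c) by rewrite expr1; ring.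
exact: idealB.
Qed.

End Exchange.

(** * Pure powers of variables form a regular sequence *)

Section PurePowers.
Variables (d : nat) (k : fieldType) (e : 'I_d -> nat).
Local Notation R := {mpoly k[d]}.

Let P (s : seq 'I_d) (m : 'X_{1..d}) := has (fun i => (e i <= m i)%N) s.

Let P_up s : upclosed (P s).
Proof.
move=> m m' /hasP[i hi hm]; apply/hasP; exists i => //.
by rewrite mnmDE; apply: leq_trans hm (leq_addr _ _).
Qed.

Let P_ideal s : is_ideal (supported (k := k) (P s)).
Proof. exact/supported_ideal/P_up. Qed.

Lemma pure_power_adj s j :
  adj (supported (k := k) (P s)) ('X_j ^+ e j) = supported (P (j :: s)).
Proof.
apply: functional_extensionality => u; apply: propositional_extensionality; split.
  move=> [h hh]; rewrite -[u](subrK (h * 'X_j ^+ e j)); apply: supportedD.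
    by move=> m /hh hm; rewrite /P /= -/(P s m) hm orbT.
  apply: (ideal_mulL _ (P_ideal _)); rewrite mpolyXn; apply: supportedX.
  by rewrite /P /= mulmnE mnm1E eqxx mul1n leqnn.
apply: supported_sub; first exact: adj_ideal.
move=> m; rewrite /P /= => /orP[hj|hm].
  have -> : m = (m - U_(j) *+ e j + U_(j) *+ e j)%MM.
    rewrite submK //; apply/mnm_lepP => i; rewrite mulmnE mnm1E.
    by case: eqP => [<-|_]; rewrite ?mul1n ?mul0n.
  rewrite mpolyXD -mpolyXn.
  apply: (ideal_mulL _ (adj_ideal _ (P_ideal s))); exact: (adj_mem _ (P_ideal s)).
by apply: sub_adj; apply: supportedX.
Qed.

Lemma pure_power_adjs s0 s :
  adjs (supported (k := k) (P s0)) [seq 'X_i ^+ e i | i <- s] = supported (P (catrev s s0)).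
Proof. by elim: s s0 => //= j s IH s0; rewrite pure_power_adj IH. Qed.

Lemma pure_power_regseq s0 s : uniq (s0 ++ s) ->
  regseq (supported (k := k) (P s0)) [seq 'X_i ^+ e i | i <- s].
Proof.
elim: s s0 => //= j s IH s0 hu; split; last first.
  by rewrite pure_power_adj; apply: IH; move: hu; rewrite -(cat1s j s) uniq_catCA.
move=> u hu' m hm.
have: (('X_j ^+ e j * u)@_(U_(j) *+ e j + m)%MM != 0) by rewrite mpolyXn mulrC mcoeffMX.
move=> /hu' /hasP[i hi]; rewrite mnmDE mulmnE mnm1E.
have [E|_] := eqVneq; last by rewrite mul0n add0n => h; apply/hasP; exists i.
by move: hu; rewrite cat_uniq => /and3P[_ /hasPn /(_ j)]; rewrite inE eqxx E hi => /(_ isT).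
Qed.

Lemma supported_nil : (fun f : R => f = 0) = supported (P [::]).
Proof.
apply: functional_extensionality => u; apply: propositional_extensionality; split.
  by move=> ->; apply: supported0.
by move=> h; apply/mpolyP => m; rewrite mcoeff0; apply/eqP/negPn/negP => /h.
Qed.

Lemma pure_powers s : uniq s ->
  regseq (fun f : R => f = 0) [seq 'X_i ^+ e i | i <- s] /\
  adjs (fun f : R => f = 0) [seq 'X_i ^+ e i | i <- s] =
    supported (fun m => has (fun i => (e i <= m i)%N) s).
Proof.
move=> hs; rewrite supported_nil; split; first exact: pure_power_regseq.
rewrite pure_power_adjs; congr supported; apply: functional_extensionality => m.
by rewrite /P catrevE has_cat has_rev orbF.
Qed.

End PurePowers.

(** * Complete intersections with an explicit socle generator *)

Section Systems.
Variables (n a delta : nat) (k : fieldType).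
Hypotheses (a_gt0 : (0 < a)%N) (a_le : (a <= delta)%N) (delta_ge2 : (2 <= delta)%N).
Hypothesis char0 : [pchar k] =i pred0.
Local Notation d := n.+3.
Local Notation R := {mpoly k[d]}.
Local Notation vy := (vy n).
Local Notation vz := (vz n).
Implicit Types (f g h u v w : R) (M : 'M[R]_d) (i j : 'I_d).

(** The socle degree for [n.+2] forms of degree [delta] and one linear form in [n.+3] variables. *)
Definition sigma : nat := (n.+2 * delta.-1)%N.

(* The generators x_0, ..., x_(d-3), y^a of the saturation of [LI], completed by [z]. *)
Definition cgen j : R := if j == vy then 'X_j ^+ a else 'X_j.

Definition gen M i : R := \sum_j M i j * cgen j.

(** The transition matrix from the variables to the generators, see [genE]; one factor y is split
    off from y^a. For a complete intersection the determinant of such a matrix generates the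
    socle. *)
Definition amx M : 'M[R]_d := \matrix_(i, j) (M i j * if j == vy then 'X_j ^+ a.-1 else 1).

(* [leadm j] is the exponent of [cgen j * z ^ _] in degree [delta]. *)
Definition leadm j : 'X_{1..d} :=
  if j == vy then (U_(j) *+ a + U_(vz) *+ (delta - a))%MM else (U_(j) + U_(vz) *+ delta.-1)%MM.

(** The default 0 at [vz] keeps the z-column of the coefficient matrices zero outside the row of
    z. *)
Definition lead v j : k := if j == vz then 0 else v@_(leadm j).

Lemma genE M i : gen M i = \sum_j amx M i j * 'X_j.
Proof.
apply: eq_bigr => j _; rewrite mxE /cgen; case: ifP => _; last by rewrite mulr1.
by rewrite -mulrA -exprSr prednK.
Qed.

(** Cramer's rule, read modulo the generators other than the [i]-th. *)
Lemma det_amx_gen M i j (B : R -> Prop) : is_ideal B ->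
  (forall l, l != i -> B (gen M l)) ->
  B (\det (amx M) * 'X_j - cofactor (amx M) i j * gen M i).
Proof.
move=> hB hl.
have -> : \det (amx M) * 'X_j = \sum_l \adj (amx M) j l * gen M l.
  pose x : 'cV[R]_d := \col_l 'X_l.
  have := congr1 (fun X : 'cV_d => X j 0) (mulmxA (\adj (amx M)) (amx M) x).
  rewrite mul_adj_mx mul_scalar_mx !mxE => <-.
  by apply: eq_bigr => l _; rewrite genE !mxE; congr (_ * _); apply: eq_bigr => q _; rewrite ?mxE.
rewrite (bigD1 i) //= mxE addrAC subrr add0r; apply: ideal_sum => // l hli.
by apply: ideal_mulL => //; apply: hl.
Qed.

(** Expanding along row [i] and applying Cramer's rule to each entry shows that, modulo the other
    generators, the determinant changes in the same proportion as the [i]-th generator. *)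
Lemma det_exchange M M' i (B : R -> Prop) : is_ideal B ->
  (forall l j, l != i -> M' l j = M l j) ->
  (forall l, l != i -> B (gen M l)) ->
  B (gen M i * \det (amx M') - gen M' i * \det (amx M)).
Proof.
move=> hB hM hl.
rewrite (expand_det_row (amx M') i) mulr_sumr [gen M' i]genE mulr_suml -sumrB.
apply: ideal_sum => // j _.
have -> : cofactor (amx M') i j = cofactor (amx M) i j.
  rewrite /cofactor; congr (_ * \det _); apply/matrixP => l j'; rewrite !mxE.
  by rewrite hM // eq_sym neq_lift.
have -> : gen M i * (amx M' i j * cofactor (amx M) i j) - amx M' i j * 'X_j * \det (amx M) =
  - amx M' i j * (\det (amx M) * 'X_j - cofactor (amx M) i j * gen M i) by ring.
by apply: ideal_mulL => //; apply: det_amx_gen.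
Qed.

Definition zero_ideal : R -> Prop := fun f => f = 0.

Definition full M : R -> Prop := adjs zero_ideal [seq gen M i | i <- enum 'I_d].

(* By [sys_socle], [\det (amx M)] spans the socle degree of the complete
   intersection [full M]; this is what survives the replacement of generators. *)
Record system M : Prop := System {
  sys_z : forall j, M vz j = (j == vz)%:R;
  sys_colz : forall i, i != vz -> M i vz = 0;
  sys_homog : forall i, i != vz -> gen M i \is delta.-homog;
  sys_reg : regseq zero_ideal [seq gen M i | i <- enum 'I_d];
  sys_bound : forall (e : nat) u, (sigma < e)%N -> u \is e.-homog -> full M u;
  sys_socle : forall u, u \is sigma.-homog -> exists c, full M (u - c *: \det (amx M))
}.

Lemma gen_z M : (forall j, M vz j = (j == vz)%:R) -> gen M vz = 'X_vz.
Proof.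
move=> h; rewrite /gen (bigD1 vz) //= h eqxx mul1r /cgen.
have -> : (vz == vy) = false by rewrite -val_eqE /=; lia.
rewrite big1 ?addr0 // => j hj; by rewrite h (negbTE hj) mul0r.
Qed.

Lemma homogXi i : ('X_i : R) \is 1.-homog.
Proof. by have := homogX k U_(i)%MM; rewrite mdeg1. Qed.

Lemma sys_pos_homog M : system M -> forall f, f \in [seq gen M i | i <- enum 'I_d] -> pos_homog f.
Proof.
move=> hM f /mapP[i _ ->]; have [->|hi] := eqVneq i vz.
  by exists 1%N => //; rewrite gen_z; [apply: homogXi | apply: sys_z].
by exists delta; [lia | apply: sys_homog].
Qed.

Lemma cgen_decomp v : supported (fun m => (0 < lord a m)%N) v ->
  exists b : 'I_d -> R, b vz = 0 /\ v = \sum_j b j * cgen j.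
Proof.
have hyz : (vz == vy) = false by rewrite -val_eqE /=; lia.
pose I f := exists b : 'I_d -> R, b vz = 0 /\ f = \sum_j b j * cgen j.
have hI : is_ideal I.
  split=> [|f f' [b [b0 ->]] [b' [b'0 ->]]|c f [b [b0 ->]]].
  - by exists (fun=> 0); split=> //; rewrite big1 // => j _; rewrite mul0r.
  - exists (fun j => b j + b' j); rewrite b0 b'0 addr0; split=> //.
    by rewrite -big_split; apply: eq_bigr => j _; rewrite mulrDl.
  - exists (fun j => c * b j); rewrite b0 mulr0; split=> //.
    by rewrite mulr_sumr; apply: eq_bigr => j _; rewrite mulrA.
have hc j : j != vz -> I (cgen j).
  move=> hj; exists (fun l => (l == j)%:R); rewrite eq_sym (negbTE hj); split=> //.
  by rewrite (bigD1 j) //= eqxx mul1r big1 ?addr0 // => l /negbTE ->; rewrite mul0r.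
apply: (supported_sub hI) => m; rewrite /lord => hm.
have [hl|/lowdeg_gt0[i hi hmi]] := posnP (lowdeg m).
  have hy : (a <= m vy)%N by rewrite leqNgt; apply/negP => /divn_small E; rewrite hl E in hm.
  have -> : m = (m - U_(vy) *+ a + U_(vy) *+ a)%MM.
    rewrite submK //; apply/mnm_lepP => i; rewrite mulmnE mnm1E.
    by have [<-|] := eqVneq; rewrite ?mul1n.
  rewrite mpolyXD -mpolyXn; apply: ideal_mulL => //.
  have := hc vy; rewrite /cgen eqxx; apply; by rewrite eq_sym hyz.
rewrite -(mnm_subK hmi) mpolyXD; apply: ideal_mulL => //.
have := hc i; rewrite /cgen; have -> : (i == vy) = false.
  by apply/eqP => E; rewrite E /low /= ltnn in hi.
by apply; apply/eqP => E; rewrite E /low /= in hi; lia.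
Qed.

(** For pure powers the conditions concern monomials only: the determinant is the single monomial of
    degree [sigma] outside the ideal. *)
Lemma initial_system : exists M, system M.
Proof.
have hyz : (vz == vy) = false by rewrite -val_eqE /=; lia.
pose e i := if i == vz then 1%N else delta.
pose b i : R := if i == vz then 1 else if i == vy then 'X_i ^+ (delta - a) else 'X_i ^+ delta.-1.
pose M : 'M[R]_d := \matrix_(i, j) (b i *+ (i == j)).
have gE i : gen M i = 'X_i ^+ e i.
  rewrite /gen (bigD1 i) //= mxE eqxx mulr1n big1 ?addr0; last first.
    by move=> j hj; rewrite mxE eq_sym (negbTE hj) mul0r.
  rewrite /b /e /cgen; case: (eqVneq i vz) => [->|hi]; first by rewrite hyz mul1r expr1.
  case: (i == vy); first by rewrite -exprD subnK.
  by rewrite -exprSr prednK //; lia.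
have gEs : [seq gen M i | i <- enum 'I_d] = [seq 'X_i ^+ e i | i <- enum 'I_d] by apply: eq_map.
have [hreg hadj] := pure_powers k e (enum_uniq 'I_d).
have fullE : full M = supported (fun m => has (fun i => (e i <= m i)%N) (enum 'I_d)).
  by rewrite /full gEs hadj.
have hsig (m : 'X_{1..d}) : ~~ has (fun i => (e i <= m i)%N) (enum 'I_d) ->
    m vz = 0%N /\ forall i, i != vz -> (m i <= delta.-1)%N.
  move=> /hasPn hm; split; first by have := hm vz (mem_enum _ _); rewrite /e eqxx -ltnNge ltnS leqn0 => /eqP.
  by move=> i hi; have := hm i (mem_enum _ _); rewrite /e (negbTE hi) -ltnNge; lia.
have degsum (m : 'X_{1..d}) : m vz = 0%N -> mdeg m = (\sum_(i | i != vz) m i)%N.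
  by move=> h; rewrite mdegE (bigD1 vz) //= h.
have cardz : #|[pred i : 'I_d | i != vz]| = n.+2.
  by have := cardC1 vz; rewrite card_ord.
have sigE : (\sum_(i < d | i != vz) delta.-1)%N = sigma by rewrite sum_nat_const cardz.
exists M; split.
- by move=> j; rewrite mxE /b eqxx eq_sym; case: eqP.
- by move=> i hi; rewrite mxE (negbTE hi).
- move=> i hi; rewrite gE /e (negbTE hi) -[X in X.-homog]mul1n.
  exact/dhomogMn/homogXi.
- by rewrite gEs.
- move=> j u hj /homogP hu; rewrite fullE => m /hu /eqP hm.
  apply/negPn/negP => /hsig[h1 h2]; move: hj; rewrite -hm degsum // ltnNge => /negP; apply.
  by rewrite -sigE; apply: leq_sum.
move=> u /homogP hu; pose ms : 'X_{1..d} := [multinom (if i == vz then 0 else delta.-1)%N | i < d].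
have detE : \det (amx M) = 'X_[ms].
  have -> : amx M = diag_mx (\row_i (if i == vz then 1 else 'X_i ^+ delta.-1)).
    apply/matrixP => i j; rewrite !mxE; have [<-|_] := eqVneq i j; last by rewrite mul0r.
    rewrite !mulr1n /b; case: (eqVneq i vz) => [->|hi]; first by rewrite hyz mulr1.
    case: (i == vy); last by rewrite mulr1.
    by rewrite -exprD; congr (_ ^+ _); lia.
  rewrite det_diag mpolyXE_id; apply: eq_bigr => i _; rewrite mxE mnmE.
  by case: ifP => // _; rewrite expr0.
exists (u@_ms); rewrite fullE detE => m hm; apply/negPn/negP => hP.
have [h1 h2] := hsig _ hP.
have [E|hne] := eqVneq m ms.
  by move: hm; rewrite mcoeffB mcoeffZ mcoeffX E eqxx mulr1 subrr eqxx.
move: hm; rewrite mcoeffB mcoeffZ mcoeffX (eq_sym ms) (negbTE hne) mulr0 subr0 => /hu /eqP.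
rewrite degsum // -sigE => hs; case/eqP: hne; apply/mnmP => i; rewrite mnmE.
case: (eqVneq i vz) => [-> //|hi].
apply/eqP; rewrite eqn_leq h2 //= leqNgt; apply/negP => hlt.
move: hs; rewrite (bigD1 i) //= [RHS](bigD1 i) //= => hs.
have : (\sum_(j < d | (j != vz) && (j != i)) m j <= \sum_(j < d | (j != vz) && (j != i)) delta.-1)%N.
  by apply: leq_sum => j /andP[hj _]; apply: h2.
by move=> hle; have := leq_add hlt hle; rewrite -hs addSn ltnn.
Qed.

End Systems.

(** * Moving the generators into [V] *)

Section SystemsExchange.
Variables (n a delta : nat) (k : fieldType).
Hypotheses (a_gt0 : (0 < a)%N) (a_le : (a <= delta)%N) (delta_ge2 : (2 <= delta)%N).
Hypothesis char0 : [pchar k] =i pred0.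
Local Notation d := n.+3.
Local Notation R := {mpoly k[d]}.
Local Notation vy := (vy n).
Local Notation vz := (vz n).
Local Notation sigma := (sigma n delta).
Local Notation gen := (gen a).
Local Notation amx := (amx a).
Local Notation full := (full a).
Local Notation system := (system a delta).
Local Notation lead := (lead a delta).
Local Notation zero_ideal := (@zero_ideal n k).
Implicit Types (f g h u v w : R) (M : 'M[R]_d) (i j : 'I_d).

Definition others M i : seq R := [seq gen M j | j <- rem i (enum 'I_d)].

Lemma perm_others M i : perm_eq [seq gen M j | j <- enum 'I_d] (rcons (others M i) (gen M i)).
Proof.
rewrite -map_rcons; apply: perm_map.
apply: perm_trans (perm_to_rem (mem_enum _ i)) _.
by rewrite perm_sym perm_rcons.
Qed.

Lemma others_pos_homog M i : system M -> forall f, f \in others M i -> pos_homog f.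
Proof.
move=> hM f hf; apply: (sys_pos_homog a_gt0 a_le delta_ge2 hM).
by rewrite (perm_mem (perm_others M i)) mem_rcons inE hf orbT.
Qed.

Lemma full_others M i : system M -> full M = adj (adjs zero_ideal (others M i)) (gen M i).
Proof.
move=> hM; rewrite -adjs_rcons.
exact: (proj2 (regseq_perm (hom_ideal0 _ _) (sys_pos_homog a_gt0 a_le delta_ge2 hM)
  (perm_others M i) (sys_reg hM))).
Qed.

Lemma reg_others M i : system M ->
  regseq zero_ideal (others M i) /\ reg (adjs zero_ideal (others M i)) (gen M i).
Proof.
move=> hM; apply/regseq_rcons.
exact: (proj1 (regseq_perm (hom_ideal0 _ _) (sys_pos_homog a_gt0 a_le delta_ge2 hM)
  (perm_others M i) (sys_reg hM))).
Qed.

Lemma others_mem M i j : j != i -> gen M j \in others M i.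
Proof. by move=> h; apply: map_f; rewrite mem_rem_uniq ?enum_uniq // inE h mem_enum. Qed.

Lemma others_hom M i : system M -> hom_ideal (adjs zero_ideal (others M i)).
Proof. by move=> hM; apply: adjs_hom (hom_ideal0 _ _) (others_pos_homog hM). Qed.

Variable V : R -> Prop.
Hypothesis V_homog : forall v, V v -> v \is delta.-homog.
Hypothesis V_lin : forall v w c, V v -> V w -> V (v + c *: w).
Hypothesis V_C : forall v, V v -> supported (fun m => (0 < lord a m)%N) v.
Variable j0 : nat.
Hypothesis V_big : forall (j : nat) u, (j0 <= j)%N -> u \is j.-homog ->
  ideal_gen (fun f => f = 'X_vz \/ V f) u.
Hypothesis V_lead : forall r : 'I_d -> k, exists2 v, V v & forall j, j != vz -> lead v j = r j.

Definition row_repl (M : 'M[R]_d) i (b : 'I_d -> R) : 'M[R]_d :=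
  \matrix_(l, j) if l == i then b j else M l j.

Lemma lead_lin v w c j : lead (v + c *: w) j = lead v j + c * lead w j.
Proof. by rewrite /lead; case: ifP => _; rewrite ?mulr0 ?addr0 // mcoeffD mcoeffZ. Qed.

(** The functional [eta] is the determinant of [Lam] with row [i] replaced by the leading
    coefficients of its argument; the condition [eta v != 0] in [exchange] thus keeps the
    coefficient matrix invertible. *)
Lemma system_exchange M (Lam : 'M[k]_d) i : system M -> i != vz ->
  \det Lam != 0 -> Lam i vz = 0 ->
  exists M', [/\ system M', forall l, l != i -> gen M' l = gen M l, V (gen M' i)
   & \det (\matrix_(l, j) (if l == i then lead (gen M' i) j else Lam l j)) != 0].
Proof.
move=> hM hi hdet hLz; set B := adjs zero_ideal (others M i).
have hB : hom_ideal B by apply: others_hom.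
have idB : is_ideal B by case: hB.
have [hregO hregi] := reg_others i hM.
have fullE := full_others i hM.
pose eta v := \sum_j lead v j * cofactor Lam i j.
have eta_lin v w c : eta (v + c *: w) = eta v + c * eta w.
  rewrite /eta mulr_sumr -big_split /=; apply: eq_bigr => j _.
  by rewrite lead_lin mulrDl (mulrA c).
have [h0 Vh0 hh0] := V_lead (fun j => Lam i j).
have eta_h0 : eta h0 != 0.
  suff -> : eta h0 = \det Lam by [].
  rewrite (expand_det_row _ i); apply: eq_bigr => l _; congr (_ * _).
  by case: (eqVneq l vz) => [->|/hh0 //]; rewrite hLz /lead eqxx.
have zB : B 'X_vz.
  rewrite -(gen_z a_gt0 a_le delta_ge2 (sys_z hM)); apply: adjs_mem; first by case: (hom_ideal0 d k).
  by apply: others_mem; rewrite eq_sym.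
have tauE : (n.+1 * delta.-1 + delta = sigma.+1)%N by rewrite /sigma; lia.
have [|||v [Vv etav regv boundv]] :=
    @exchange d k char0 B delta sigma (n.+1 * delta.-1) (gen M i) V hB _ tauE
    (sys_homog hM hi) hregi _ V_homog V_lin j0 _ eta eta_lin h0 Vh0 eta_h0.
- by lia.
- by move=> j u hj hu; rewrite -fullE; exact: (sys_bound hM hj hu).
- move=> j u hj hu; apply: (V_big hj hu); first exact: ideal_gen_ideal.
  move=> f [->|hf]; apply: ideal_gen_sub; [left; exact: zB | right; exact: hf].
have [b [bz vE]] := cgen_decomp a_gt0 a_le delta_ge2 (V_C Vv).
pose M' := row_repl M i b; exists M'.
have gM' l : l != i -> gen M' l = gen M l.
  by move=> hl; apply: eq_bigr => j _; rewrite mxE (negbTE hl).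
have gM'i : gen M' i = v.
  by rewrite vE; apply: eq_bigr => j _; rewrite mxE eqxx.
have othersE : others M' i = others M i.
  apply/eq_in_map => j; rewrite mem_rem_uniq ?enum_uniq // inE => /andP[hj _].
  exact: gM'.
have posM' f : f \in rcons (others M i) v -> pos_homog f.
  rewrite mem_rcons inE => /orP[/eqP ->|]; last exact: others_pos_homog.
  by exists delta; [lia | apply: V_homog].
have permM' : perm_eq (rcons (others M i) v) [seq gen M' j | j <- enum 'I_d].
  by rewrite perm_sym -othersE -gM'i perm_others.
have [regM' adjE] := regseq_perm (hom_ideal0 _ _) posM' permM'
  (proj2 (regseq_rcons _ _ _) (conj hregO regv)).
have fullM' : full M' = adj B v by rewrite /full -[in LHS]adjE adjs_rcons.
split=> //; last 2 first.
- by rewrite gM'i.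
- rewrite gM'i (expand_det_row _ i).
  suff -> : \sum_j (\matrix_(l, j) (if l == i then lead v j else Lam l j)) i j *
     cofactor (\matrix_(l, j) (if l == i then lead v j else Lam l j)) i j = eta v by [].
  apply: eq_bigr => j _; rewrite mxE eqxx; congr (_ * _).
  rewrite /cofactor; congr (_ * \det _); apply/matrixP => l j'; rewrite !mxE.
  by rewrite eq_sym (negbTE (neq_lift _ _)).
split.
- by move=> j; rewrite mxE eq_sym (negbTE hi) (sys_z hM).
- move=> l hl; rewrite mxE; case: eqP => // _; exact: sys_colz hM _ hl.
- move=> l hl; case: (eqVneq l i) => [->|hli]; first by rewrite gM'i; apply: V_homog.
  by rewrite gM' //; apply: sys_homog hM _ hl.
- exact: regM'.
- by move=> j u hj hu; rewrite fullM'; apply: boundv hu.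
move=> u hu; rewrite fullM'.
have hex := @det_exchange n a k a_gt0 M M' i B idB.
have {hex} : B (gen M i * \det (amx M') - gen M' i * \det (amx M)).
  apply: hex => [l j hl|l hl]; first by rewrite mxE (negbTE hl).
  by apply: adjs_mem; [case: (hom_ideal0 d k) | apply: others_mem].
rewrite gM'i => hex.
(* The old generator times [u] lies in [B + (v)], with a cofactor of [v] in degree [sigma], where
   the old socle statement applies. [det_exchange] then trades the determinants and the old
   generator cancels. *)
have hgu : (gen M i * u) \is (sigma + delta)%N.-homog.
  by rewrite addnC; apply: dhomogM => //; apply: sys_homog hM _ hi.
have [|u1 hu1] := boundv _ _ _ hgu; first by lia.
have {}hu1 : B (gen M i * u - hcomp sigma u1 * v).
  have := proj2 hB (sigma + delta)%N _ hu1.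
  by rewrite raddfB /= pihomog_dE // (compM_homog _ _ (V_homog Vv)).
have [c] := sys_socle hM (pihomogP mdeg sigma u1).
rewrite fullE => -[u2 hu2].
exists c, u2; apply: hregi; rewrite -/B.
set w := hcomp sigma u1 in hu1 hu2.
have -> : gen M i * (u - c *: \det (amx M') - u2 * v) =
  (gen M i * u - w * v) + v * (w - c *: \det (amx M) - u2 * gen M i)
  - c *: (gen M i * \det (amx M') - v * \det (amx M)).
  rewrite scalerBr -!mul_mpolyC; ring.
by apply: idealB => //; [apply: idealD => //; apply: ideal_mulL | apply: idealZ].
Qed.

(** Rows of [Lam] not yet treated are unit vectors, so that its determinant starts at 1; the row of
    z is never exchanged. *)
Lemma system_in_V : exists M, exists Lam : 'M[k]_d,
  [/\ system M, \det Lam != 0, forall i, i != vz -> V (gen M i),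
      forall i j, i != vz -> Lam i j = lead (gen M i) j & forall j, Lam vz j = (j == vz)%:R].
Proof.
suff h t : (t <= n.+2)%N -> exists M, exists Lam : 'M[k]_d,
  [/\ system M, \det Lam != 0, forall i : 'I_d, (i < t)%N -> V (gen M i),
      forall i j : 'I_d, (i < t)%N -> Lam i j = lead (gen M i) j
    & forall i j : 'I_d, (t <= i)%N -> Lam i j = (i == j)%:R].
  have ht (i : 'I_d) : i != vz -> (i < n.+2)%N.
    by rewrite -val_eqE /=; have := ltn_ord i; lia.
  have [M [Lam [h1 h2 h3 h4 h5]]] := h n.+2 (leqnn _).
  exists M, Lam; split=> // [i /ht|i j /ht|j]; [exact: h3 | exact: h4 |].
  by rewrite h5 // eq_sym.
elim: t => [|t IH] ht.
  have [M hM] := initial_system n k a_gt0 a_le delta_ge2; exists M, 1%:M; split=> //.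
    by rewrite det1 oner_eq0.
  by move=> i j _; rewrite mxE.
have [M [Lam [hM hdet hV hL1 hL2]]] := IH (ltnW ht).
pose i : 'I_d := Ordinal (leq_trans ht (leqnSn _)).
have hi : i != vz by rewrite -val_eqE /=; lia.
have hLz : Lam i vz = 0 by rewrite hL2 //= (negbTE hi).
have [M' [hM' gM' Vi hdet']] := system_exchange hM hi hdet hLz.
exists M', (\matrix_(l, j) (if l == i then lead (gen M' i) j else Lam l j)); split=> //.
- move=> l; rewrite ltnS leq_eqVlt => /orP[/eqP E|hl].
    by have -> : l = i by apply: val_inj.
  by rewrite gM'; [apply: hV | rewrite -val_eqE /=; lia].
- move=> l j; rewrite ltnS leq_eqVlt mxE => /orP[/eqP E|hl].
    have -> : l = i by apply: val_inj.
    by rewrite eqxx.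
  have hli : l != i by rewrite -val_eqE /=; lia.
  by rewrite (negbTE hli) gM' //; apply: hL1.
- move=> l j hl; have hli : l != i by rewrite -val_eqE /=; lia.
  by rewrite mxE (negbTE hli); apply: hL2; lia.
Qed.

End SystemsExchange.

(** * Homogeneous reductions *)

Section Plus.
Variable R : comNzRingType.
Implicit Types (I J : R -> Prop).

Definition plus I J : R -> Prop := fun f => exists2 w, J w & I (f - w).

Lemma plus_ideal I J : is_ideal I -> is_ideal J -> is_ideal (plus I J).
Proof.
move=> hI hJ; split=> [|f g [w hw h1] [w' hw' h2]|b f [w hw h1]].
- by exists 0; rewrite ?subr0; apply: ideal0.
- exists (w + w'); first exact: idealD.
  by rewrite opprD addrACA; apply: idealD.
- exists (b * w); first exact: ideal_mulL.
  by rewrite -mulrBr; apply: ideal_mulL.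
Qed.

Lemma plusr I J f : is_ideal I -> J f -> plus I J f.
Proof. by move=> hI hf; exists f; rewrite ?subrr //; apply: ideal0. Qed.

End Plus.

(** * The weight filtration on C *)

Section Weights.
Variables (n a : nat) (k : fieldType).
Local Notation d := n.+3.
Local Notation R := {mpoly k[d]}.
Local Notation vy := (vy n).
Local Notation vz := (vz n).
Implicit Types (f g h u v w : R) (m : 'X_{1..d}).

Lemma low_neq_vz i : low i -> i != vz.
Proof. by rewrite /low -val_eqE /=; lia. Qed.

Lemma low_neq_vy i : low i -> (i == vy) = false.
Proof. by rewrite /low -val_eqE /=; lia. Qed.

Lemma vz_neq_vy : (vz == vy) = false.
Proof. by rewrite -val_eqE /=; lia. Qed.

Hypotheses (a_gt0 : (0 < a)%N).

(* [mu] gives the generators x_0, ..., x_(d-3), y^a of the saturation the same weight [a]. *)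
Definition mu m : nat := (a * lowdeg m + m vy)%N.

Definition Wt t : R -> Prop := supported (fun m => (t <= mu m)%N).

Lemma muD m m' : mu (m + m')%MM = (mu m + mu m')%N.
Proof. by rewrite /mu lowdegD mnmDE; lia. Qed.

Lemma lord_mu m : lord a m = (mu m %/ a)%N.
Proof. by rewrite /lord /mu mulnC divnMDl. Qed.

Lemma lord_geq m t : (t <= lord a m)%N = (t * a <= mu m)%N.
Proof. by rewrite lord_mu leq_divRL. Qed.

Lemma mdeg_mu m : (mdeg m <= mu m + m vz)%N.
Proof. by rewrite mdeg_lord /mu; nia. Qed.

Lemma Wt_ideal t : is_ideal (Wt t).
Proof. by apply: supported_ideal => m m' h; rewrite muD; lia. Qed.

Lemma lordE f : supported (fun m => (0 < lord a m)%N) f <-> Wt a f.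
Proof. by split=> h m /h; rewrite lord_geq mul1n. Qed.

Lemma WtM s t f g : Wt s f -> Wt t g -> Wt (s + t) (f * g).
Proof. by apply: supportedM => m m' h h'; rewrite muD leq_add. Qed.

Lemma mu_z p : mu (U_(vz) *+ p)%MM = 0%N.
Proof.
rewrite /mu mulmnE mnm1E vz_neq_vy mul0n addn0 /lowdeg big1 ?muln0 // => i hi.
by rewrite mulmnE mnm1E eq_sym (negbTE (low_neq_vz hi)).
Qed.

Lemma mu_cgen_split m : (a <= mu m)%N -> exists j m',
  [/\ j != vz, 'X_[m] = cgen a k j * 'X_[m'], mu m = (a + mu m')%N & m vz = m' vz].
Proof.
move=> hm; have [hl|/lowdeg_gt0[i hi hmi]] := posnP (lowdeg m).
  have hy : (a <= m vy)%N by move: hm; rewrite /mu hl; lia.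
  have E : m = (U_(vy) *+ a + (m - U_(vy) *+ a))%MM.
    rewrite addmC submK //; apply/mnm_lepP => i; rewrite mulmnE mnm1E.
    by case: eqP => [<-|_]; rewrite ?mul1n ?mul0n.
  exists vy, (m - U_(vy) *+ a)%MM; split.
  - by rewrite eq_sym vz_neq_vy.
  - by rewrite {1}E mpolyXD -mpolyXn /cgen eqxx.
  - rewrite {1}E muD; congr addn.
    have hl0 : lowdeg (U_(vy) *+ a)%MM = 0%N.
      by apply: big1 => i hi; rewrite mulmnE mnm1E eq_sym (low_neq_vy hi) mul0n.
    by rewrite /mu hl0 mulmnE mnm1E eqxx; lia.
  - by rewrite mnmBE mulmnE mnm1E eq_sym vz_neq_vy mul0n subn0.
exists i, (m - U_(i))%MM; split.
- exact: low_neq_vz.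
- by rewrite -{1}(mnm_subK hmi) addmC mpolyXD /cgen low_neq_vy.
- rewrite -{1}(mnm_subK hmi) muD addnC; congr addn.
  by rewrite /mu lowdegU hi mnm1E low_neq_vy; lia.
- by rewrite mnmBE mnm1E (negbTE (low_neq_vz hi)) subn0.
Qed.

(** Modulo [I], each factor [z ^ N] buys an increase of the weight by at least one. A monomial of
    large degree and weight below [T] has enough factors z, since by [mdeg_mu] degree not covered by
    the weight comes from z. *)
Lemma Wt_raise (I : R -> Prop) N : is_ideal I ->
  (forall j, j != vz -> plus I (Wt a.+1) ('X_vz ^+ N * cgen a k j)) ->
  forall T m, (a <= mu m)%N -> (N * T + T <= mdeg m)%N -> plus I (Wt T) 'X_[m].
Proof.
move=> hI hc.
have stepX t m : (a <= t)%N -> (t <= mu m)%N -> plus I (Wt t.+1) ('X_vz ^+ N * 'X_[m]).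
  move=> hat htm.
  have [|j [m' [hj -> hmu _]]] := @mu_cgen_split m; first exact: leq_trans hat htm.
  have [w hw hw'] := hc j hj; exists (w * 'X_[m']).
    have : Wt (a.+1 + mu m') (w * 'X_[m']) by apply: WtM => //; apply: supportedX.
    by move=> h m0 /h; lia.
  by rewrite mulrA -mulrBl; apply: ideal_mulR.
have step t f : (a <= t)%N -> Wt t f -> plus I (Wt t.+1) ('X_vz ^+ N * f).
  move=> hat; apply: (supported_sub (I := fun f => plus I (Wt t.+1) ('X_vz ^+ N * f))).
    by apply: ideal_colon; apply: plus_ideal => //; apply: Wt_ideal.
  by move=> m hm; apply: stepX.
have iter s f : Wt a f -> plus I (Wt (a + s)) ('X_vz ^+ (N * s) * f).
  elim: s => [|s IH] hf.
    rewrite muln0 mul1r addn0; exact: plusr.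
  have [w hw hIw] := IH hf.
  have [w' hw' hIw'] := step _ _ (leq_addr s a) hw.
  exists w'; first by rewrite addnS.
  have -> : 'X_vz ^+ (N * s.+1) * f - w' =
    'X_vz ^+ N * ('X_vz ^+ (N * s) * f - w) + ('X_vz ^+ N * w - w').
    by rewrite mulnS exprD; ring.
  by apply: idealD => //; apply: ideal_mulL.
move=> T m ham hdeg.
have [hT|hT] := leqP T (mu m).
  by apply: plusr => //; apply: supportedX.
have hz : (N * T <= m vz)%N by have := mdeg_mu m; lia.
have E : m = (U_(vz) *+ (N * T) + (m - U_(vz) *+ (N * T)))%MM.
  rewrite addmC submK //; apply/mnm_lepP => i; rewrite mulmnE mnm1E.
  by case: eqP => [<-|_]; rewrite ?mul1n ?mul0n.
have [w hw hIw] : plus I (Wt (a + T)) 'X_[m].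
  rewrite E mpolyXD -mpolyXn; apply: iter; apply: supportedX.
  by move: ham; rewrite {1}E muD mu_z.
by exists w => // m' /hw; lia.
Qed.

Lemma Wt_zK p t f : Wt t ('X_vz ^+ p * f) -> Wt t f.
Proof.
move=> h m hm; have: ('X_vz ^+ p * f)@_(U_(vz) *+ p + m)%MM != 0.
  by rewrite mpolyXn mulrC mcoeffMX.
by move/h; rewrite muD mu_z.
Qed.

End Weights.

(** * Forms of C generated by [V] from degree D on *)

Section HomogeneousReduction.
Variables (n a delta : nat) (k : fieldType).
Hypotheses (a_gt0 : (0 < a)%N) (a_le : (a <= delta)%N) (delta_ge2 : (2 <= delta)%N).
Hypothesis char0 : [pchar k] =i pred0.
Local Notation d := n.+3.
Local Notation R := {mpoly k[d]}.
Local Notation vy := (vy n).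
Local Notation vz := (vz n).
Local Notation sigma := (sigma n delta).
Local Notation gen := (gen a).
Local Notation amx := (amx a).
Local Notation full := (full a).
Local Notation system := (system a delta).
Local Notation lead := (lead a delta).
Local Notation zero_ideal := (@zero_ideal n k).
Local Notation Wt := (@Wt n a k).
Local Notation LI := (@LI n a delta k).
Local Notation cgen := (@cgen n a k).
Implicit Types (f g h u v w : R) (M : 'M[R]_d) (i j : 'I_d).

Lemma LI_expE t f : ideal_exp LI t f <-> supported (fun m => (t * a <= mu a m)%N && (t * delta <= mdeg m)%N) f.
Proof.
rewrite LI_exp //; split=> h m /h; rewrite /Lmon lord_geq //.
Qed.

Lemma ideal_mul_gen (I J : R -> Prop) : subideal (ideal_mul I J) (ideal_gen I).
Proof.
apply: ideal_mul_ind; first exact: ideal_gen_ideal.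
by move=> f g hf _; apply: (ideal_mulR _ (ideal_gen_ideal I)); apply: ideal_gen_sub.
Qed.

Lemma mcoeff_leadm v j : j != vz -> lead v j = v@_(leadm a delta j).
Proof. by rewrite /lead => /negbTE ->. Qed.

Lemma leadmE j : j != vz -> 'X_[leadm a delta j] = cgen j * 'X_vz ^+ (if j == vy then delta - a else delta.-1)%N.
Proof.
move=> hj; rewrite /leadm /cgen; case: ifP => _; by rewrite mpolyXD ?mpolyXn.
Qed.

(** The only monomials of degree [delta] and weight exactly [a] are the [leadm j]. *)
Lemma lead_decomp v : v \is delta.-homog -> Wt a v ->
  Wt a.+1 (v - \sum_(j | j != vz) lead v j *: 'X_[leadm a delta j]).
Proof.
move=> /homogP hv hW m; rewrite mcoeffB raddf_sum /=.
under eq_bigr do rewrite mcoeffZ mcoeffX.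
have leadm_inj i j : i != vz -> j != vz -> leadm a delta i = leadm a delta j -> i = j.
  move=> hi hj /(congr1 (fun m : 'X_{1..d} => m i)); rewrite /leadm.
  have [->|hiy] := eqVneq i vy; have [->|hjy] := eqVneq j vy => //.
  - rewrite !mnmDE !mulmnE !mnm1E eqxx (negbTE hjy) vz_neq_vy; lia.
  - rewrite !mnmDE !mulmnE !mnm1E eqxx (eq_sym vy) (negbTE hiy) (eq_sym vz) (negbTE hi); lia.
  - rewrite !mnmDE !mulmnE !mnm1E eqxx (eq_sym vz) (negbTE hi); case: (eqVneq j i) => // _; lia.
move=> hm; have [E|hne] := boolP [exists j, (j != vz) && (m == leadm a delta j)].
  case/existsP: E => j /andP[hj /eqP E]; case/eqP: hm.
  rewrite (bigD1 j) //= E eqxx mulr1 mcoeff_leadm // big1 ?addr0 ?subrr //.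
  move=> i /andP[hi hij]; case: eqP => [E'|_]; last by rewrite mulr0.
  by rewrite (leadm_inj _ _ hi hj E') eqxx in hij.
move: hne; rewrite negb_exists => /forallP hne.
have hm' : v@_m != 0.
  move: hm; rewrite big1 ?subr0 // => j hj; move: (hne j); rewrite hj /= eq_sym => /negbTE ->.
  by rewrite mulr0.
have h1 := hW _ hm'; have /eqP h2 := hv _ hm'.
rewrite ltn_neqAle h1 andbT; apply/negP => /eqP hmu.
have [hl|/lowdeg_gt0[i hi hmi]] := posnP (lowdeg m).
  have hy : m vy = a by move: hmu; rewrite /mu hl; lia.
  case/negP: (hne vy); rewrite eq_sym vz_neq_vy /=; apply/eqP/mnmP => l.
  rewrite /leadm eqxx mnmDE !mulmnE !mnm1E.
  have hz : m vz = (delta - a)%N by move: h2; rewrite mdeg_lord hl hy; lia.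
  have [<-|hly] := eqVneq vy l; first by rewrite hy vz_neq_vy; lia.
  have [<-|hlz] := eqVneq vz l; first by rewrite hz; lia.
  rewrite mul0n; have hll : low l.
    by move: hly hlz; rewrite -!val_eqE /low /=; have := ltn_ord l; lia.
  by have := lowdeg_ge m hll; rewrite hl leqn0 => /eqP.
have hiz := low_neq_vz hi.
have hE : m = (m - U_(i) + U_(i))%MM by rewrite mnm_subK.
have hl1 : lowdeg m = (lowdeg (m - U_(i))%MM).+1 by rewrite {1}hE lowdegD lowdegU hi addn1.
have hl0 : lowdeg (m - U_(i))%MM = 0%N by move: hmu; rewrite /mu hl1; nia.
have hy : m vy = 0%N by move: hmu; rewrite /mu hl1 hl0; lia.
case/negP: (hne i); rewrite hiz /=; apply/eqP/mnmP => l.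
rewrite /leadm low_neq_vy // mnmDE mulmnE !mnm1E.
have hz : m vz = delta.-1 by move: h2; rewrite mdeg_lord hl1 hl0 hy; lia.
have [<-|hlz] := eqVneq vz l; first by rewrite hz (negbTE hiz); lia.
rewrite mul0n addn0.
have [->|hly] := eqVneq l vy; first by rewrite hy low_neq_vy.
have hll : low l by move: hly hlz; rewrite -!val_eqE /low /=; have := ltn_ord l; lia.
have := lowdeg_ge (m - U_(i))%MM hll; rewrite hl0 mnmBE mnm1E => h3.
have [hEl|hil] := eqVneq i l; last by move: h3; rewrite (negbTE hil); lia.
move: h3; rewrite -hEl eqxx; lia.
Qed.

Variables (V : R -> Prop) (N : nat).
Hypothesis V_homog : forall v, V v -> v \is delta.-homog.
Hypothesis V_lin : forall v w c, V v -> V w -> V (v + c *: w).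
Hypothesis V_C : forall v, V v -> Wt a v.
Hypothesis N_gt0 : (0 < N)%N.
Hypothesis V_red : forall f, ideal_exp LI N.+1 f -> ideal_mul V (ideal_exp LI N) f.
Hypothesis V_lead : forall r : 'I_d -> k, exists2 v, V v & forall j, j != vz -> lead v j = r j.

(** A monomial of large degree without z has large weight, so it lies in [L ^ N.+1] and therefore in
    the ideal generated by [V]. *)
Lemma V_big (e : nat) u : (N.+1 * delta <= e)%N -> u \is e.-homog ->
  ideal_gen (fun f => f = 'X_vz \/ V f) u.
Proof.
move=> he /homogP; apply: supported_sub; first exact: ideal_gen_ideal.
move=> m /eqP hm; have [hz|hz] := posnP (m vz); last first.
  rewrite -(mnm_subK hz) mpolyXD; apply: (ideal_mulL _ (ideal_gen_ideal _)).
  by apply: ideal_gen_sub; left.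
have h : ideal_gen V 'X_[m].
  apply: (@ideal_mul_gen V (ideal_exp LI N)); apply: V_red; apply/LI_expE; apply: supportedX.
  rewrite hm he andbT.
  have := mdeg_mu a_gt0 m; rewrite hz addn0 hm; move: he; nia.
apply: h; first exact: ideal_gen_ideal.
by move=> f hf; apply: ideal_gen_sub; right.
Qed.

Section WithSystem.
Variables (M : 'M[R]_d) (Lam : 'M[k]_d).
Hypotheses (hM : system M) (hdet : \det Lam != 0) (hV : forall i, i != vz -> V (gen M i)).
Hypotheses (hLam : forall i j, i != vz -> Lam i j = lead (gen M i) j).
Hypothesis (hLamz : forall j, Lam vz j = (j == vz)%:R).

Let K := adjs zero_ideal (others a M vz).

Let homK : hom_ideal K. Proof. exact: (others_hom a_gt0 a_le delta_ge2 vz hM). Qed.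
Let idK : is_ideal K. Proof. by case: homK. Qed.

Let idW t : is_ideal (Wt t). Proof. exact: Wt_ideal. Qed.

Let K_gen i : i != vz -> K (gen M i).
Proof. by move=> hi; apply: adjs_mem; [case: (hom_ideal0 d k) | apply: others_mem]. Qed.

Let K_min J : is_ideal J -> (forall v, V v -> J v) -> subideal K J.
Proof.
move=> hJ hVJ f; apply: adjs_min => //; first by move=> g ->; apply: ideal0.
move=> g /mapP[i]; rewrite mem_rem_uniq ?enum_uniq // inE => /andP[hi _] ->.
by apply/hVJ/hV.
Qed.

Let K_Wt : subideal K (Wt a).
Proof. by apply: K_min => //; apply: Wt_ideal. Qed.

Let full_z : full M = adj K 'X_vz.
Proof. by rewrite (full_others a_gt0 a_le delta_ge2 vz hM) (gen_z a_gt0 a_le delta_ge2 (sys_z hM)). Qed.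

Let reg_z : reg K 'X_vz.
Proof.
rewrite -(gen_z a_gt0 a_le delta_ge2 (sys_z hM)).
exact: (proj2 (reg_others a_gt0 a_le delta_ge2 vz hM)).
Qed.

(** Inverting [Lam] solves for the leading monomials modulo higher weight: where z is invertible,
    the generators recover C to first order. *)
Let K_lead j : j != vz -> plus K (Wt a.+1) ('X_vz ^+ delta * cgen j).
Proof.
move=> hj; pose w := row j (invmx Lam).
have hu : Lam \in unitmx by rewrite unitmxE unitfE.
have hw : w *m Lam = row j 1%:M by rewrite -row_mul mulVmx.
have hwl l : l != vz -> \sum_(i | i != vz) w 0 i * Lam i l = (j == l)%:R.
  move=> hl; have := congr1 (fun X : 'rV_d => X 0 l) hw; rewrite !mxE (bigD1 vz) //=.
  by rewrite hLamz (negbTE hl) mulr0 add0r => <-.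
have e_in : plus K (Wt a.+1) 'X_[leadm a delta j].
  have -> : 'X_[leadm a delta j] = \sum_(i | i != vz) w 0 i *: gen M i
     - \sum_(i | i != vz) w 0 i *: (gen M i - \sum_(l | l != vz) lead (gen M i) l *: 'X_[leadm a delta l]).
    rewrite -sumrB.
    under eq_bigr do rewrite -scalerBr opprB addrCA subrr addr0 scaler_sumr.
    rewrite exchange_big /= (bigD1 j) //= [X in _ = X + _](_ : _ = 'X_[leadm a delta j]).
      rewrite big1 ?addr0 // => l /andP[hl hlj].
      under eq_bigr => i hi do rewrite scalerA -hLam //.
      by rewrite -scaler_suml hwl // eq_sym (negbTE hlj) scale0r.
    under eq_bigr => i hi do rewrite scalerA -hLam //.
    by rewrite -scaler_suml hwl // eqxx scale1r.
  exists (- \sum_(i | i != vz) w 0 i *: (gen M i - \sum_(l | l != vz) lead (gen M i) l *: 'X_[leadm a delta l])).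
    apply: (idealN (idW _)); apply: (ideal_sum _ (idW _)) => i hi.
    apply: (idealZ _ (idW _)).
    by apply: lead_decomp; [apply/V_homog/hV | apply/V_C/hV].
  rewrite opprK subrK; apply: ideal_sum => // i hi; apply: idealZ => //; exact: K_gen.
have hp : is_ideal (plus K (Wt a.+1)) by apply: plus_ideal => //; apply: Wt_ideal.
move: e_in; rewrite leadmE //.
set p := (if _ then _ else _); have hp' : (p <= delta)%N by rewrite /p; case: ifP; lia.
move=> h; have -> : 'X_vz ^+ delta * cgen j = 'X_vz ^+ (delta - p) * (cgen j * 'X_vz ^+ p).
  by rewrite mulrCA -exprD subnK // mulrC.
exact: ideal_mulL.
Qed.

(** The determinant of [amx M] is a multiple of that of [M], and Cramer's rule for [M] multiplies
    the generators of C into [K]. *)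
Let det_K f : Wt a f -> K (\det (amx M) * f).
Proof.
move=> /lordE -/(_ a_gt0) hf.
have [b [b0 ->]] := cgen_decomp a_gt0 a_le delta_ge2 hf.
rewrite mulr_sumr; apply: ideal_sum => // j _.
have [->|hj] := eqVneq j vz; first by rewrite b0 mul0r mulr0; apply: ideal0.
rewrite mulrCA; apply: ideal_mulL => //.
suff: K (\det M * cgen j).
  have -> : amx M = M *m diag_mx (\row_j (if j == vy then 'X_j ^+ a.-1 else 1)).
    apply/matrixP => i l; rewrite mul_mx_diag !mxE //.
  rewrite det_mulmx mulrAC; exact: ideal_mulR.
(* The entry of z may be set to 0 because the z-column of [M] vanishes outside the row of z. *)
pose x : 'cV[R]_d := \col_l (if l == vz then 0 else cgen l).
have := congr1 (fun X : 'cV_d => X j 0) (mulmxA (\adj M) M x).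
rewrite mul_adj_mx mul_scalar_mx [in RHS]mxE [x j 0]mxE (negbTE hj) => <-.
rewrite mxE; apply: ideal_sum => // l _; apply: ideal_mulL => //.
have [->|hl] := eqVneq l vz.
  rewrite mxE big1; first exact: ideal0.
  by move=> q _; rewrite (sys_z hM) mxE; case: eqP => _; rewrite ?mulr0 ?mul0r.
suff -> : (M *m x) l 0 = gen M l by apply: K_gen.
rewrite mxE; apply: eq_bigr => q _; rewrite mxE.
by case: eqP => // ->; rewrite (sys_colz hM hl) !mul0r.
Qed.


(** In large degree, [Wt_raise] moves a form of C into [L ^ N.+1] modulo [K], where [V_red]
    applies. *)
Let V_mod_K : exists e1, forall (e : nat) u, (e1 <= e)%N -> u \is e.-homog -> Wt a u ->
  plus K (ideal_mul V (Wt a)) u.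
Proof.
pose T := (a * N.+1)%N; exists (delta * T + T + N.+1 * delta)%N => e u he hu hW.
have idP : is_ideal (plus K (Wt T)) by apply: plus_ideal.
have [w hw hKw] : plus K (Wt T) u.
  apply: (@supported_sub _ _ _ (fun m => (a <= mu a m)%N && (mdeg m == e))) => //.
    move=> m /andP[h1 /eqP h2]; apply: (Wt_raise a_gt0 idK K_lead) => //.
    by rewrite h2; lia.
  by move=> m hm; rewrite hW //=; move/homogP: hu => /(_ _ hm).
exists (hcomp e w); last first.
  by have := proj2 homK e _ hKw; rewrite raddfB /= pihomog_dE.
have : ideal_mul V (ideal_exp LI N) (hcomp e w).
  apply: V_red; apply/LI_expE => m hm.
  rewrite (_ : (N.+1 * a = T)%N) ?(supported_comp hw hm) /=; last by rewrite /T mulnC.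
  have /homogP /(_ _ hm) /eqP -> := comp_homog e w; lia.
apply: ideal_mul_ind; first exact: ideal_mul_ideal.
move=> f g hf hg; apply: ideal_mul_in => //.
have hLI : is_ideal LI by apply: LI_ideal.
move: hg; case: (N) N_gt0 => // N' _ /(subideal_exp1 hLI) {}hg.
by apply/lordE => // m /hg /andP[].
Qed.

Let z_transport p u : u \is (sigma + p)%N.-homog ->
  exists2 h, h \is sigma.-homog & K (u - 'X_vz ^+ p * h).
Proof.
elim: p u => [|p IH] u hu.
  rewrite addn0 in hu; exists u => //.
  by rewrite expr0 mul1r subrr; apply: ideal0.
have [h hh] : adj K 'X_vz u by rewrite -full_z; apply: (sys_bound hM _ hu); lia.
have {}hh : K (u - hcomp (sigma + p)%N h * 'X_vz).
  have := proj2 homK (sigma + p + 1)%N _ hh.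
  rewrite raddfB /= (compM_homog (sigma + p)%N h (homogXi k vz)) pihomog_dE //.
  by rewrite addn1 -addnS.
have [h' hh' hK] := IH _ (comp_homog (sigma + p)%N h).
exists h' => //; set w := hcomp _ h in hh hK.
have -> : u - 'X_vz ^+ p.+1 * h' = (u - w * 'X_vz) + 'X_vz * (w - 'X_vz ^+ p * h').
  by rewrite exprS; ring.
by apply: idealD => //; apply: ideal_mulL.
Qed.

Let W := ideal_mul V (fun h => Wt a h /\ h \is sigma.-homog).

(** Multiplication by [z ^ p] reaches the degrees covered by [V_mod_K]; there the cofactors are,
    modulo [K], [z ^ p] times forms of degree [sigma], and [z ^ p] cancels. *)
Let V_sigma u : u \is (sigma + delta)%N.-homog -> Wt a u -> plus K W u.
Proof.
move=> hu hW; have [p hp] := V_mod_K.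
have idW' : is_ideal W by apply: ideal_mul_ideal.
pose Q f := forall g, exists2 w, W w & K (hcomp (sigma + p + delta)%N (g * f) - 'X_vz ^+ p * w).
have hQ : is_ideal Q.
  split.
  - by move=> g; exists 0; rewrite ?(mulr0, raddf0, subr0); [apply: (ideal0 idW') | apply: (ideal0 idK)].
  - move=> f f' h h' g; have [w hw hK] := h g; have [w' hw' hK'] := h' g.
    exists (w + w'); first exact: (idealD idW').
    by rewrite !mulrDr raddfD /= opprD addrACA; apply: idealD.
  - by move=> b f h g; have := h (g * b); rewrite mulrA.
have hKQ f : K f -> Q f.
  move=> hf g; exists 0; first exact: (ideal0 idW').
  by rewrite mulr0 subr0; apply: (proj2 homK); apply: ideal_mulL.
have hVQ : subideal (ideal_mul V (Wt a)) Q.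
  apply: ideal_mul_ind => // v h hv hh g.
  rewrite (mulrC v) mulrA (compM_homog _ _ (V_homog hv)).
  set h1 := hcomp _ _.
  have hh1 : Wt a h1 by apply: supported_comp; apply: (ideal_mulL _ (idW a)).
  have [h2 hh2 hK] := @z_transport p h1 (comp_homog _ _).
  exists (v * h2).
    apply: ideal_mul_in => //; split=> //.
    suff hz : Wt a ('X_vz ^+ p * h2) by apply: Wt_zK hz.
    have -> : 'X_vz ^+ p * h2 = h1 - (h1 - 'X_vz ^+ p * h2) by ring.
    by apply: (idealB (idW a)) => //; apply: K_Wt.
  have -> : h1 * v - 'X_vz ^+ p * (v * h2) = v * (h1 - 'X_vz ^+ p * h2) by ring.
  exact: ideal_mulL.
have hzu : 'X_vz ^+ p * u \is (p + (sigma + delta))%N.-homog.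
  by rewrite -[X in (X + _)%N]mul1n; apply: dhomogM => //; apply/dhomogMn/homogXi.
have [||f hf hKf] := hp _ _ _ hzu; first by lia.
  exact: (ideal_mulL _ (idW a)).
have hfin : Q ('X_vz ^+ p * u).
  by rewrite -[_ * u](subrK f); apply: (idealD hQ); [apply: hKQ | apply: hVQ].
have [w hw] := hfin 1; rewrite mul1r pihomog_dE; last first.
  by rewrite (_ : (sigma + p + delta = p + (sigma + delta))%N) //; lia.
rewrite -mulrBr => /(reg_exp reg_z) hK; by exists w.
Qed.

Lemma degree_bound_with_system u :
  u \is (sigma + delta.-1)%N.-homog -> Wt a u -> ideal_gen V u.
Proof.
move=> hu hW.
have [||w hw hKw] := @V_sigma ('X_vz * u).
- rewrite (_ : (sigma + delta = 1 + (sigma + delta.-1))%N); last by lia.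
  by apply: dhomogM => //; apply: homogXi.
- exact: (ideal_mulL _ (idW a)).
have idG := ideal_gen_ideal V.
pose Z f := exists2 f', ideal_gen V f' & K (f - 'X_vz * f').
have hZ : is_ideal Z.
  split=> [|f g [f' h1 h2] [g' h3 h4]|b f [f' h1 h2]].
  - by exists 0; rewrite ?(mulr0, subr0); [apply: (ideal0 idG) | apply: (ideal0 idK)].
  - exists (f' + g'); first exact: (idealD idG).
    by rewrite mulrDr opprD addrACA; apply: idealD.
  - exists (b * f'); first exact: (ideal_mulL _ idG).
    by rewrite mulrCA -mulrBr; apply: ideal_mulL.
have [f' hf' hKf'] : Z w.
  apply: (ideal_mul_ind hZ) hw => v h hv [hWh hh].
  (* Modulo [K] and z, [h] is a multiple of the determinant, and the determinant times [v] lies in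
     [K] because [v] lies in C. *)
  have [c] := sys_socle hM hh; rewrite full_z => -[h' hh'].
  exists (v * h'); first by apply: (ideal_mulR _ idG); apply: ideal_gen_sub.
  have -> : v * h - 'X_vz * (v * h') =
     v * (h - c *: \det (amx M) - h' * 'X_vz) + c *: (\det (amx M) * v).
    by rewrite -!mul_mpolyC; ring.
  apply: idealD => //; first exact: ideal_mulL.
  by apply: idealZ => //; apply/det_K/V_C.
have hK : K (u - f').
  apply: reg_z; have -> : 'X_vz * (u - f') = ('X_vz * u - w) + (w - 'X_vz * f') by ring.
  exact: idealD.
rewrite -[u](subrK f'); apply: (idealD idG) => //.
by apply: K_min hK => //; apply: ideal_gen_sub.
Qed.

End WithSystem.

Lemma degree_bound u : u \is (sigma + delta.-1)%N.-homog -> Wt a u -> ideal_gen V u.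
Proof.
have V_C' v : V v -> supported (fun m => (0 < lord a m)%N) v by move=> /V_C /lordE; apply.
have [M [Lam [hM hdet hV hLam hLamz]]] :=
  system_in_V a_gt0 a_le delta_ge2 char0 V_homog V_lin V_C' V_big V_lead.
exact: degree_bound_with_system hM hdet hV hLam hLamz u.
Qed.

End HomogeneousReduction.

(** * Initial forms of a reduction *)

Section Elimination.
Variables (A : idomainType) (x : A) (x0 : x != 0) (d : nat).
Implicit Types (W : 'rV[A]_d -> Prop) (w t : 'rV[A]_d) (s : seq 'I_d).

Definition submodule W : Prop := W 0 /\ forall c w w', W w -> W w' -> W (c *: w + w').

Definition dot w t : A := \sum_j w 0 j * t 0 j.

Lemma dotDl w w' t : dot (w + w') t = dot w t + dot w' t.
Proof. by rewrite /dot -big_split; apply: eq_bigr => j _; rewrite mxE mulrDl. Qed.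

Lemma dotZl c w t : dot (c *: w) t = c * dot w t.
Proof. by rewrite /dot mulr_sumr; apply: eq_bigr => j _; rewrite mxE mulrA. Qed.

Lemma dotDr w t t' : dot w (t + t') = dot w t + dot w t'.
Proof. by rewrite /dot -big_split; apply: eq_bigr => j _; rewrite mxE mulrDr. Qed.

Lemma dotZr c w t : dot w (c *: t) = c * dot w t.
Proof. by rewrite /dot mulr_sumr; apply: eq_bigr => j _; rewrite mxE mulrCA. Qed.

Lemma dot_delta w i : dot w (delta_mx 0 i) = w 0 i.
Proof.
rewrite /dot (bigD1 i) //= mxE !eqxx mulr1 big1 ?addr0 // => j hj.
by rewrite mxE (negbTE hj) andbF mulr0.
Qed.

Lemma submodule_sum W (T : Type) (r : seq T) (P : pred T) (F : T -> 'rV[A]_d) :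
  submodule W -> (forall i, P i -> W (F i)) -> W (\sum_(i <- r | P i) F i).
Proof.
move=> [W0 WL] hF; apply: big_ind => // u v hu hv.
by rewrite -[u]scale1r; apply: WL.
Qed.

Lemma submoduleZ W c w : submodule W -> W w -> W (c *: w).
Proof. by move=> [W0 WL] hw; rewrite -[_ *: _]addr0; apply: WL. Qed.

Lemma submoduleB W w w' : submodule W -> W w -> W w' -> W (w - w').
Proof. by move=> [W0 WL] hw hw'; rewrite addrC -scaleN1r; apply: WL. Qed.

(* Testing [W] against the vectors [t] orthogonal to the rows already found
   yields the next row of a triangular system. *)
Lemma elimination s W e m : uniq s -> submodule W ->
  (forall t i, (forall j, j \notin s -> t 0 j = 0) -> i \in s ->
     exists2 w, W w & dot w t = x ^+ e * t 0 i ^+ m) ->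
  exists M, forall i, i \in s ->
     exists2 w, W w & forall j, j \in s -> w 0 j = x ^+ M *+ (i == j).
Proof.
elim: s W e => [|i0 s IH] W e /=; first by move=> _ _ _; exists 0%N.
move=> /andP[hi0 hs] hW H; have [W0 WL] := hW.
have [||w1 hw1 E1] := H (delta_mx 0 i0) i0.
- by move=> j; rewrite inE negb_or mxE => /andP[/negbTE -> _].
- by rewrite inE eqxx.
move: E1; rewrite dot_delta mxE !eqxx expr1n mulr1 => E1.
pose W' w := W w /\ w 0 i0 = 0.
have hW' : submodule W'.
  split; first by split; rewrite ?mxE.
  by move=> c w w' [h1 h2] [h3 h4]; split; [apply: WL | rewrite !mxE h2 h4 mulr0 addr0].
have [|M hM] := IH W' (e + e * m)%N hs hW'.
  (* [t] is a multiple of [t'] corrected at [i0] to be orthogonal to [w1]; so [w1] can clear the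
     entry of [w] at [i0] without affecting the product with [t]. The power [x ^+ e] in [t] accounts
     for the exponent [e + e * m]. *)
  move=> t' i ht' hi; pose t := x ^+ e *: t' - dot w1 t' *: delta_mx 0 i0.
  have t'0 : t' 0 i0 = 0 by apply: ht'.
  have hii0 : i != i0 by apply: contraNneq hi0 => <-.
  have [||w hw Ew] := H t i.
  - move=> j; rewrite inE negb_or => /andP[h1 h2].
    by rewrite !mxE (negbTE h1) ht' // !mulr0 subr0.
  - by rewrite inE hi orbT.
  exists (x ^+ e *: w - w 0 i0 *: w1).
    split; first by apply: submoduleB => //; apply: submoduleZ.
    by rewrite !mxE E1 mulrC subrr.
  apply: (mulfI (expf_neq0 e x0)).
  have tE : t 0 i = x ^+ e * t' 0 i by rewrite !mxE (negbTE hii0) andbF mulr0 subr0.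
  have dot1 : dot w1 t = 0.
    by rewrite dotDr -scaleNr !dotZr dot_delta E1 mulrC mulNr subrr.
  have dt w2 : w2 0 i0 = 0 -> dot w2 t = x ^+ e * dot w2 t'.
    by move=> h; rewrite dotDr -scaleNr !dotZr dot_delta h mulr0 addr0.
  rewrite -dt; last by rewrite !mxE E1 mulrC subrr.
  rewrite dotDl -scaleNr !dotZl dot1 mulr0 addr0 Ew tE exprMn exprD -exprM; ring.
exists (M + e)%N => i; rewrite inE; case: (eqVneq i i0) => [-> _|hii0 /= hi]; last first.
  have [w [hw w0] Ew] := hM i hi; exists (x ^+ e *: w); first exact: submoduleZ.
  move=> j; rewrite inE mxE => /orP[/eqP ->|hj].
    by rewrite w0 mulr0 (negbTE hii0) mulr0n.
  by rewrite Ew // mulrnAr -exprD addnC.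
have [F hF] : exists F : 'I_d -> 'rV[A]_d, forall i, i \in s ->
    W' (F i) /\ forall j, j \in s -> F i 0 j = x ^+ M *+ (i == j).
  apply: (@fin_all_exists _ _ (fun i w => i \in s ->
    W' w /\ forall j, j \in s -> w 0 j = x ^+ M *+ (i == j))) => i1.
  by case: (boolP (i1 \in s)) => [/hM[w]|_]; [exists w | exists 0].
exists (x ^+ M *: w1 - \sum_(j <- s) w1 0 j *: F j).
  apply: submoduleB => //; first exact: submoduleZ.
  by rewrite big_seq; apply: submodule_sum => // j /hF[[h _] _]; apply: submoduleZ.
move=> j; rewrite inE => hj; rewrite !mxE summxE big_seq.
have [->|hji0] := eqVneq j i0.
  rewrite ?eqxx mulr1n E1 -exprD big1 ?subr0 // => l /hF[[_ h] _].
  by rewrite mxE h mulr0.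
have {}hj : j \in s by move: hj; rewrite (negbTE hji0).
rewrite mulr0n -big_seq (bigD1_seq j) //= big_seq_cond big1.
  by rewrite mxE (proj2 (hF j hj)) // eqxx mulr1n addr0 mulrC subrr.
by move=> l /andP[hl hlj]; rewrite mxE (proj2 (hF l hl)) // (negbTE hlj) mulr0.
Qed.

End Elimination.

(** * Arcs in the zero set with z invertible *)

Section LocalReduction.
Variables (n a delta : nat) (k : fieldType).
Hypotheses (a_gt0 : (0 < a)%N) (a_le : (a <= delta)%N).
Local Notation d := n.+3.
Local Notation R := {mpoly k[d]}.
Local Notation P := {poly k}.
Local Notation vy := (vy n).
Local Notation vz := (vz n).
Local Notation Wt := (@Wt n a k).
Local Notation LI := (@LI n a delta k).
Local Notation cgen := (@cgen n a k).
Implicit Types (f g h u v : R) (i j : 'I_d) (w t : 'rV[P]_d).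

Definition pz (p : P) : R := (map_poly (@mpolyC d k) p).['X_vz].

Lemma pzD p q : pz (p + q) = pz p + pz q.
Proof. by rewrite /pz rmorphD hornerD. Qed.

Lemma pzM p q : pz (p * q) = pz p * pz q.
Proof. by rewrite /pz rmorphM hornerM. Qed.

Lemma pz0 : pz 0 = 0.
Proof. by rewrite /pz rmorph0 horner0. Qed.

Lemma pzXn q : pz 'X^q = 'X_vz ^+ q.
Proof. by rewrite /pz map_polyXn hornerXn. Qed.

Lemma pzC c : pz c%:P = c%:MP.
Proof. by rewrite /pz map_polyC hornerC. Qed.

Let idW e : is_ideal (Wt e). Proof. exact: Wt_ideal. Qed.

(** The row [w] holds coordinates of [f] in C modulo weight above [a], a free module over [k[z]] on
    the [cgen j] with [j != vz]; the entry at [vz] is ignored. *)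
Definition rep f w : Prop := Wt a.+1 (f - \sum_(j | j != vz) pz (w 0 j) * cgen j).

Lemma rep_lin c f g w w' : rep f w -> rep g w' -> rep (pz c * f + g) (c *: w + w').
Proof.
rewrite /rep => h h'.
have -> : pz c * f + g - \sum_(j | j != vz) pz ((c *: w + w') 0 j) * cgen j =
   pz c * (f - \sum_(j | j != vz) pz (w 0 j) * cgen j) +
   (g - \sum_(j | j != vz) pz (w' 0 j) * cgen j).
  under eq_bigr do rewrite !mxE pzD pzM mulrDl -mulrA.
  rewrite big_split /= -mulr_sumr; ring.
by apply: (idealD (idW _)) => //; apply: (ideal_mulL _ (idW _)).
Qed.

Lemma rep0 f : Wt a.+1 f -> rep f 0.
Proof.
rewrite /rep => h; rewrite big1 ?subr0 // => j _; by rewrite mxE pz0 mul0r.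
Qed.

Lemma mu0_X (m : 'X_{1..d}) : mu a m = 0%N -> 'X_[m] = 'X_vz ^+ (m vz) :> R.
Proof.
move=> h; rewrite mpolyXn; congr ('X_[_]); apply/mnmP => l; rewrite mulmnE mnm1E.
have hl : lowdeg m = 0%N by move: h; rewrite /mu; nia.
have hy : m vy = 0%N by move: h; rewrite /mu; lia.
have [->|hlz] := eqVneq vz l; first by rewrite mul1n.
rewrite mul0n; have [->|hly] := eqVneq l vy; first by [].
have hll : low l by move: hly hlz; rewrite -!val_eqE /low /=; have := ltn_ord l; lia.
by have := lowdeg_ge m hll; rewrite hl; lia.
Qed.

Lemma rep_exists f : Wt a f -> exists w, rep f w.
Proof.
move=> hf; rewrite (mpolyE f) big_seq; apply: (big_ind (fun f => exists w, rep f w)).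
- by exists 0; apply: rep0; apply: ideal0.
- move=> u v [w hw] [w' hw']; exists (1%:P *: w + w').
  by have := rep_lin (c := 1%:P) hw hw'; rewrite pzC mpolyC1 mul1r.
move=> m hm; suff [w hw] : exists w, rep 'X_[m] w.
  exists ((f@_m)%:P *: w + 0); rewrite -mul_mpolyC -pzC -[_ * _]addr0.
  by apply: rep_lin => //; apply: rep0; apply: ideal0.
have hmu : (a <= mu a m)%N by apply: hf; rewrite -mcoeff_msupp.
have [hlt|hge] := ltnP a (mu a m); first by exists 0; apply: rep0; apply: supportedX.
have [j [m' [hj E Emu _]]] := mu_cgen_split k a_gt0 hmu.
exists ('X^(m' vz) *: delta_mx 0 j); rewrite /rep E (bigD1 j) //= big1 ?addr0.
  rewrite !mxE !eqxx mulr1 pzXn mu0_X; last by lia.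
  by rewrite mulrC subrr; apply: ideal0.
by move=> l /andP[_ hl]; rewrite !mxE (negbTE hl) andbF mulr0 pz0 mul0r.
Qed.

Variables (J : R -> Prop) (N : nat).
Hypothesis idJ : is_ideal J.
Hypothesis J_Wt : subideal J (Wt a).
Hypothesis J_red : forall f, ideal_exp LI N.+1 f -> ideal_mul J (ideal_exp LI N) f.

Definition Wm w : Prop := exists2 f, J f & rep f w.

Lemma Wm_submodule : submodule Wm.
Proof.
split; first by exists 0; [apply: ideal0 | apply: rep0; apply: ideal0].
move=> c w w' [f hf hw] [g hg hw']; exists (pz c * f + g); last exact: rep_lin.
by apply: idealD => //; apply: ideal_mulL.
Qed.

Section Arc.
(** The outer indeterminate of [{poly P}] is the arc parameter and the inner one is z; along the arc
    the generators of C have order at least [s], with coefficients prescribed by [t] up to the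
    factor [gam]. *)
Variables (Psi : {rmorphism R -> {poly P}}) (s : nat) (gam : P) (t : 'rV[P]_d).
Hypothesis Psi_C : forall c, Psi c%:MP = c%:P%:P.
Hypothesis Psi_z : Psi 'X_vz = 'X%:P.
Hypothesis Psi_cgen : forall j, j != vz -> Psi (cgen j) = (gam * t 0 j)%:P * 'X^s.
Hypothesis Psi_var : forall j, j != vz -> exists q, Psi 'X_j = q * 'X.
Hypothesis t_z : t 0 vz = 0.

Let dvX e f := exists q, Psi f = q * 'X^e.

Let dvX_ideal e : is_ideal (dvX e).
Proof.
split=> [|f g [q hq] [q' hq']|b f [q hq]].
- by exists 0; rewrite rmorph0 mul0r.
- by exists (q + q'); rewrite rmorphD hq hq' mulrDl.
- by exists (Psi b * q); rewrite rmorphM hq mulrA.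
Qed.

Let Psi_pz p : Psi (pz p) = p%:P.
Proof.
rewrite /pz -horner_map -map_poly_comp Psi_z.
have -> : map_poly (Psi \o @mpolyC d k) p = map_poly polyC (map_poly polyC p).
  by rewrite -map_poly_comp; apply: eq_map_poly => c /=; rewrite Psi_C.
rewrite horner_map; congr (_%:P); exact: comp_polyXr.
Qed.

Let dvX_Wt f : Wt a f -> dvX s f.
Proof.
apply: supported_sub => // m /(mu_cgen_split k a_gt0)[j [m' [hj -> _ _]]].
by apply: (ideal_mulR _ (dvX_ideal s)); rewrite /dvX Psi_cgen //; exists (gam * t 0 j)%:P.
Qed.

Let dvX_Wt1 f : Wt a.+1 f -> dvX s.+1 f.
Proof.
apply: supported_sub => // m hm.
have [j [m' [hj -> hmu _]]] := mu_cgen_split k a_gt0 (ltnW hm).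
have [i [hi hmi]] : exists i, i != vz /\ (0 < m' i)%N.
  have [hl|/lowdeg_gt0[i hi hmi]] := posnP (lowdeg m'); last first.
    by exists i; split=> //; apply: low_neq_vz.
  exists vy; rewrite eq_sym vz_neq_vy; split=> //.
  by move: hmu; rewrite [mu a m']/mu hl; lia.
have [q hq] := Psi_var hi.
exists ((gam * t 0 j)%:P * (Psi 'X_[m' - U_(i)] * q)).
have E : 'X_[m'] = 'X_[m' - U_(i)] * 'X_i :> R by rewrite -mpolyXD mnm_subK.
rewrite (rmorphM Psi) Psi_cgen // E (rmorphM Psi) hq exprS; ring.
Qed.

Let Psi_rep f w : rep f w -> (Psi f)`_s = gam * dot w t.
Proof.
move=> /dvX_Wt1[q hq]; rewrite -[f](subrK (\sum_(j | j != vz) pz (w 0 j) * cgen j)).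
rewrite rmorphD hq coefD exprS mulrA coefMXn ltnn subnn coefMX eqxx add0r.
rewrite rmorph_sum coef_sum /dot mulr_sumr [RHS](bigD1 vz) //= t_z !mulr0 add0r.
apply: eq_bigr => j hj; rewrite rmorphM Psi_pz Psi_cgen // mulrA -polyCM.
by rewrite coefCM coefXn eqxx mulr1 mulrCA.
Qed.

Let dvX_exp e f : ideal_exp LI e f -> dvX (s * e) f.
Proof.
elim: e f => [|e IH] f /=; first by exists (Psi f); rewrite muln0 mulr1.
apply: (ideal_mul_ind (dvX_ideal (s * e.+1))) => u v hu /IH[q hq].
have [q' hq'] : dvX s u by apply: dvX_Wt; apply/lordE => // m /hu /andP[].
by exists (q' * q); rewrite rmorphM hq hq' mulnS exprD mulrACA.
Qed.

(* Apply the arc [Psi] to [z ^ _ * c_i ^ N.+1], which lies in [J LI ^ N], and compare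
   the lowest coefficients in the arc parameter. *)
Lemma arc_lemma i : i != vz -> exists2 w, Wm w &
  gam * dot w t = 'X^(N.+1 * delta) * (gam * t 0 i) ^+ N.+1.
Proof.
move=> hi; have hWm := Wm_submodule.
have h1 : ideal_mul J (ideal_exp LI N) ('X_vz ^+ (N.+1 * delta) * cgen i ^+ N.+1).
  apply: J_red; apply/LI_exp => //.
  have hc : cgen i = 'X_[(if i == vy then U_(i) *+ a else U_(i))%MM].
    by rewrite /cgen; case: ifP; rewrite ?mpolyXn.
  rewrite hc !mpolyXn -mpolyXD; apply: supportedX; rewrite /Lmon lord_geq //; apply/andP; split.
    rewrite muD // mulnC; apply: leq_trans (leq_addl _ _).
    have hmuM (m : 'X_{1..d}) q : mu a (m *+ q)%MM = (mu a m * q)%N.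
      elim: q => [|q IH]; last by rewrite mulmS muD // IH mulnS.
      rewrite mulm0n muln0 /mu mnm0E addn0 /lowdeg big1 ?muln0 // => l _; by rewrite mnm0E.
    rewrite hmuM leq_mul2r /=; case: (eqVneq i vy) => [->|hiy].
      rewrite hmuM /mu mnm1E eqxx lowdegU; lia.
    have hli : low i by move: hi hiy; rewrite -!val_eqE /low /=; have := ltn_ord i; lia.
    by rewrite /mu lowdegU hli muln1 leq_addr.
  by rewrite mdegD mdegMn mdeg1 mul1n leq_addr.
pose Q f := dvX (s * N.+1) f /\ exists2 w, Wm w & (Psi f)`_(s * N.+1) = gam * dot w t.
have hQ : is_ideal Q.
  split.
  - split; first exact: ideal0.
    exists 0; first by case: hWm.
    by rewrite rmorph0 coef0 /dot big1 ?mulr0 // => j _; rewrite mxE mul0r.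
  - move=> f g [hf [w hw E]] [hg [w' hw' E']]; split; first exact: (idealD (dvX_ideal _)).
    exists (1 *: w + w'); first by apply: (proj2 hWm).
    by rewrite rmorphD coefD E E' dotDl dotZl mul1r mulrDr.
  - move=> b f [hf [w hw E]]; split; first exact: (ideal_mulL _ (dvX_ideal _)).
    exists ((Psi b)`_0 *: w); first exact: submoduleZ.
    rewrite dotZl mulrCA -E; case: hf => q hq.
    by rewrite rmorphM hq mulrA !coefMXn ltnn subnn -!horner_coef0 hornerM.
have [_ [w hw E]] : Q ('X_vz ^+ (N.+1 * delta) * cgen i ^+ N.+1).
  apply: (ideal_mul_ind hQ) h1 => u v hu /dvX_exp[q hq].
  have [w hw] := rep_exists (J_Wt hu).
  have [q' hq'] := dvX_Wt (J_Wt hu).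
  have E : Psi (u * v) = q' * q * 'X^(s * N.+1).
    by rewrite rmorphM hq hq' mulnS exprD mulrACA.
  split; first by exists (q' * q).
  exists (q`_0 *: w); first by apply: submoduleZ => //; exists u.
  rewrite dotZl mulrCA -(Psi_rep hw) E hq' !coefMXn !ltnn !subnn -!horner_coef0 hornerM.
  by rewrite mulrC.
exists w => //; rewrite -E rmorphM !rmorphXn /= Psi_z Psi_cgen // exprMn -exprM.
rewrite -!rmorphXn /= mulrA -polyCM coefCM coefXn eqxx mulr1 //.
Qed.

End Arc.
End LocalReduction.

(** * Generators of C inside a reduction, up to powers of z *)

Section LocalStructure.
Variables (n a delta : nat) (k : fieldType).
Hypotheses (a_gt0 : (0 < a)%N) (a_le : (a <= delta)%N).
Local Notation d := n.+3.
Local Notation R := {mpoly k[d]}.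
Local Notation P := {poly k}.
Local Notation vy := (vy n).
Local Notation vz := (vz n).
Local Notation Wt := (@Wt n a k).
Local Notation LI := (@LI n a delta k).
Local Notation cgen := (@cgen n a k).
Local Notation rep := (rep a).
Local Notation lead := (lead a delta).
Implicit Types (f g h u v : R) (i j : 'I_d) (w t : 'rV[P]_d).

Section Ideal.
Variables (J : R -> Prop) (N : nat).
Hypothesis idJ : is_ideal J.
Hypothesis J_Wt : subideal J (Wt a).
Hypothesis J_red : forall f, ideal_exp LI N.+1 f -> ideal_mul J (ideal_exp LI N) f.
Local Notation Wm := (Wm a J).

Let idW e : is_ideal (Wt e). Proof. exact: Wt_ideal. Qed.

Let arc_map (h : 'I_d -> {poly P}) : {rmorphism R -> {poly P}} := mmap (polyC \o polyC) h.

Let arc_mapC (h : 'I_d -> {poly P}) c : arc_map h c%:MP = c%:P%:P. Proof. exact: mmapC. Qed.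

Let arc_mapX (h : 'I_d -> {poly P}) i : arc_map h 'X_i = h i. Proof. by rewrite /= mmapX mmap1U. Qed.

Let e := (N.+1 * delta)%N.

Let low_arc t i : (forall j, ~~ low j -> t 0 j = 0) -> i != vz ->
  exists2 w, Wm w & dot w t = 'X^e * t 0 i ^+ N.+1.
Proof.
move=> ht hi; pose h j : {poly P} := if low j then (t 0 j)%:P * 'X else if j == vz then 'X%:P else 0.
have lowz : low vz = false by rewrite /low /=; lia.
have lowy : low vy = false by rewrite /low /=; lia.
have [||||w hw E] := @arc_lemma n a delta k a_gt0 a_le J N idJ J_Wt J_red
  (arc_map h) 1%N 1 t (arc_mapC h) _ _ _ _ i hi.
- by rewrite arc_mapX /h lowz eqxx.
- move=> j hj; rewrite mul1r expr1 /cgen; case: (eqVneq j vy) => [->|hjy].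
    by rewrite rmorphXn /= arc_mapX /h lowy eq_sym vz_neq_vy expr0n ht ?lowy // mul0r; case: (a) a_gt0.
  rewrite arc_mapX /h; have -> // : low j.
  by move: hj hjy; rewrite -!val_eqE /low /=; have := ltn_ord j; lia.
- move=> j hj; rewrite arc_mapX /h; case: ifP => _; first by exists (t 0 j)%:P.
  by rewrite (negbTE hj); exists 0; rewrite mul0r.
- by apply: ht; rewrite lowz.
by exists w => //; move: E; rewrite !mul1r.
Qed.

(** Along this arc y^a has order [a], so the other generators are given that order too. Its
    coefficient is necessarily an [a]-th power; the common factor [gam], the power [a.-1] of the
    y-entry of [t], avoids extracting a root. *)
Let y_arc t p : t 0 vz = 0 -> t 0 vy = 'X^p ->
  exists2 w, Wm w & exists q, dot w t = 'X^q.
Proof.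
move=> ht hty; pose gam : P := t 0 vy ^+ a.-1.
pose h j : {poly P} := if low j then (gam * t 0 j)%:P * 'X^a
  else if j == vy then (t 0 vy)%:P * 'X else 'X%:P.
have lowz : low vz = false by rewrite /low /=; lia.
have lowy : low vy = false by rewrite /low /=; lia.
have lowj j : j != vz -> j != vy -> low j.
  by rewrite -!val_eqE /low /=; have := ltn_ord j; lia.
have [||||w hw E] := @arc_lemma n a delta k a_gt0 a_le J N idJ J_Wt J_red
  (arc_map h) a gam t (arc_mapC h) _ _ _ ht vy _.
- by rewrite arc_mapX /h lowz vz_neq_vy.
- move=> j hj; rewrite /cgen; case: (eqVneq j vy) => [->|hjy].
    rewrite rmorphXn /= arc_mapX /h lowy eqxx exprMn -rmorphXn /=; congr (_%:P * _).
    by rewrite /gam -exprSr prednK.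
  by rewrite arc_mapX /h lowj.
- move=> j hj; rewrite arc_mapX /h; case: (eqVneq j vy) => [->|hjy].
    by rewrite lowy; exists (t 0 vy)%:P.
  rewrite lowj //; exists ((gam * t 0 j)%:P * 'X^(a.-1)).
  by rewrite -mulrA -exprSr prednK.
- by rewrite eq_sym vz_neq_vy.
exists w => //; exists (e + (p * a.-1 * N + p * N.+1))%N.
have gE : gam = 'X^(p * a.-1) by rewrite /gam hty -exprM.
have g0 : gam != 0 by rewrite gE monic_neq0 // monicXn.
apply: (mulfI g0); rewrite E {}gE hty -!exprD -!exprM -!exprD; congr (_ ^+ _); lia.
Qed.

Let Wm_plus w q j : j != vz -> Wm w -> (forall i, i != vz -> w 0 i = 'X^q *+ (i == j)) ->
  plus J (Wt a.+1) ('X_vz ^+ q * cgen j).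
Proof.
move=> hj [f hf hrep] hw; exists ('X_vz ^+ q * cgen j - f); last first.
  by rewrite opprB addrCA subrr addr0.
have -> : 'X_vz ^+ q * cgen j - f = - (f - \sum_(i | i != vz) pz n (w 0 i) * cgen i).
  rewrite opprB (bigD1 j) //= hw // eqxx pzXn big1 ?addr0 // => i /andP[hi hij].
  by rewrite hw // (negbTE hij) mulr0n pz0 mul0r.
exact: (idealN (idW _)).
Qed.

(** Arcs with y sent to 0 determine the low variables by [elimination]; one further arc isolates
    y^a, whose row then clears the y-entries of the others. *)
Lemma local_structure : exists q, forall j, j != vz ->
  plus J (Wt a.+1) ('X_vz ^+ q * cgen j).
Proof.
have hWm : submodule Wm by apply: Wm_submodule.
have X0 : ('X : P) != 0 by rewrite monic_neq0 // monicX.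
pose s := [seq i <- enum 'I_d | low i].
have sE i : (i \in s) = low i by rewrite mem_filter mem_enum andbT.
have lowz : low vz = false by rewrite /low /=; lia.
have lowy : low vy = false by rewrite /low /=; lia.
have lowj j : j != vz -> j != vy -> low j.
  by rewrite -!val_eqE /low /=; have := ltn_ord j; lia.
have us : uniq s by rewrite filter_uniq // enum_uniq.
have [|M hM] := @elimination P 'X X0 d s Wm e N.+1 us hWm.
  move=> t i ht; rewrite sE => hi; apply: low_arc; last exact: low_neq_vz.
  by move=> j hj; apply: ht; rewrite sE.
have [F hF] : exists F : 'I_d -> 'rV[P]_d, forall i, low i ->
    Wm (F i) /\ forall j, low j -> F i 0 j = 'X ^+ M *+ (i == j).
  apply: (@fin_all_exists _ _ (fun i w => low i ->
    Wm w /\ forall j, low j -> w 0 j = 'X ^+ M *+ (i == j))) => i.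
  case: (boolP (low i)) => [hi|_]; last by exists 0.
  have [|w hw hE] := hM i; first by rewrite sE.
  by exists w => _; split=> // j hj; apply: hE; rewrite sE.
(* This [t] is orthogonal to all rows [F i]. Clearing the low entries of [w] by these rows therefore
   only rescales [dot w t], which exhibits the remaining y-entry as a power of the indeterminate. *)
pose t : 'rV[P]_d := \row_j (if low j then - F j 0 vy else if j == vy then 'X^M else 0).
have [||w hw [q hq]] := @y_arc t M.
- by rewrite mxE lowz vz_neq_vy.
- by rewrite mxE lowy eqxx.
have tz : t 0 vz = 0 by rewrite mxE lowz vz_neq_vy.
have ty : t 0 vy = 'X^M by rewrite mxE lowy eqxx.
have dotE (u : 'rV[P]_d) : dot u t = \sum_(j | low j) u 0 j * t 0 j + u 0 vy * 'X^M.
  rewrite /dot (bigID (@low n)) /=; congr (_ + _).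
  rewrite (bigD1 vy) /=; last by rewrite lowy.
  rewrite ty big1 ?addr0 // => j /andP[h1 h2].
  have -> : j = vz by apply/eqP; apply: contraNT h1 => h1; apply: lowj.
  by rewrite tz mulr0.
have dotF i : low i -> dot (F i) t = 0.
  move=> hi; rewrite dotE (bigD1 i) //= big1 => [|j /andP[hj hji]].
    by rewrite (proj2 (hF i hi)) // eqxx mxE hi addr0 mulr1n mulrN mulrC addNr.
  by rewrite (proj2 (hF i hi)) // eq_sym (negbTE hji) mul0r.
pose w' := 'X^M *: w - \sum_(i <- s) w 0 i *: F i.
have hw' : Wm w'.
  apply: submoduleB => //; first exact: submoduleZ.
  rewrite big_seq; apply: submodule_sum => // i; rewrite sE => hi.
  by apply: submoduleZ => //; case: (hF i hi).
have w'low j : low j -> w' 0 j = 0.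
  move=> hj; rewrite !mxE summxE (bigD1_seq j) ?sE //= big_seq_cond big1.
    by rewrite mxE (proj2 (hF j hj)) // eqxx mulr1n addr0 mulrC subrr.
  by move=> l /andP[]; rewrite sE mxE => hl hlj; rewrite (proj2 (hF l hl)) // (negbTE hlj) mulr0.
have w'y : w' 0 vy = 'X^q.
  have XM : ('X^M : P) != 0 by rewrite monic_neq0 // monicXn.
  apply: (mulIf XM); have : dot w' t = 'X^M * 'X^q.
    rewrite /w' dotDl dotZl hq -scaleN1r dotZl [X in _ + _ * X](_ : _ = 0) ?mulr0 ?addr0 //.
    rewrite /dot; under eq_bigr do rewrite summxE mulr_suml.
    rewrite exchange_big /= big_seq big1 // => i; rewrite sE => hi.
    rewrite -[RHS](mulr0 (w 0 i)) -[X in _ = _ * X](dotF i hi).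
    by rewrite mulr_sumr; apply: eq_bigr => j _; rewrite mxE mulrA.
  rewrite dotE big1 ?add0r => [->|j hj]; first by rewrite mulrC.
  by rewrite w'low // mul0r.
have Xq (c : P) (u v : 'rV[P]_d) : Wm u -> Wm v -> Wm ('X^q *: u - c *: v).
  by move=> hu hv; apply: submoduleB => //; apply: submoduleZ.
have entry (c c' : P) (u v : 'rV[P]_d) l : (c *: u - c' *: v) 0 l = c * u 0 l - c' * v 0 l.
  by rewrite !mxE.
exists (q + M)%N => j hj; case: (eqVneq j vy) => [->|hjy].
  apply: (@Wm_plus ('X^M *: w')); first by rewrite eq_sym vz_neq_vy.
    exact: submoduleZ.
  move=> i hi; rewrite mxE; case: (eqVneq i vy) => [->|hiy].
    by rewrite w'y -exprD addnC mulr1n.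
  by rewrite w'low ?mulr0 //; apply: lowj.
have hlj := lowj _ hj hjy.
apply: (@Wm_plus ('X^q *: F j - F j 0 vy *: w')) => //.
  by apply: Xq => //; case: (hF j hlj).
move=> i hi; case: (eqVneq i vy) => [->|hiy].
  by rewrite entry eq_sym (negbTE hjy) mulr0n w'y mulrC subrr.
have hli := lowj _ hi hiy.
rewrite entry w'low // mulr0 subr0 (proj2 (hF j hlj)) // mulrnAr -exprD eq_sym //.
Qed.

End Ideal.

End LocalStructure.

(** * Lowest homogeneous components of products *)

Section LowestComponents.
Variables (d : nat) (k : fieldType).
Local Notation R := {mpoly k[d]}.
Implicit Types (f g h : R) (m : 'X_{1..d}).

Definition order_ge (e : nat) f : Prop := supported (fun m => (e <= mdeg m)%N) f.

Lemma order_geM e e' f g : order_ge e f -> order_ge e' g -> order_ge (e + e')%N (f * g).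
Proof. by apply: supportedM => m m' h h'; rewrite mdegD leq_add. Qed.

Lemma order_ge_comp e f : order_ge e.+1 f -> hcomp e f = 0.
Proof.
move=> hf; apply/mpolyP => m; rewrite mcoeff_comp mcoeff0; case: eqP => // E.
by apply/eqP/negPn/negP => /hf; rewrite E ltnn.
Qed.

Lemma comp_order_ge e f : order_ge e (hcomp e f).
Proof. by move=> m; rewrite mcoeff_comp; case: (eqVneq (mdeg m) e) => [->|_]; rewrite ?eqxx. Qed.

Lemma sub_comp_order (P : pred 'X_{1..d}) e f : supported (fun m => P m && (e <= mdeg m)%N) f ->
  supported (fun m => P m && (e < mdeg m)%N) (f - hcomp e f).
Proof.
move=> hf m; rewrite mcoeffB mcoeff_comp; case: (eqVneq (mdeg m) e) => [E|hne]; first by rewrite subrr eqxx.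
by rewrite subr0 => /hf /andP[-> h]; rewrite ltn_neqAle h eq_sym andbT.
Qed.

Lemma hcompM_low e e' f g : order_ge e f -> order_ge e' g ->
  hcomp (e + e')%N (f * g) = hcomp e f * hcomp e' g.
Proof.
move=> hf hg.
have cut q p : order_ge q p -> order_ge q.+1 (p - hcomp q p).
  move=> hp m hm; have := @sub_comp_order predT q p; apply => //.
have -> : f * g = hcomp e f * hcomp e' g + ((f - hcomp e f) * g + hcomp e f * (g - hcomp e' g)) by ring.
rewrite raddfD /= [X in _ + X](_ : _ = 0) ?addr0; last first.
  apply: order_ge_comp; apply: supportedD.
    by have := order_geM (cut _ _ hf) hg; rewrite addSn.
  by have := order_geM (@comp_order_ge e f) (cut _ _ hg); rewrite addnS.
by apply: pihomog_dE; apply: dhomogM; apply: pihomogP.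
Qed.

End LowestComponents.

(** * Prescribing leading coefficients in [V] *)

Section LowerInclusion.
Variables (n a delta : nat) (k : fieldType).
Hypotheses (a_gt0 : (0 < a)%N) (a_le : (a <= delta)%N).
Local Notation d := n.+3.
Local Notation R := {mpoly k[d]}.
Local Notation vy := (vy n).
Local Notation vz := (vz n).
Local Notation sigma := (sigma n delta).
Local Notation Wt := (@Wt n a k).
Local Notation LI := (@LI n a delta k).
Local Notation cgen := (@cgen n a k).
Local Notation lead := (lead a delta).
Local Notation leadm := (leadm a delta).
Implicit Types (f g h u v : R) (i j : 'I_d) (m : 'X_{1..d}).

Let idW e : is_ideal (Wt e). Proof. exact: Wt_ideal. Qed.

Hypothesis delta_ge2 : (2 <= delta)%N.

Lemma mu_leadm j q : j != vz -> mu a (leadm j + U_(vz) *+ q)%MM = a.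
Proof.
move=> hj; rewrite muD // mu_z addn0 /leadm; case: (eqVneq j vy) => [->|hjy]; rewrite muD // mu_z addn0.
  rewrite /mu mulmnE mnm1E eqxx [lowdeg _](_ : _ = 0%N); first by lia.
  by rewrite /lowdeg big1 // => i hi; rewrite mulmnE mnm1E eq_sym low_neq_vy.
have hlj : low j by move: hj hjy; rewrite -!val_eqE /low /=; have := ltn_ord j; lia.
by rewrite /mu lowdegU hlj mnm1E (negbTE hjy); lia.
Qed.

Lemma leadm_diag l : l != vz -> (0 < leadm l l)%N.
Proof.
move=> hl; rewrite /leadm; case: eqP => _; rewrite mnmDE !mulmnE ?mulmnE !mnm1E eqxx; lia.
Qed.

Lemma leadm_off l j : l != vz -> l != j -> leadm j l = 0%N.
Proof.
move=> hl hlj; rewrite /leadm.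
by case: ifP => _; rewrite mnmDE !mulmnE ?mulmnE !mnm1E (eq_sym j) (negbTE hlj) (eq_sym vz) (negbTE hl).
Qed.

(** Monomials of [v] other than the [leadm l] have too large a weight to contribute, and among the
    [leadm l] only [leadm j] divides the monomial considered. *)
Lemma coef_mul_lead h v j q : v \is delta.-homog -> Wt a v -> j != vz ->
  (h * v)@_(leadm j + U_(vz) *+ q) = h@_(U_(vz) *+ q) * lead v j.
Proof.
move=> hv hW hj; have hdec := lead_decomp a_gt0 a_le delta_ge2 hv hW.
rewrite -{1}[v](subrK (\sum_(l | l != vz) lead v l *: 'X_[leadm l])) mulrDr mcoeffD.
rewrite [X in X + _](_ : _ = 0) ?add0r; last first.
  apply/eqP/negPn/negP => /(ideal_mulL h (idW _) hdec).
  by rewrite mu_leadm // ltnn.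
rewrite mulr_sumr raddf_sum /= (bigD1 j) //= -scalerAr mcoeffZ mcoeffMX mulrC big1 ?addr0 //.
move=> l /andP[hl hlj]; rewrite -scalerAr mcoeffZ.
suff -> : (h * 'X_[leadm l])@_(leadm j + U_(vz) *+ q) = 0 by rewrite mulr0.
apply/eqP/negPn/negP => hm.
have: supported (fun m => (leadm l <= m)%MM) (h * 'X_[leadm l]).
  apply: (@supportedM _ _ predT (fun m => m == leadm l)) => //.
    by move=> m1 m2 _ /eqP ->; rewrite lem_addl.
  exact: supportedX.
move=> /(_ _ hm) /mnm_lepP /(_ l).
rewrite mnmDE mulmnE mnm1E (eq_sym vz) (negbTE hl) mul0n addn0 (leadm_off hl hlj).
by have := leadm_diag hl; lia.
Qed.

Section LeadSurjective.
Variables (V : R -> Prop) (N : nat).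
Hypothesis V_homog : forall v, V v -> v \is delta.-homog.
Hypothesis V_lin : forall v w c, V v -> V w -> V (v + c *: w).
Hypothesis V0 : V 0.
Hypothesis V_C : forall v, V v -> Wt a v.
Hypothesis V_red : forall f, ideal_exp LI N.+1 f -> ideal_mul V (ideal_exp LI N) f.

(** By [local_structure] the ideal generated by [V] contains the leading monomials times powers of
    z, modulo higher weight; reading off coefficients sends this ideal back to leading coefficients
    of the vector space [V]. *)
Lemma lead_surj (r : 'I_d -> k) : exists2 v, V v & forall j, j != vz -> lead v j = r j.
Proof.
have idG := ideal_gen_ideal V.
have VZ c v : V v -> V (c *: v) by move=> hv; rewrite -[_ *: _]add0r; apply: V_lin.
have VD v w : V v -> V w -> V (v + w) by move=> hv hw; rewrite -[w]scale1r; apply: V_lin.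
have [||q hq] := @local_structure n a delta k a_gt0 a_le (ideal_gen V) N idG.
- by move=> f; apply; [apply: idW | apply: V_C].
- move=> f /V_red; apply: ideal_mulS; exact: ideal_gen_sub.
have unit_lead i : i != vz -> exists2 v, V v & forall j, j != vz -> lead v j = (i == j)%:R.
  (* With this [p], [z ^ (delta + q) * cgen i] is [leadm i] times [z ^ p]. *)
  move=> hi; pose p := (q + (if i == vy then a else 1))%N.
  pose Q f := forall h, exists2 v, V v &
    forall j, j != vz -> (h * f)@_(leadm j + U_(vz) *+ p) = lead v j.
  have lead0 j : lead 0 j = 0 by rewrite /lead mcoeff0 if_same.
  have hQ : is_ideal Q.
    split.
    - by move=> h; exists 0 => // j hj; rewrite mulr0 mcoeff0 lead0.
    - move=> f g hf hg h; have [v hv E] := hf h; have [v' hv' E'] := hg h.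
      exists (v + v'); first exact: VD.
      move=> j hj; rewrite mulrDr mcoeffD E // E' //.
      by rewrite -[v']scale1r lead_lin mul1r scale1r.
    - by move=> b f hf h; have := hf (h * b); rewrite mulrA.
  have [w hw hG] := hq i hi.
  have [|v hv E] := (hG Q hQ _) ('X_vz ^+ delta).
    move=> v hv h; exists (h@_(U_(vz) *+ p) *: v); first exact: VZ.
    move=> j hj; rewrite coef_mul_lead //; [|exact: V_homog|exact: V_C].
    by rewrite -[_ *: v]add0r lead_lin lead0 add0r.
  exists v => // j hj; rewrite -E // mulrBr mcoeffB.
  rewrite [X in _ - X](_ : _ = 0) ?subr0; last first.
    apply/eqP/negPn/negP => /(ideal_mulL ('X_vz ^+ delta) (idW _) hw).
    by rewrite mu_leadm // ltnn.
  have -> : 'X_vz ^+ delta * ('X_vz ^+ q * cgen i) = 'X_[leadm i + U_(vz) *+ p].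
    transitivity (cgen i * 'X_vz ^+ (delta + q)); first by rewrite exprD; ring.
    rewrite mpolyXD (leadmE a delta k hi) -mpolyXn -mulrA -exprD; congr (_ * _ ^+ _).
    by rewrite /p; case: ifP => _; lia.
  rewrite mcoeffX; congr (_%:R); case: (eqVneq i j) => [->|hij]; first by rewrite eqxx.
  suff /negbTE -> : (leadm i + U_(vz) *+ p)%MM != (leadm j + U_(vz) *+ p)%MM by [].
  apply/eqP => /(congr1 (fun m : 'X_{1..d} => m i)).
  rewrite !mnmDE !mulmnE !mnm1E (eq_sym vz) (negbTE hi) mul0n !addn0 (leadm_off hi hij).
  by have := leadm_diag hi; lia.
have [F hF] : exists F : 'I_d -> R, forall i, i != vz ->
    V (F i) /\ forall j, j != vz -> lead (F i) j = (i == j)%:R.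
  apply: (@fin_all_exists _ _ (fun i v => i != vz ->
    V v /\ forall j, j != vz -> lead v j = (i == j)%:R)) => i.
  by case: (boolP (i != vz)) => [/unit_lead[v hv E]|_]; [exists v | exists 0].
exists (\sum_(i | i != vz) r i *: F i).
  apply: big_ind => // i hi; by apply: VZ; case: (hF i hi).
move=> j hj; have leadS : lead (\sum_(i | i != vz) r i *: F i) j = \sum_(i | i != vz) r i * lead (F i) j.
  rewrite mcoeff_leadm // raddf_sum; apply: eq_bigr => i hi /=.
  by rewrite mcoeffZ mcoeff_leadm.
rewrite leadS (bigD1 j) //= (proj2 (hF j hj)) // eqxx mulr1 big1 ?addr0 // => i /andP[hi hij].
by rewrite (proj2 (hF i hi)) // (negbTE hij) mulr0.
Qed.

End LeadSurjective.

End LowerInclusion.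

(** * From initial forms to arbitrary reductions *)

Section Lower.
Variables (n a delta : nat) (k : fieldType).
Hypotheses (a_gt0 : (0 < a)%N) (a_le : (a <= delta)%N) (delta_ge2 : (2 <= delta)%N).
Hypothesis char0 : [pchar k] =i pred0.
Local Notation d := n.+3.
Local Notation R := {mpoly k[d]}.
Local Notation vy := (vy n).
Local Notation vz := (vz n).
Local Notation sigma := (sigma n delta).
Local Notation Wt := (@Wt n a k).
Local Notation LI := (@LI n a delta k).
Implicit Types (f g h u v : R) (i j : 'I_d) (m : 'X_{1..d}).

Variables (J : R -> Prop) (N : nat).
Hypothesis idJ : is_ideal J.
Hypothesis J_LI : subideal J LI.
Hypothesis N_gt0 : (0 < N)%N.
Hypothesis J_red : forall f, ideal_exp LI N.+1 f -> ideal_mul J (ideal_exp LI N) f.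

Let V v := exists2 f, J f & v = hcomp delta f.

Let Wd s : R -> Prop := supported (fun m => (a <= mu a m)%N && (s <= mdeg m)%N).

Let idWd s : is_ideal (Wd s).
Proof. by apply: supported_ideal => m m' /andP[h1 h2]; rewrite muD // mdegD; lia. Qed.

Let LI_Wd f : LI f -> Wd delta f.
Proof. by move=> hf m /hf; rewrite /Lmon lord_geq // !mul1n. Qed.

Let J_Wt : subideal J (Wt a).
Proof. by move=> f /J_LI /LI_Wd hf m /hf /andP[]. Qed.

Let V_homog v : V v -> v \is delta.-homog.
Proof. by move=> [f _ ->]; apply: pihomogP. Qed.

Let V_lin v w c : V v -> V w -> V (v + c *: w).
Proof.
move=> [f hf ->] [g hg ->]; exists (f + c *: g); last by rewrite raddfD /= linearZ.
by apply: idealD => //; apply: idealZ.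
Qed.

Let V0 : V 0. Proof. by exists 0; [apply: ideal0 | rewrite raddf0]. Qed.

Let V_C v : V v -> Wt a v.
Proof. by move=> [f /J_Wt hf ->]; apply: supported_comp. Qed.

(** Taking lowest components replaces [J] by [V] in degree exactly [N.+1 * delta]; the other
    monomials of [L ^ N.+1] are multiples of monomials of that degree. *)
Let V_red f : ideal_exp LI N.+1 f -> ideal_mul V (ideal_exp LI N) f.
Proof.
have idVL := ideal_mul_ideal V (ideal_exp LI N).
move=> /LI_exp -/(_ a_gt0 a_le); apply: supported_sub => // m hm.
have hdeg : (N.+1 * delta + (mdeg m - N.+1 * delta) <= mdeg m)%N by case/andP: hm; lia.
have [m1 [m2 [E E1 hm2]]] := Lmon_remove_many a_gt0 a_le hm hdeg.
rewrite E mpolyXD; apply: (ideal_mulL _ idVL).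
have Em2 : mdeg m2 = (N.+1 * delta)%N.
  by move: hm; rewrite E => /andP[_]; have := congr1 (@mdeg _) E; rewrite !mdegD E1; lia.
pose Q f := order_ge (N.+1 * delta) f /\ ideal_mul V (ideal_exp LI N) (hcomp (N.+1 * delta)%N f).
have hQ : is_ideal Q.
  split.
  - by split; [apply: supported0 | rewrite raddf0; apply: (ideal0 idVL)].
  - move=> g h [h1 h2] [h3 h4]; split; first exact: supportedD.
    by rewrite raddfD; apply: (idealD idVL).
  - move=> b g [h1 h2]; split.
      by have := order_geM (e := 0) (f := b) (fun m _ => isT) h1; rewrite add0n.
    have := @hcompM_low _ _ 0%N (N.+1 * delta)%N b g (fun m _ => isT) h1.
    by rewrite add0n => ->; apply: (ideal_mulL _ idVL).
have [_] : Q 'X_[m2].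
  apply: (ideal_mul_ind hQ (I := J) (J := ideal_exp LI N)); last first.
    by apply: J_red; apply/LI_exp => //; apply: supportedX.
  move=> u v hu hv; have hu' : order_ge delta u by move=> m0 /(LI_Wd (J_LI hu)) /andP[].
  have /LI_exp -/(_ a_gt0 a_le) hv' := hv.
  have hv2 : order_ge (N * delta) v by move=> m0 /hv' /andP[].
  split; first by rewrite mulSn; apply: order_geM.
  rewrite mulSn hcompM_low //; apply: ideal_mul_in; first by exists u.
  by apply/LI_exp => //; apply: supported_comp.
by rewrite pihomog_dE // -Em2; apply: homogX.
Qed.

Let J_big : exists n0, forall m, (a <= mu a m)%N -> (n0 <= mdeg m)%N -> J 'X_[m].
Proof.
have [q hq] := local_structure a_gt0 a_le idJ J_Wt J_red.
pose T := (a * N.+1)%N; pose E := (N.+1 * delta)%N.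
have J_pow f : supported (fun m => (T <= mu a m)%N && (E <= mdeg m)%N) f -> J f.
  move=> hf; have : ideal_mul J (ideal_exp LI N) f.
    by apply: J_red; apply/LI_expE => // m /hf; rewrite mulnC.
  by apply: ideal_mul_ind => // u v hu _; apply: ideal_mulR.
exists (q * T + T + E + T)%N => m hmu hdeg.
have [hT|hT] := leqP T (mu a m).
  by apply: J_pow; apply: supportedX; rewrite hT; lia.
(* The element of large weight given by [Wt_raise] need not be homogeneous; [z ^ E] is set aside to
   lift all its terms to the degree required by [L ^ N.+1]. *)
have hz : (E <= m vz)%N by have := mdeg_mu a_gt0 m; lia.
have EE : m = (U_(vz) *+ E + (m - U_(vz) *+ E))%MM.
  rewrite addmC submK //; apply/mnm_lepP => i; rewrite mulmnE mnm1E.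
  by case: eqP => [<-|_]; rewrite ?mul1n ?mul0n.
have hm' : mu a (m - U_(vz) *+ E)%MM = mu a m.
  by rewrite [in RHS]EE muD // mu_z.
have hd : mdeg m = (E + mdeg (m - U_(vz) *+ E)%MM)%N by rewrite {1}EE mdegD mdegMn mdeg1 mul1n.
have hmu' : (a <= mu a (m - U_(vz) *+ E)%MM)%N by rewrite hm'.
have hdeg' : (q * T + T <= mdeg (m - U_(vz) *+ E)%MM)%N by move: hdeg; rewrite hd; lia.
have [w hw hJ] := Wt_raise a_gt0 idJ hq hmu' hdeg'.
rewrite EE mpolyXD -[X in _ * X](subrK w) mulrDr; apply: idealD => //; first exact: ideal_mulL.
apply: J_pow; apply: (@supportedM _ _ (fun m => E <= mdeg m)%N (fun m => T <= mu a m)%N) hw => //.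
  by move=> m1 m2 h1 h2; rewrite muD // mdegD; lia.
by apply: supportedX; rewrite mdegMn mdeg1 mul1n.
Qed.

Let D := (sigma + delta.-1)%N.

(** A form in the ideal generated by [V] is the initial form of an element of [J], with an error of
    higher degree that stays in C; this feeds the descending induction. *)
Let V_lift u e : ideal_gen V u -> plus J (Wd e.+1) (hcomp e u).
Proof.
pose Q f := forall h, plus J (Wd e.+1) (hcomp e (h * f)).
have idP : is_ideal (plus J (Wd e.+1)) by apply: plus_ideal.
have hQ : is_ideal Q.
  split=> [h|f g hf hg h|b f hf h].
  - by rewrite mulr0 raddf0; apply: (ideal0 idP).
  - by rewrite mulrDr raddfD; apply: (idealD idP); [apply: hf | apply: hg].
  - by rewrite mulrA; apply: hf.
move=> /(_ Q hQ) hu; rewrite -[u]mul1r; apply: hu => _ [f hf ->] h.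
have hv : hcomp delta f \is delta.-homog by apply: pihomogP.
have [he|he] := ltnP e delta; first by rewrite (compM_homog_lt _ hv he); apply: (ideal0 idP).
rewrite -[X in pihomog mdeg X](subnK he) (compM_homog _ _ hv).
set h1 := hcomp _ h; exists (- (h1 * (f - hcomp delta f))).
  apply: (idealN (idWd _)).
  apply: (@supportedM _ _ (fun m => (e - delta <= mdeg m)%N)
            (fun m => (a <= mu a m)%N && (delta < mdeg m)%N)).
  - by move=> m1 m2 h2 /andP[h3 h4]; rewrite muD // mdegD; lia.
  - exact: comp_order_ge.
  - exact: (sub_comp_order (P := fun m => (a <= mu a m)%N) (LI_Wd (J_LI hf))).
by rewrite opprK -mulrDr addrC subrK; apply: ideal_mulL.
Qed.

Lemma lower_inclusion f :
  supported (fun m => (0 < lord a m)%N && (D <= mdeg m)%N) f -> J f.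
Proof.
have [n0 hn0] := J_big.
have base g : Wd n0 g -> J g.
  by apply: supported_sub => // m /andP[]; apply: hn0.
have gen_s e m : (D <= e)%N -> (a <= mu a m)%N -> mdeg m = e -> ideal_gen V 'X_[m].
  move=> hD hmu hm.
  have hL : Lmon a delta 1 m.
    by rewrite /Lmon lord_geq // !mul1n hmu hm; move: hD; rewrite /D /sigma; nia.
  have hdeg : (1 * delta + (e - D) <= mdeg m)%N.
    by rewrite hm; move: hD; rewrite /D /sigma; nia.
  have [m1 [m2 [E E1 hm2]]] := Lmon_remove_many a_gt0 a_le hL hdeg.
  have Em2 : mdeg m2 = D by move: hm; rewrite E mdegD E1; lia.
  rewrite E mpolyXD; apply: (ideal_mulL _ (ideal_gen_ideal V)).
  apply: (degree_bound a_gt0 a_le delta_ge2 char0 V_homog V_lin V_C N_gt0 V_red).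
  - by move=> r; apply: (lead_surj a_gt0 a_le delta_ge2 V_homog V_lin V0 V_C V_red).
  - by rewrite -/D -Em2; apply: homogX.
  - by apply: supportedX; move: hm2; rewrite /Lmon lord_geq // mul1n => /andP[].
have step e g : (D <= n0 - e)%N -> Wd (n0 - e) g -> J g.
  elim: e g => [|e IH] g; first by rewrite subn0 => _; apply: base.
  move=> hD hg; set s := (n0 - e.+1)%N in hD hg.
  have [hle|hlt] := leqP n0 e.
    by apply: IH; rewrite (_ : (n0 - e = s)%N) // /s; lia.
  have IH' h : Wd s.+1 h -> J h.
    by rewrite (_ : s.+1 = (n0 - e)%N) => [hh|]; [apply: IH => //; lia | rewrite /s; lia].
  rewrite -[g](subrK (hcomp s g)); apply: idealD => //.
    by apply: IH'; apply: (sub_comp_order (P := fun m => (a <= mu a m)%N)).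
  have : ideal_gen V (hcomp s g).
    apply: (@supported_sub _ _ _ (fun m => (a <= mu a m)%N && (mdeg m == s))).
    - exact: ideal_gen_ideal.
    - by move=> m /andP[h1 /eqP h2]; apply: gen_s h2.
    move=> m; rewrite mcoeff_comp; case: ifP => [_|_]; last by rewrite eqxx.
    by move=> /hg /andP[->].
  move=> /(@V_lift _ s) [w /IH' hw]; rewrite pihomog_id => hJ.
  by rewrite -[hcomp s g](subrK w); apply: idealD.
move=> hf; have hWf : Wd D f by move=> m /hf; rewrite lord_geq // mul1n.
have [h|h] := leqP n0 D.
  by apply: base => m /hWf /andP[-> h']; apply: leq_trans h h'.
by apply: (step (n0 - D)%N); rewrite subKn // ltnW.
Qed.

End Lower.

(** * A special reduction and a functional killing it *)

Section Nilpotents.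
Variables (R : comNzRingType) (L J : R -> Prop).
Hypotheses (idL : is_ideal L) (idJ : is_ideal J) (J_L : subideal J L).
Implicit Types f g u w : R.

(* [nil f] says that the image of [f] in the quotient of the Rees algebra of [L]
   by [J] is nilpotent. *)
Definition nil f : Prop := L f /\ exists q, ideal_mul J (ideal_exp L q) (f ^+ q.+1).

Let idJL q : is_ideal (ideal_mul J (ideal_exp L q)). Proof. exact: ideal_mul_ideal. Qed.

Lemma nilJ f : J f -> nil f.
Proof.
by move=> hf; split; [apply: J_L | exists 0%N; rewrite expr1 -[f]mulr1; apply: ideal_mul_in].
Qed.

Lemma nilD f g : nil f -> nil g -> nil (f + g).
Proof.
move=> [hf [p hp]] [hg [q hq]]; split; first exact: idealD.
exists (p + q)%N; rewrite exprDn; apply: ideal_sum => // -[i /= hi0] _.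
rewrite -mulr_natl; apply: (ideal_mulL _ (idJL _)).
have [hi|hi] := leqP i q.
  have -> : ((p + q).+1 - i = p.+1 + (q - i))%N by lia.
  rewrite exprD -mulrA; apply: ideal_mul_expD => //.
  by rewrite -{1}(subnK hi); apply: ideal_expD; apply: ideal_expX.
have -> : g ^+ i = g ^+ q.+1 * g ^+ (i - q.+1) by rewrite -exprD; congr (_ ^+ _); lia.
rewrite mulrCA [X in ideal_exp L X]addnC; apply: ideal_mul_expD => //.
have E : ((p + q).+1 - i + (i - q.+1) = p)%N by lia.
by rewrite -[X in ideal_exp L X]E; apply: ideal_expD; apply: ideal_expX.
Qed.

Lemma nil_sum (T : Type) (r : seq T) (P : pred T) (F : T -> R) :
  (forall i, P i -> nil (F i)) -> nil (\sum_(i <- r | P i) F i).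
Proof.
move=> hF; apply: (big_ind nil) => //; last exact: nilD.
apply: nilJ; exact: (ideal0 idJ).
Qed.

Lemma nil_power f q u w j : L f -> f ^+ q.+1 = u * w + j -> nil u -> ideal_exp L q w ->
  ideal_mul J (ideal_exp L q) j -> nil f.
Proof.
move=> hf E [hu [p hp]] hw hj; split=> //; exists (q + q.+1 * p)%N.
have -> : (q + q.+1 * p).+1 = (q.+1 * p.+1)%N by lia.
have huw : ideal_exp L q.+1 (u * w) by apply: ideal_mul_in.
have hfq : ideal_exp L q.+1 (f ^+ q.+1) by apply: ideal_expX.
have hpow s g : ideal_exp L q.+1 g -> ideal_exp L (q.+1 * s)%N (g ^+ s).
  by move=> hg; elim: s => [|s IH]; rewrite ?muln0 // mulnS exprS; apply: ideal_expD.
rewrite exprM -[_ ^+ p.+1](subrK ((u * w) ^+ p.+1)); apply: (idealD (idJL _)).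
  rewrite subrXX; apply: ideal_mul_expD; first by rewrite E addrC addKr.
  apply: (ideal_sum _ (ideal_exp_ideal _ _)).
  move=> i _; have hi : (i <= p)%N by rewrite -ltnS.
  have -> : (q.+1 * p = q.+1 * (p.+1 - i.+1) + q.+1 * i)%N by rewrite -mulnDr subSS subnK.
  by apply: ideal_expD; [rewrite subSS | ]; apply: hpow.
rewrite exprMn (_ : (q + q.+1 * p = p + q * p.+1)%N); last by lia.
apply: ideal_mul_expD => //.
have hw' s : ideal_exp L (q * s)%N (w ^+ s).
  by elim: s => [|s IH]; rewrite ?muln0 // mulnS exprS; apply: ideal_expD.
exact: hw'.
Qed.

(** Pigeonhole: a long product either repeats [u] beyond its nilpotency index or still has a long
    subproduct over the remaining elements. *)
Lemma nil_products (s : seq R) : (forall u, u \in s -> nil u) ->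
  exists M, forall t : seq R, (forall f, f \in t -> f \in s) -> (M < size t)%N ->
    ideal_mul J (ideal_exp L (size t).-1) (\prod_(f <- t) f).
Proof.
elim: s => [|u s IH] hs.
  by exists 0%N => -[|f t] // /(_ f); rewrite inE eqxx => /(_ isT).
have [|M hM] := IH; first by move=> v hv; apply: hs; rewrite inE hv orbT.
have [hu [q hq]] : nil u by apply: hs; rewrite inE eqxx.
exists (M + q.+1)%N => t ht hsize.
pose t1 := filter (pred1 u) t; pose t2 := filter (predC (pred1 u)) t.
have hperm : perm_eq t (t1 ++ t2) by rewrite perm_sym perm_filterC.
have t1E : t1 = nseq (size t1) u by apply/all_pred1P; apply: filter_all.
have t2s f : f \in t2 -> f \in s.
  by rewrite mem_filter /= => /andP[hf /ht]; rewrite inE (negbTE hf).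
have t2L : ideal_exp L (size t2) (\prod_(f <- t2) f).
  elim: (t2) t2s => [|f r IHr] hr; first by rewrite big_nil.
  rewrite big_cons /=; apply: ideal_mul_in; last by apply: IHr => g hg; apply: hr; rewrite inE hg orbT.
  have : nil f by apply: hs; rewrite inE hr ?orbT // inE eqxx.
  by case.
have prod1 : \prod_(f <- t1) f = u ^+ size t1.
  by rewrite t1E big_nseq size_nseq; elim: (size t1) => //= c ->; rewrite exprS.
rewrite (perm_big _ hperm) big_cat /= prod1 (perm_size hperm) size_cat.
have hsz : (size t1 + size t2 = size t)%N by rewrite (perm_size hperm) size_cat.
have {}hsize : (M + q.+1 < size t1 + size t2)%N by rewrite hsz.
have [hc|hc] := ltnP q (size t1).
  have -> : (size t1 = q.+1 + (size t1 - q.+1))%N by lia.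
  rewrite exprD -mulrA addSn /= -addnA; apply: ideal_mul_expD => //.
  by apply: ideal_expD => //; apply: ideal_expX.
have := hM t2 t2s; rewrite mulrC => hM2.
have h2 : (M < size t2)%N.
  by rewrite -(ltn_add2r (size t1)) [X in (_ < X)%N]addnC; apply: leq_trans hsize; rewrite ltnS leq_add2l ltnW.
have -> : (size t1 + size t2).-1 = ((size t2).-1 + size t1)%N.
  by rewrite -{1}(prednK (leq_ltn_trans (leq0n _) h2)) addnS addnC.
by apply: ideal_mul_expD; [apply: hM2 | apply: ideal_expX].
Qed.

(** An ideal generated by finitely many nilpotents is nilpotent; for the irrelevant ideal of the
    Rees algebra modulo [J], this is the reduction property. *)
Lemma nil_reduction (s : seq R) : (forall f, L f -> ideal_gen (fun g => g \in s) f) ->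
  (forall u, u \in s -> nil u) -> is_reduction J L.
Proof.
move=> hgen hs; split=> //; have [M hM] := nil_products hs; exists M => m hm f; split; last first.
  by apply: ideal_mulS.
pose G q f := ideal_gen (fun g => exists t : seq R,
  [/\ forall h, h \in t -> h \in s, size t = q & g = \prod_(h <- t) h]) f.
have hG q g : ideal_exp L q g -> G q g.
  elim: q g => [|q IH] g.
    move=> _; rewrite -[g]mulr1; apply: (ideal_mulL _ (ideal_gen_ideal _)).
    by apply: ideal_gen_sub; exists [::]; split; rewrite ?big_nil.
  apply: (ideal_mul_ind (ideal_gen_ideal _)) => u v /hgen hu /IH hv.
  have idc : is_ideal (fun u => G q.+1 (v * u)) by apply: ideal_colon; apply: ideal_gen_ideal.
  rewrite mulrC; apply: (hu _ idc) => {hu} u hu.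
  have idc' : is_ideal (fun v => G q.+1 (u * v)) by apply: ideal_colon; apply: ideal_gen_ideal.
  rewrite mulrC; apply: (hv _ idc') => _ [t [ht hsz ->]].
  apply: ideal_gen_sub; exists (u :: t); rewrite big_cons /= hsz; split=> //.
  by move=> h; rewrite inE => /orP[/eqP ->|/ht].
move=> /hG; apply; first exact: ideal_mul_ideal.
move=> _ [t [ht hsz ->]]; have := hM t ht; rewrite hsz; apply; lia.
Qed.

End Nilpotents.

(** * An explicit reduction with [d] generators *)

Section SpecialReduction.
Variables (n a delta : nat) (k : fieldType).
Local Notation d := n.+3.
Local Notation R := {mpoly k[d]}.
Local Notation vy := (vy n).
Local Notation vz := (vz n).
Local Notation LI := (@LI n a delta k).
Local Notation Lmon := (Lmon a delta).
Implicit Types (f g h v : R) (i j q : nat) (m u : 'X_{1..d}).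

Definition vx (i : nat) : 'I_d := inord i.

Definition mp (i : nat) : 'X_{1..d} := (U_(vx i) + U_(vz) *+ delta.-1)%MM.
Definition mq (i : nat) : 'X_{1..d} := (U_(vx i) *+ delta)%MM.
Definition mt : 'X_{1..d} := (U_(vy) *+ a + U_(vz) *+ (delta - a))%MM.

(* Only the first generator of [J0] below is not homogeneous for the weights
   delta ^ (d-2-i) of x_i (0 for z); the weights of the tail are those for which
   the functional of [functional_exists] does not vanish on a power of x_0. *)
Definition tail_monomials : seq 'X_{1..d} :=
  [:: (U_(vx 0) + U_(vy) *+ a.-1 + U_(vz) *+ (delta - a))%MM, mp 0
    & if (3 <= delta)%N then [:: (U_(vx 0) *+ 2 + U_(vz) *+ delta.-2)%MM] else [::]].

Definition tailp : R := \sum_(m <- tail_monomials) 'X_[m].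

Definition J0gen f : Prop :=
  [\/ f = 'X_[mq 0] - tailp,
      (exists2 i, (0 < i <= n.+1)%N & f = 'X_[mq i] - 'X_[mp i.-1])
    | f = 'X_[mt]].

Definition J0 : R -> Prop := ideal_gen J0gen.

Lemma vx_val i : (i < d)%N -> vx i = i :> nat.
Proof. by move=> h; rewrite /vx inordK. Qed.

Lemma vx_low i : (i <= n)%N -> low (vx i).
Proof. by move=> h; rewrite /low vx_val // ltnS (leq_trans h) // leqW. Qed.

Lemma vx_vy : vx n.+1 = vy.
Proof. by apply: val_inj; rewrite /= vx_val. Qed.

Lemma vx_neq_vz i : (i <= n.+1)%N -> vx i != vz.
Proof. by move=> h; rewrite -val_eqE /= vx_val; lia. Qed.

Lemma vx_of (i : 'I_d) : i != vz -> exists2 j, (j <= n.+1)%N & i = vx j.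
Proof.
move=> h; exists (nat_of_ord i); last by apply: val_inj; rewrite /= vx_val.
by move: h; rewrite -val_eqE /=; have := ltn_ord i; lia.
Qed.

Hypotheses (a_gt0 : (0 < a)%N) (a_le : (a <= delta)%N) (delta_ge2 : (2 <= delta)%N).

Let muU (i : 'I_d) : mu a U_(i)%MM = if i == vz then 0%N else if i == vy then 1%N else a.
Proof.
rewrite /mu lowdegU mnm1E; case: (eqVneq i vz) => [->|hz].
  by rewrite vz_neq_vy (_ : low vz = false) ?muln0 // /low /=; lia.
case: (eqVneq i vy) => [->|hy]; first by rewrite (_ : low vy = false) ?muln0 // /low /=; lia.
have -> : low i by move: hz hy; rewrite -!val_eqE /low /=; have := ltn_ord i; lia.
by rewrite muln1 addn0.
Qed.

Let muM m q : mu a (m *+ q)%MM = (mu a m * q)%N.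
Proof.
elim: q => [|q IH]; last by rewrite mulmS muD // IH mulnS.
rewrite mulm0n muln0 /mu mnm0E addn0 /lowdeg big1 ?muln0 // => l _; by rewrite mnm0E.
Qed.

Lemma mp_deg i : mdeg (mp i) = delta.
Proof. by rewrite mdegD mdegMn !mdeg1 mul1n add1n prednK // ltnW. Qed.

Lemma mq_deg i : mdeg (mq i) = delta.
Proof. by rewrite mdegMn mdeg1 mul1n. Qed.

Lemma mt_deg : mdeg mt = delta.
Proof. by rewrite mdegD !mdegMn !mdeg1; lia. Qed.

Lemma mp_mu i : (i <= n)%N -> mu a (mp i) = a.
Proof.
move=> h; rewrite muD // mu_z addn0 muU (negbTE (vx_neq_vz _)) ?low_neq_vy ?vx_low //; lia.
Qed.

Lemma mq_mu i : (i <= n)%N -> mu a (mq i) = (a * delta)%N.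
Proof.
move=> h; rewrite muM muU (negbTE (vx_neq_vz _)) ?low_neq_vy ?vx_low //; lia.
Qed.

Lemma mqy_mu : mu a (mq n.+1) = delta.
Proof. by rewrite muM muU vx_vy eqxx eq_sym vz_neq_vy mul1n. Qed.

Lemma mt_mu : mu a mt = a.
Proof. by rewrite muD // mu_z muM muU eqxx eq_sym vz_neq_vy; lia. Qed.

Lemma LmonE m : mdeg m = delta -> Lmon 1 m = (a <= mu a m)%N.
Proof. by move=> h; rewrite /Lmon lord_geq // !mul1n h leqnn andbT. Qed.

Lemma LmonE' q m : Lmon q m = ((q * a <= mu a m) && (q * delta <= mdeg m))%N.
Proof. by rewrite /Lmon lord_geq. Qed.

Lemma tail_Lmon m : m \in tail_monomials -> mdeg m = delta /\ (a <= mu a m)%N.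
Proof.
have h0 : vx 0 != vz by apply: vx_neq_vz.
have h1 : (vx 0 == vy) = false by rewrite low_neq_vy ?vx_low.
rewrite !inE => /or3P[/eqP ->|/eqP ->|].
- rewrite !mdegD !mdegMn !mdeg1 !muD // mu_z !muM !muU (negbTE h0) h1 eqxx (eq_sym vy) vz_neq_vy; split; lia.
- by rewrite mp_deg mp_mu.
case: ifP => // h3; rewrite inE => /eqP ->.
rewrite !mdegD !mdegMn !mdeg1 !muD // mu_z !muU (negbTE h0) h1; split; lia.
Qed.

Let idL : is_ideal LI. Proof. exact: LI_ideal. Qed.

Let LI_mon m : mdeg m = delta -> (a <= mu a m)%N -> LI 'X_[m].
Proof. by move=> h1 h2; apply: LI_X; rewrite LmonE. Qed.

Lemma J0_ideal : is_ideal J0. Proof. exact: ideal_gen_ideal. Qed.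

Lemma J0_LI : subideal J0 LI.
Proof.
move=> f; apply => //.
have hq i : (i <= n.+1)%N -> LI 'X_[mq i].
  move=> hi; apply: LI_mon; first exact: mq_deg.
  move: hi; rewrite leq_eqVlt => /orP[/eqP ->|]; first by rewrite mqy_mu.
  by rewrite ltnS => hi; rewrite mq_mu //; nia.
move=> _ [->|[i hi ->]|->].
- apply: (idealB idL); first exact: hq.
  by apply: (ideal_sum_seq idL) => m /tail_Lmon[h1 h2]; apply: LI_mon.
- apply: (idealB idL); first by apply: hq; lia.
  by apply: LI_mon; [apply: mp_deg | rewrite mp_mu //; lia].
- by apply: LI_mon; [apply: mt_deg | rewrite mt_mu].
Qed.

Local Notation nil := (nil LI J0).

Let nil_sub f g : J0 (f - g) -> nil g -> nil f.
Proof.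
move=> h hg; rewrite -[f](subrK g); exact: (nilD idL (nilJ J0_LI h) hg).
Qed.

Let nil_mt : nil 'X_[mt].
Proof.
apply: (nilJ J0_LI); apply: ideal_gen_sub; by constructor 3.
Qed.

Let J0_chain i : (0 < i <= n.+1)%N -> J0 ('X_[mq i] - 'X_[mp i.-1]).
Proof. by move=> h; apply: ideal_gen_sub; constructor 2; exists i. Qed.

(* One step of the chain: [x^m ^ q * x^m'] is a multiple of the nilpotent [x^u],
   and [x^m'] agrees with [x^m] modulo [J0]. *)
Let nil_chain m m' u q : mdeg m = delta -> mdeg m' = delta -> mdeg u = delta ->
  (a <= mu a m)%N -> J0 ('X_[m'] - 'X_[m]) -> nil 'X_[u] ->
  (u <= m *+ q + m')%MM -> (q * a + mu a u <= q * mu a m + mu a m')%N -> nil 'X_[m].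
Proof.
move=> dm dm' du hm hJ hu hle hmu.
have hLm := LI_mon dm hm.
apply: (@nil_power _ LI J0 'X_[m] q 'X_[u] 'X_[m *+ q + m' - u] ('X_[m] ^+ q * ('X_[m] - 'X_[m']))) => //.
- rewrite -mpolyXD addmC submK // mpolyXD -mpolyXn exprSr; ring.
- apply/LI_exp => //; apply: supportedX; rewrite LmonE'.
  have E : (m *+ q + m' - u + u = m *+ q + m')%MM by rewrite submK.
  have := congr1 (mu a) E; have := congr1 (@mdeg _) E.
  rewrite !muD // !mdegD muM mdegMn dm dm' du; lia.
rewrite mulrC; apply: ideal_mul_in; last exact: ideal_expX.
by rewrite -opprB; apply: (idealN J0_ideal).
Qed.

(** Starting from the generator y^a z^(delta-a), the relations pass nilpotency from y to x_n and
    then down the indices to x_0. *)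
Let nil_mp i : (i <= n)%N -> nil 'X_[mp i].
Proof.
suff h j : (j <= n)%N -> nil 'X_[mp (n - j)].
  by move=> hi; have := h (n - i)%N (leq_subr _ _); rewrite subKn.
elim: j => [|j IH] hj.
  rewrite subn0; apply: (@nil_chain _ (mq n.+1) mt a); rewrite ?mp_deg ?mq_deg ?mt_deg ?mp_mu //.
  - by apply: (J0_chain (i := n.+1)); rewrite ltnS leqnn.
  - apply/mnm_lepP => l; rewrite /mt /mp /mq vx_vy !mnmDE !mulmnE !mnmDE !mulmnE !mnm1E.
    case: (eqVneq vy l) => [<-|h1]; first by rewrite vz_neq_vy; nia.
    by case: (eqVneq vz l) => [<-|h2]; nia.
  - by rewrite mt_mu mqy_mu; nia.
have hj1 : (n - j = (n - j.+1).+1)%N by lia.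
apply: (@nil_chain _ (mq (n - j)) (mp (n - j)) 1).
- exact: mp_deg.
- exact: mq_deg.
- exact: mp_deg.
- by rewrite mp_mu //; lia.
- by rewrite (_ : (n - j.+1 = (n - j).-1)%N); [apply: J0_chain | ]; lia.
- by apply: IH; lia.
- apply/mnm_lepP => l; rewrite /mp /mq mulm1n !mnmDE !mulmnE !mnm1E.
  by case: (eqVneq (vx (n - j)) l) => [_|_]; lia.
- by rewrite mul1n !mp_mu ?mq_mu; nia.
Qed.

Let nil_mq i : (0 < i <= n.+1)%N -> nil 'X_[mq i].
Proof. by move=> h; apply: (nil_sub (J0_chain h)); apply: nil_mp; lia. Qed.

Let nil_multiple m u : mdeg m = delta -> mdeg u = delta -> (a <= mu a m)%N -> nil 'X_[u] ->
  (mu a u <= a)%N || (a < mu a m)%N -> (forall l : 'I_d, (0 < u l)%N -> (0 < m l)%N) -> nil 'X_[m].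
Proof.
(* This [q] is large enough for [u] to divide the power [q.+1] of the monomial and for the quotient
   to have weight at least [q * a]. *)
move=> dm du hm hu hmu hsupp; pose q := (delta + mu a u)%N.
have ule (i : 'I_d) : (u i <= delta)%N by rewrite -du mdegE (bigD1 i) //= leq_addr.
have hle : (u <= m *+ q.+1)%MM.
  apply/mnm_lepP => i; rewrite mulmnE; case: (posnP (u i)) => [-> //|/hsupp h].
  by have := ule i; rewrite /q; nia.
have E : (m *+ q.+1 - u + u = m *+ q.+1)%MM by rewrite submK.
apply: (@nil_power _ LI J0 'X_[m] q 'X_[u] 'X_[m *+ q.+1 - u] 0) => //.
- exact: LI_mon.
- by rewrite addr0 -mpolyXD addmC E mpolyXn.
- apply/LI_exp => //; apply: supportedX; rewrite LmonE'.
  have := congr1 (mu a) E; have := congr1 (@mdeg _) E.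
  rewrite muD // mdegD muM mdegMn dm du; case/orP: hmu => hmu; rewrite /q; nia.
exact: (ideal0 (ideal_mul_ideal _ _)).
Qed.

(** With z present, compare to y^a z^(delta-a) or some x_i z^(delta-1); without z, compare to the
    pure power of y or of a low variable other than x_0. Only x_0^delta escapes and is traded for
    the tail. *)
Let nil_mono m : mdeg m = delta -> (a <= mu a m)%N -> m != mq 0 -> nil 'X_[m].
Proof.
move=> dm hm hne; have [hz|hz] := posnP (m vz); last first.
  have [hl|/lowdeg_gt0[i hi hmi]] := posnP (lowdeg m).
    apply: (nil_multiple dm mt_deg hm nil_mt); first by rewrite mt_mu leqnn.
    have hy : (0 < m vy)%N by move: hm; rewrite /mu hl; lia.
    move=> i; rewrite mnmDE !mulmnE !mnm1E.
    case: (eqVneq vy i) => [<- //|_]; case: (eqVneq vz i) => [<- //|_]; lia.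
  have [j hj Ei] := vx_of (low_neq_vz hi).
  have hjn : (j <= n)%N by move: hi; rewrite Ei /low vx_val; lia.
  apply: (nil_multiple dm (mp_deg j) hm (nil_mp hjn)); first by rewrite mp_mu // leqnn.
  move=> l; rewrite mnmDE mulmnE !mnm1E -Ei.
  case: (eqVneq i l) => [<- //|_]; case: (eqVneq vz l) => [<- //|_]; lia.
have [i [hi0 hin hmi]] : exists i, [/\ (0 < i)%N, (i <= n.+1)%N & (0 < m (vx i))%N].
  apply: NNPP => hn; case/eqP: hne; apply/mnmP => l.
  have hl0 l' : l' != vx 0 -> m l' = 0%N.
    move=> hl'; have [->|hlz] := eqVneq l' vz; first exact: hz.
    have [j hj Ej] := vx_of hlz; apply/eqP; rewrite -leqn0 leqNgt; apply/negP => hm'.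
    apply: hn; exists j; rewrite -Ej; split=> //; rewrite lt0n; apply: contraNneq hl' => E.
    by rewrite Ej E.
  have hm0 : m (vx 0) = delta.
    by rewrite -dm mdegE (bigD1 (vx 0)) //= big1 ?addn0 // => l' /hl0.
  rewrite mulmnE mnm1E; case: (eqVneq (vx 0) l) => [<-|h]; first by rewrite mul1n.
  by rewrite hl0 // eq_sym.
have hi : (0 < i <= n.+1)%N by rewrite hi0.
apply: (nil_multiple dm (mq_deg i) hm (nil_mq hi)); last first.
  by move=> l; rewrite mulmnE mnm1E; case: (eqVneq (vx i) l) => [<- //|_]; lia.
case: (ltnP a (mu a m)) => [_|hle]; first by rewrite orbT.
have hma : mu a m = a by apply/eqP; rewrite eqn_leq hle.
have := mdeg_lord m; rewrite hz dm addn0 => hd.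
have hl : lowdeg m = 0%N by move: hma hd; rewrite /mu; nia.
have hiy : i = n.+1.
  apply/eqP; rewrite eqn_leq hin leqNgt; apply/negP => hi'.
  by have := lowdeg_ge m (vx_low (hi' : i <= n)%N); rewrite hl; lia.
by rewrite hiy mqy_mu; move: hma hd; rewrite /mu hl; lia.
Qed.

Lemma J0_reduction : is_reduction J0 LI.
Proof.
pose s : seq R := [seq 'X_[val b] | b <- enum {: 'X_{1..d < delta.+1}} & (mdeg (val b) == delta) && (a <= mu a (val b))%N].
have nil_q0 : nil 'X_[mq 0].
  apply: (@nil_sub _ tailp); first by apply: ideal_gen_sub; constructor 1.
  rewrite /tailp big_seq; apply: (nil_sum idL J0_ideal J0_LI) => m hm.
  have [h1 h2] := tail_Lmon hm; apply: nil_mono => //.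
  have h0 : vx 0 != vz by apply: vx_neq_vz.
  have h1' : (vx 0 == vy) = false by rewrite low_neq_vy ?vx_low.
  apply/eqP => /(congr1 (fun m : 'X_{1..d} => m (vx 0))).
  rewrite [RHS]mulmnE mnm1E eqxx mul1n.
  move: hm; rewrite !inE => /or3P[/eqP ->|/eqP ->|].
  - by rewrite !mnmDE !mulmnE !mnm1E eqxx (eq_sym vy) h1' (eq_sym vz) (negbTE h0); lia.
  - by rewrite !mnmDE !mulmnE !mnm1E eqxx (eq_sym vz) (negbTE h0); lia.
  case: ifP => // h3; rewrite inE => /eqP ->.
  by rewrite !mnmDE !mulmnE !mnm1E eqxx (eq_sym vz) (negbTE h0); lia.
apply: (@nil_reduction _ LI J0 J0_ideal J0_LI s).
  move=> f hf; apply: (@supported_sub _ _ _ (Lmon 1) f _ _ hf); first exact: ideal_gen_ideal.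
  move=> m hm; have hdeg : (1 * delta + (mdeg m - delta) <= mdeg m)%N by move: hm; rewrite LmonE'; lia.
  have [m1 [m2 [E E1 hm2]]] := Lmon_remove_many a_gt0 a_le hm hdeg.
  have Em2 : mdeg m2 = delta by have := congr1 (@mdeg _) E; move: hm; rewrite LmonE' mdegD E1; lia.
  rewrite E mpolyXD; apply: (ideal_mulL _ (ideal_gen_ideal _)).
  have hlt : (mdeg m2 < delta.+1)%N by rewrite Em2.
  move=> I _; apply; apply/mapP; exists (BMultinom hlt) => //.
  rewrite mem_filter /= Em2 eqxx mem_enum andbT.
  by move: hm2; rewrite LmonE'; lia.
move=> w /mapP[b]; rewrite mem_filter => /andP[/andP[/eqP h1 h2] _] ->.
by case: (eqVneq (val b) (mq 0)) => [->|h]; [apply: nil_q0 | apply: nil_mono].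
Qed.

End SpecialReduction.

(** In base [delta] the lowest [r] digits of the value are all [delta - 1], and carrying never
    increases a digit sum; the induction moves the carry [c] out of the lowest position. *)
Lemma digit_sum_bound delta r T (b : nat -> nat) : (0 < delta)%N ->
  (\sum_(j < r.+1) b j * delta ^ j = T * delta ^ r + (delta ^ r).-1)%N ->
  (T + r * delta.-1 <= \sum_(j < r.+1) b j)%N.
Proof.
move=> delta_gt0; elim: r b => [|r IH] b; first by rewrite !big_ord1 expn0; lia.
rewrite big_ord_recl expn0 muln1 [in X in _ -> X]big_ord_recl => E.
pose S := (\sum_(j < r.+1) b j.+1 * delta ^ j)%N.
have E1 : (b 0 + delta * S = T * delta ^ r.+1 + (delta ^ r.+1).-1)%N.
  rewrite -E; congr addn; rewrite /S big_distrr /=; apply: eq_bigr => j _.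
  by rewrite /bump /= add1n expnS mulnCA.
have hq : (0 < delta ^ r)%N by rewrite expn_gt0 delta_gt0.
pose c := (T * delta ^ r + (delta ^ r).-1 - S)%N.
have hS : (S <= T * delta ^ r + (delta ^ r).-1)%N.
  rewrite -ltnS -(ltn_pmul2l delta_gt0); move: E1; rewrite expnS.
  by move: (delta ^ r)%N hq => q hq; nia.
have hb : (b 0 = delta.-1 + delta * c)%N.
  move: E1; rewrite expnS /c; move: hS; move: (delta ^ r)%N hq => q hq; nia.
pose b' j := if j is 0 then (b 1 + c)%N else b j.+1.
have := IH b'; rewrite !big_ord_recl /= expn0 muln1.
have -> : (b 1 + c + \sum_(i < r) b i.+2 * delta ^ bump 0 i = S + c)%N.
  rewrite /S big_ord_recl expn0 muln1 addnAC; congr (_ + _ + _)%N.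
rewrite /c subnKC // => /(_ erefl) h.
rewrite -/c in h; set X := (\sum_(i < r) _)%N in h.
change (T + r.+1 * delta.-1 <= b 0 + (b 1 + X))%N.
rewrite hb mulSn; nia.
Qed.

(** * A functional vanishing on [J0] *)

Section Functional.
Variables (n a delta : nat) (k : fieldType).
Hypotheses (a_gt0 : (0 < a)%N) (a_le : (a <= delta)%N) (delta_ge2 : (2 <= delta)%N).
Hypothesis char0 : [pchar k]%R =i pred0.
Local Notation d := n.+3.
Local Notation R := {mpoly k[d]}.
Local Notation vy := (vy n).
Local Notation vz := (vz n).
Local Notation vx := (vx n).
Local Notation J0 := (@J0 n a delta k).
Local Notation tailp := (tailp n a delta k).
Local Notation tail_monomials := (tail_monomials n a delta).
Local Notation q := (delta ^ n.+1)%N.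
Implicit Types (f g h : R) (i j : nat) (m u : 'X_{1..d}).

Let s := (n.+3 * delta.-1).-1.
(** A truncation bound: each factor [tailp] has smaller weight than x_0^delta, so after this many
    terms the telescoping in [lam_first] leaves no remainder. *)
Let K := (s * q + n.+3)%N.
(** The value is dictated by [lam_last]: [w j - a] is [(j.+1 * delta - 2) * q + q.-1], and the digit
    bound shows that a monomial of this weight has degree at least one above the degree allowed
    there. *)
Let w j := (delta * q - 1 + a - q + j * (delta * q))%N.

Let wt (l : 'I_d) : nat := if l == vz then 0%N else (delta ^ (n.+1 - l))%N.
Definition wdeg m : nat := (\sum_(l < d) m l * wt l)%N.

Let q_gt0 : (0 < q)%N. Proof. by rewrite expn_gt0; lia. Qed.

Let wdegD m u : wdeg (m + u)%MM = (wdeg m + wdeg u)%N.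
Proof. by rewrite /wdeg -big_split; apply: eq_bigr => l _; rewrite mnmDE mulnDl. Qed.

Let wdegM m j : wdeg (m *+ j)%MM = (wdeg m * j)%N.
Proof. by rewrite /wdeg big_distrl; apply: eq_bigr => l _; rewrite mulmnE mulnAC. Qed.

Let wdegU l : wdeg U_(l)%MM = wt l.
Proof.
rewrite /wdeg (bigD1 l) //= mnm1E eqxx mul1n big1 ?addn0 // => l' h.
by rewrite mnm1E eq_sym (negbTE h).
Qed.

Let wt_le l : (wt l <= q)%N.
Proof. by rewrite /wt; case: ifP => // _; rewrite leq_exp2l //; lia. Qed.

Let wdeg_le m : (wdeg m <= mdeg m * q)%N.
Proof. by rewrite mdegE big_distrl; apply: leq_sum => l _; rewrite leq_mul2l wt_le orbT. Qed.

Let wt_vx i : (i <= n.+1)%N -> wt (vx i) = (delta ^ (n.+1 - i))%N.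
Proof. by move=> h; rewrite /wt (negbTE (vx_neq_vz h)) vx_val //; lia. Qed.

Let wt_vz : wt vz = 0%N. Proof. by rewrite /wt eqxx. Qed.
Let wt_vy : wt vy = 1%N. Proof. by rewrite -vx_vy wt_vx // subnn. Qed.
Let wt_vx0 : wt (vx 0) = q. Proof. by rewrite wt_vx // subn0. Qed.

Lemma wdeg_digits m T : wdeg m = (T * q + q.-1)%N -> (T + n.+1 * delta.-1 <= mdeg m)%N.
Proof.
pose b j := m (vx (n.+1 - j)).
have E : wdeg m = (\sum_(j < n.+2) b j * delta ^ j)%N.
  rewrite /wdeg big_ord_recr /= (_ : ord_max = vz) // wt_vz muln0 addn0.
  rewrite (reindex_inj rev_ord_inj) /=; apply: eq_bigr => j _; rewrite /b.
  have hj := ltn_ord j.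
  have -> : widen_ord (leqnSn n.+2) (rev_ord j) = vx (n.+1 - j).
    by apply: val_inj; rewrite /= vx_val; lia.
  by rewrite wt_vx ?leq_subr // subKn.
rewrite E => /digit_sum_bound h; apply: leq_trans (h _) _; first by lia.
rewrite mdegE [X in (_ <= X)%N]big_ord_recr /= [X in (_ <= X + _)%N](reindex_inj rev_ord_inj) /=.
apply: leq_trans (leq_addr _ _); apply: leq_sum => j _; rewrite /b /= .
have hj := ltn_ord j.
suff -> : vx (n.+1 - j)%N = widen_ord (leqnSn n.+2) (rev_ord j) by [].
by apply: val_inj; rewrite /= vx_val; lia.
Qed.

(** The outer indeterminate records the degree and the inner one the weight, so that [cf e v] sums
    the coefficients of one bidegree. *)
Let Xi : {rmorphism R -> {poly {poly k}}} :=
  mmap (polyC \o polyC) (fun l => ('X^(wt l))%:P * 'X).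

Let cf e v (P : {poly {poly k}}) : k := P`_e`_v.

Let XiX m : Xi 'X_[m] = ('X^(wdeg m))%:P * 'X^(mdeg m).
Proof.
rewrite /= mmapX /mmap1 /wdeg mdegE.
rewrite !expr_sum rmorph_prod -big_split /=; apply: eq_bigr => l _.
by rewrite exprMn_comm -?rmorphXn -?exprM 1?mulnC //; apply: mulrC.
Qed.

Let cf_mulX e v f m : cf e v (Xi (f * 'X_[m])) =
  if (mdeg m <= e)%N && (wdeg m <= v)%N then cf (e - mdeg m) (v - wdeg m) (Xi f) else 0.
Proof.
rewrite rmorphM XiX mulrA /cf coefMXn ltnNge; case: (mdeg m <= e)%N => /=; last by rewrite coef0.
by rewrite coefMC coefMXn ltnNge; case: (wdeg m <= v)%N.
Qed.

Let cf_lin e v c f g : cf e v (Xi (c *: f + g)) = c * cf e v (Xi f) + cf e v (Xi g).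
Proof. by rewrite rmorphD /= mmapZ /cf coefD coefCM coefD coefCM. Qed.

Let cf_supported e v f : supported (fun m => (mdeg m == e) ==> (wdeg m != v)) f ->
  cf e v (Xi f) = 0.
Proof.
move=> hf; rewrite (mpolyE f) rmorph_sum /cf coef_sum coef_sum big_seq big1 // => m hm.
rewrite -[_ *: _]addr0 -[LHS]/(cf e v _) cf_lin rmorph0 {2}/cf !coef0 addr0.
rewrite -['X_[m]]mul1r cf_mulX rmorph1 /cf.
case: ifP => h; last by rewrite mulr0.
rewrite coef1; case: eqP => he; last by rewrite coef0 mulr0.
rewrite coef1; case: eqP => hv; last by rewrite mulr0.
have := hf m; rewrite -mcoeff_msupp hm => /(_ isT) /implyP h'.
have /h' /eqP : mdeg m == e by apply/eqP; lia.
lia.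
Qed.

(** A factor x_0^delta shifts degree and weight exactly as the index [j] does, and a factor [tailp]
    raises the exponent; hence the two cancel in [lam]. *)
Let lam f : k := \sum_(j < K) cf (s + delta * j) (w j) (Xi (f * tailp ^+ j)).

Let lam_lin c f g : lam (c *: f + g) = c * lam f + lam g.
Proof.
rewrite /lam mulr_sumr -big_split; apply: eq_bigr => j _ /=.
by rewrite mulrDl -scalerAl cf_lin.
Qed.

Let lam0 : lam 0 = 0.
Proof. by rewrite /lam big1 // => j _; rewrite mul0r rmorph0 /cf !coef0. Qed.

Let lamD f g : lam (f + g) = lam f + lam g.
Proof. by rewrite -{1}[f]scale1r lam_lin mul1r. Qed.

Let lamN f : lam (- f) = - lam f.
Proof. by rewrite -scaleN1r -[_ *: f]addr0 lam_lin lam0 addr0 mulN1r. Qed.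

Let lam_middle i f : (0 < i <= n.+1)%N -> lam (f * ('X_[mq n delta i] - 'X_[mp n delta i.-1])) = 0.
Proof.
move=> /andP[i0 hi]; rewrite mulrBr lamD lamN /lam; apply/eqP; rewrite subr_eq0; apply/eqP.
apply: eq_bigr => j _; rewrite (mulrAC f 'X_[mq n delta i]) (mulrAC f 'X_[mp n delta i.-1]) !cf_mulX mq_deg mp_deg //.
suff -> : wdeg (mq n delta i) = wdeg (mp n delta i.-1) by [].
rewrite wdegD !wdegM !wdegU wt_vz wt_vx // wt_vx; last by lia.
by rewrite mul0n addn0 -expnSr; congr (_ ^ _)%N; lia.
Qed.

Let tail_bound m : m \in tail_monomials -> mdeg m = delta /\ (wdeg m < delta * q)%N.
Proof.
have hq2 : (2 <= q)%N.
  by apply: (leq_trans delta_ge2); rewrite -{1}(expn1 delta) leq_exp2l.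
have hd : (delta <= q)%N by rewrite -{1}(expn1 delta) leq_exp2l.
rewrite !inE => /or3P[/eqP ->|/eqP ->|].
- rewrite !mdegD !mdegMn !mdeg1 !wdegD !wdegM !wdegU wt_vx0 wt_vy wt_vz; split; nia.
- by rewrite mp_deg // wdegD wdegM !wdegU wt_vx0 wt_vz; split=> //; nia.
case: ifP => // h3; rewrite inE => /eqP ->.
rewrite !mdegD !mdegMn !mdeg1 !wdegD !wdegM !wdegU wt_vx0 wt_vz; split; nia.
Qed.

Let tailpow_supported j :
  supported (fun m => (mdeg m == delta * j)%N && (wdeg m + j <= j * (delta * q))%N) (tailp ^+ j).
Proof.
elim: j => [|j IH].
  rewrite expr0 -mpolyX0; apply: supportedX.
  by rewrite mdeg0 muln0 eqxx /wdeg big1 // => l _; rewrite mnm0E.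
rewrite exprS; pose Q m := (mdeg m == delta)%N && (wdeg m < delta * q)%N.
apply: (@supportedM _ _ Q _ _ _ _ _ _ IH).
  move=> m u /andP[/eqP h1 h2] /andP[/eqP h3 h4].
  by rewrite mdegD h1 h3 mulnS eqxx wdegD mulSn; lia.
rewrite /tailp big_seq; apply: supported_sum => m /tail_bound[h1 h2].
by apply: supportedX; rewrite /Q h1 eqxx.
Qed.

Let lam_last f : lam (f * 'X_[mt n a delta]) = 0.
Proof.
rewrite /lam big1 // => j _; rewrite mulrAC cf_mulX mt_deg //.
case: ifP => // /andP[h1 h2]; apply: cf_supported => m _; apply/implyP => /eqP hm.
apply/eqP => hw; have := @wdeg_digits m (j.+1 * delta - 2)%N; rewrite hw hm.
rewrite wdegD !wdegM !wdegU wt_vy wt_vz.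
have hs : s = (n.+1 * delta.-1 + delta + delta - 3)%N by rewrite /s; nia.
suff -> : (w j - (1 * a + 0 * (delta - a)) = (j.+1 * delta - 2) * q + q.-1)%N.
  by move=> /(_ erefl); rewrite hs; nia.
have hq2 : (2 * q <= delta * q)%N by rewrite leq_mul2r delta_ge2 orbT.
rewrite /w mulnBl -mulnA [(j.+1 * _)%N]mulSn mul1n mul0n.
by move: q_gt0 hq2; move: (delta * q)%N q => A q'; move: (j * A)%N => B; lia.
Qed.

Let lam_first f : lam (f * ('X_[mq n delta 0] - tailp)) = 0.
Proof.
pose c j := cf (s + delta * j) (w j) (Xi (f * tailp ^+ j.+1)).
have hq0 : wdeg (mq n delta 0) = (delta * q)%N by rewrite wdegM wdegU wt_vx0 mulnC.
have hw0 : (w 0 < delta * q)%N.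
  have : (2 * q <= delta * q)%N by rewrite leq_mul2r delta_ge2 orbT.
  have : (delta <= q)%N by rewrite -{1}(expn1 delta) leq_exp2l.
  rewrite /w; nia.
rewrite mulrBr lamD lamN /lam.
have -> : \sum_(j < K) cf (s + delta * j) (w j) (Xi (f * tailp * tailp ^+ j)) = \sum_(j < K) c j.
  by apply: eq_bigr => j _; rewrite -mulrA -exprS.
have -> : K = K.-1.+1 by rewrite /K; lia.
rewrite big_ord_recl [X in _ - X]big_ord_recr /= mulrAC cf_mulX hq0 mq_deg.
rewrite [(_ <= w 0)%N]leqNgt hw0 andbF add0r.
rewrite opprD addrA; have -> : c K.-1 = 0.
  apply: cf_supported.
  pose Q m := (delta * K <= mdeg m)%N && (wdeg m + K <= (mdeg m - delta * K) * q + K * (delta * q))%N.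
  have hK : (K.-1.+1 = K)%N by rewrite /K; lia.
  have hsup : supported Q (f * tailp ^+ K.-1.+1).
    apply: (@supportedM _ _ predT _ _ _ _ _ _ (@tailpow_supported K.-1.+1)) => //.
    move=> m u _ /andP[/eqP h1 h2]; rewrite /Q mdegD h1 wdegD hK.
    rewrite leq_addl addnK; have := wdeg_le m; move: h2; rewrite hK; lia.
  move=> m /hsup /andP[h1 h2]; apply/implyP => /eqP h3; apply/eqP => h4.
  move: h2; rewrite h4 h3 /w.
  have h5 : (s + delta * K.-1 - delta * K <= s)%N.
    by rewrite leq_subLR addnC leq_add2r leq_mul2l leq_pred orbT.
  have : ((s + delta * K.-1 - delta * K) * q <= s * q)%N by rewrite leq_mul2r h5 orbT.
  have : (2 * q <= delta * q)%N by rewrite leq_mul2r delta_ge2 orbT.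
  have h6 : (K * (delta * q) = K.-1 * (delta * q) + delta * q)%N by rewrite -{1}hK mulSn addnC.
  rewrite h6 {2}/K; move: (K.-1 * _)%N => A; lia.
rewrite subr0; apply/eqP; rewrite subr_eq0; apply/eqP; apply: eq_bigr => j _.
rewrite /= /bump /= add1n mulrAC cf_mulX hq0 mq_deg /c.
have -> : (delta <= s + delta * j.+1)%N by rewrite mulnS; lia.
have -> : (delta * q <= w j.+1)%N by rewrite /w mulSn; lia.
by congr (cf _ _ _); rewrite /w ?mulnS ?mulSn; lia.
Qed.

Lemma lam_J0 f : J0 f -> lam f = 0.
Proof.
pose I f := forall g, lam (g * f) = 0.
have idI : is_ideal I.
  split=> [g|f1 f2 h1 h2 g|b f1 h1 g]; first by rewrite mulr0 lam0.
    by rewrite mulrDr lamD h1 h2 addr0.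
  by rewrite mulrA.
suff h : subideal J0 I by move=> /h /(_ 1); rewrite mul1r.
move=> g; apply; first exact: idI.
move=> u [->|[i hi ->]|->] b.
- exact: lam_first.
- exact: lam_middle.
- exact: lam_last.
Qed.

Let tailpow : nat -> seq 'X_{1..d} := fix F j :=
  if j is j'.+1 then [seq (m + u)%MM | m <- tail_monomials, u <- F j'] else [:: 0%MM].

Let tailpowE j : tailp ^+ j = \sum_(m <- tailpow j) 'X_[m].
Proof.
elim: j => [|j IH]; first by rewrite expr0 big_seq1 mpolyX0.
rewrite exprS IH /tailp mulr_suml big_allpairs_dep; apply: eq_bigr => m _.
by rewrite mulr_sumr; apply: eq_bigr => u _; rewrite mpolyXD.
Qed.

Let tailpowS j m u : m \in tail_monomials -> u \in tailpow j -> (m + u)%MM \in tailpow j.+1.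
Proof. by move=> hm hu; apply: allpairs_f. Qed.

Let tailpow_mp j : (mp n delta 0 *+ j)%MM \in tailpow j.
Proof.
elim: j => [|j IH]; first by rewrite mulm0n inE.
by rewrite mulmS; apply: tailpowS => //; rewrite !inE eqxx orbT.
Qed.

(* All coefficients of the powers of [tailp] are natural numbers, so no
   cancellation occurs in characteristic 0. *)
Lemma lam_x0_neq0 : lam 'X_[U_(vx 0) *+ s] != 0.
Proof.
pose x0 := (U_(vx 0) *+ s)%MM.
pose P j m := (s + mdeg m == s + delta * j)%N && (s * q + wdeg m == w j)%N.
have wx0 : wdeg x0 = (s * q)%N by rewrite wdegM wdegU wt_vx0 mulnC.
have dx0 : mdeg x0 = s by rewrite mdegMn mdeg1 mul1n.
have cfE e v m : cf e v (Xi 'X_[m]) = ((mdeg m == e) && (wdeg m == v))%:R.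
  rewrite XiX /cf -['X^(mdeg m)]mul1r mulrA mulr1 coefMXn coefC.
  have [hlt|hle] := ltnP e (mdeg m); first by rewrite coef0 (gtn_eqF hlt).
  rewrite subn_eq0 (eqn_leq (mdeg m)) hle /=; case: (e <= mdeg m)%N => /=; last by rewrite coef0.
  by rewrite coefXn eq_sym.
have E : lam 'X_[x0] = (\sum_(j < K) count (P j) (tailpow j))%:R.
  rewrite natr_sum /lam; apply: eq_bigr => j _.
  rewrite tailpowE mulr_sumr rmorph_sum /cf coef_sum coef_sum -sum1_count natr_sum [RHS]big_mkcond.
  apply: eq_bigr => m _; rewrite -mpolyXD -[LHS]/(cf _ _ _) cfE mdegD wdegD wx0 dx0 /P.
  by case: ifP.
rewrite E; move/pcharf0P: char0 => ->.
have hq2 : (2 * q <= delta * q)%N by rewrite leq_mul2r delta_ge2 orbT.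
suff [j hj [m hm hP]] : exists2 j, (j < K)%N & exists2 m, m \in tailpow j & P j m.
  rewrite (bigD1 (Ordinal hj)) //= -lt0n addn_gt0 -has_count; apply/orP; left.
  by apply/hasP; exists m.
pose m1 := (U_(vx 0) + U_(vy) *+ a.-1 + U_(vz) *+ (delta - a))%MM.
have hm1 : m1 \in tail_monomials by rewrite !inE eqxx.
have [dm1 _] := tail_bound hm1.
have dmp : mdeg (mp n delta 0) = delta by rewrite mp_deg.
have wmp : wdeg (mp n delta 0) = q by rewrite wdegD wdegM !wdegU wt_vx0 wt_vz mul0n addn0.
have wm1 : wdeg m1 = (q + a.-1)%N.
  by rewrite !wdegD !wdegM !wdegU wt_vx0 wt_vy wt_vz; lia.
(* The product needs weight [w j - s * q]. For [j = n.+2] this is [(n + 3) q + a - 1], so besides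
   the factor containing y^(a-1) one factor must have weight [2 q]. For [delta = 2] the choice
   [j = n.+1] leaves [(n + 1) q + a - 1]. *)
have [hd3|hd2] := ltnP 2 delta.
  pose m2 := (U_(vx 0) *+ 2 + U_(vz) *+ delta.-2)%MM.
  have hm2 : m2 \in tail_monomials by rewrite !inE hd3 inE eqxx !orbT.
  have [dm2 _] := tail_bound hm2.
  have wm2 : wdeg m2 = (2 * q)%N by rewrite !wdegD !wdegM !wdegU wt_vx0 wt_vz; lia.
  exists n.+2; first by rewrite /K; lia.
  exists (m1 + (m2 + mp n delta 0 *+ n))%MM; first by do 2 apply: tailpowS => //.
  rewrite /P mdegD dm1 mdegD dm2 mdegMn dmp wdegD wm1 wdegD wm2 wdegM wmp /w /s.
  apply/andP; split; first by apply/eqP; nia.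
  apply/eqP; have -> : ((d * delta.-1).-1 = n.+3 * delta - n.+3 - 1)%N by lia.
  rewrite !mulnBl mul1n mulnA.
  have : (n.+3 * q + q <= n.+3 * delta * q)%N.
    by rewrite -mulSnr leq_mul2r; apply/orP; right; nia.
  move: hq2; rewrite mulnAC; nia.
have d2 : delta = 2 by lia.
exists n.+1; first by rewrite /K; lia.
exists (m1 + mp n delta 0 *+ n)%MM; first by apply: tailpowS.
rewrite /P mdegD dm1 mdegMn dmp wdegD wm1 wdegM wmp /w /s.
apply/andP; split; first by apply/eqP; lia.
by apply/eqP; move: hq2 q_gt0; move: q => q'; rewrite d2; nia.
Qed.

Lemma functional_exists : exists l : R -> k,
  [/\ forall c f g, l (c *: f + g) = c * l f + l g,
      forall f, J0 f -> l f = 0,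
      forall m, mdeg m != (n.+3 * delta.-1).-1 -> l 'X_[m] = 0
    & l 'X_[U_(vx 0) *+ (n.+3 * delta.-1).-1] != 0].
Proof.
exists lam; split=> [|f|m hm|]; [exact: lam_lin | exact: lam_J0 | | exact: lam_x0_neq0].
rewrite /lam big1 // => j _; apply: cf_supported.
pose Q u := mdeg u != s + delta * j.
have hsup : supported Q ('X_[m] * tailp ^+ j).
  apply: (@supportedM _ _ (pred1 m) _ _ _ _ _ _ (@tailpow_supported j)).
    by move=> _ u /eqP -> /andP[/eqP hu _]; rewrite /Q mdegD hu eqn_add2r.
  by apply: supportedX; rewrite /= eqxx.
by move=> u /hsup /negPf hu; rewrite hu.
Qed.

End Functional.

(** * Automorphisms and the degree bound for the core *)

Lemma digits_inj B r (b c : 'I_r -> nat) : (forall j, b j < B)%N -> (forall j, c j < B)%N ->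
  (\sum_(j < r) b j * B ^ j = \sum_(j < r) c j * B ^ j)%N -> b =1 c.
Proof.
elim: r b c => [|r IH] b c hb hc; first by move=> _ [].
have split_sum (e : 'I_r.+1 -> nat) :
    (\sum_(j < r.+1) e j * B ^ j = (\sum_(j < r) e (lift ord0 j) * B ^ j) * B + e ord0)%N.
  rewrite big_ord_recl expn0 muln1 addnC big_distrl; congr addn.
  by apply: eq_bigr => j _; rewrite /= /bump add1n expnSr mulnA.
rewrite !split_sum => E.
have E0 : b ord0 = c ord0.
  by have := congr1 (modn^~ B) E; rewrite !modnMDl !modn_small.
have B_gt0 : (0 < B)%N by apply: leq_ltn_trans (hb ord0).
move/eqP: E; rewrite E0 eqn_add2r eqn_pmul2r // => /eqP E1 j.
case: (unliftP ord0 j) => [j' ->|-> //]; exact: (IH (b \o lift ord0) (c \o lift ord0) (fun=> hb _) (fun=> hc _) E1 j').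
Qed.

(** Kronecker substitution: sending the variable [l] to [t ^+ (B ^ l)] keeps distinct monomials of
    [f] distinct. *)
Lemma mpoly_nonroot (d : nat) (k : fieldType) (char0 : [pchar k] =i pred0) (f : {mpoly k[d]}) :
  f != 0 -> exists c : 'I_d -> k, f.@[c] != 0.
Proof.
move=> f0; pose B := msize f; pose kr (m : 'X_{1..d}) := (\sum_(l < d) m l * B ^ l)%N.
pose p : {poly k} := \sum_(m <- msupp f) f@_m *: 'X^(kr m).
have lt_B m l : m \in msupp f -> (m l < B)%N.
  by move=> /msize_mdeg_lt; apply: leq_ltn_trans; rewrite mdegE (bigD1 l) //= leq_addr.
have p0 : p != 0.
  have [m0 hm0] : exists m0, m0 \in msupp f.
    by exists (mlead f); apply: mlead_supp.
  apply/eqP => /(congr1 (fun p : {poly k} => p`_(kr m0))).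
  rewrite coef0 coef_sum (bigD1_seq m0) //= coefZ coefXn eqxx mulr1 big_seq_cond big1 => [|m].
    by rewrite addr0; apply/eqP; rewrite -mcoeff_msupp.
  move=> /andP[hm hne]; rewrite coefZ coefXn; case: eqP => E; last by rewrite mulr0.
  case/eqP: hne; apply/mnmP; apply: (@digits_inj B); [| |exact: esym] => l; exact: lt_B.
have [t ht] := nonroot_exists char0 p0.
exists (fun l => t ^+ (B ^ l)); rewrite mevalE.
suff <- : p.[t] = \sum_(m <- msupp f) f@_m * \prod_(l < d) (t ^+ (B ^ l)) ^+ m l by [].
rewrite horner_sum; apply: eq_bigr => m _; rewrite hornerZ hornerXn expr_sum.
by congr (_ * _); apply: eq_bigr => l _; rewrite mulnC exprM.
Qed.

Lemma rmorph_mpoly_eq (d : nat) (k : fieldType) (S : nzRingType) (F G : {rmorphism {mpoly k[d]} -> S}) :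
  (forall c, F c%:MP = G c%:MP) -> (forall i, F 'X_i = G 'X_i) -> F =1 G.
Proof.
move=> hC hX f; rewrite (mpolyE f) !rmorph_sum; apply: eq_bigr => m _.
rewrite -mul_mpolyC !rmorphM hC; congr (_ * _); rewrite mpolyXE_id !rmorph_prod.
by apply: eq_bigr => i _; rewrite !rmorphXn hX.
Qed.

(** * Shears towards the first variable *)

Section UpperInclusion.
Variables (n a delta : nat) (k : fieldType).
Hypotheses (a_gt0 : (0 < a)%N) (a_le : (a <= delta)%N).
Local Notation d := n.+3.
Local Notation R := {mpoly k[d]}.
Local Notation vy := (vy n).
Local Notation vz := (vz n).
Local Notation vx := (vx n).
Local Notation LI := (@LI n a delta k).
Local Notation Lmon := (Lmon a delta).
Implicit Types (f g h : R) (l : 'I_d) (m u : 'X_{1..d}) (c b : 'I_d -> k).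

Definition shear (t : k) c : {rmorphism R -> R} :=
  mmap (@mpolyC d k) (fun l => t *: 'X_l + c l *: 'X_(vx 0)).

Lemma shearC t c e : shear t c e%:MP = e%:MP.
Proof. exact: mmapC. Qed.

Lemma shearX t c l : shear t c 'X_l = t *: 'X_l + c l *: 'X_(vx 0).
Proof. by rewrite /= mmapX mmap1U. Qed.

Lemma shearK t t' c c' : t' * t = 1 -> (forall l, t' * c l + c' l * (t + c (vx 0)) = 0) ->
  cancel (shear t' c') (shear t c).
Proof.
move=> htt hcc f.
apply: (@rmorph_mpoly_eq _ _ _ (shear t c \o shear t' c')%FUN idfun) => [e|l] /=.
  by rewrite -!/(shear _ _ _) !shearC.
rewrite -!/(shear _ _ _) shearX rmorphD -!mul_mpolyC !rmorphM !shearC !shearX.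
transitivity ((t' * t)%:MP * 'X_l + (t' * c l + c' l * (t + c (vx 0)))%:MP * 'X_(vx 0) : R).
  rewrite -!mul_mpolyC !(mpolyCD, mpolyCM); ring.
by rewrite htt hcc mpolyC1 mpolyC0 mul0r mul1r addr0.
Qed.

(** Only multiples of x_0 are added, and x_0 lies in C; in particular the image of y^a is a scalar
    multiple of y^a modulo x_0. *)
Lemma shear_LI t c f : LI f -> LI (shear t c f).
Proof.
pose C : R -> Prop := supported (fun m => 0 < lord a m)%N.
have idC : is_ideal C by apply: supported_ideal => m m' h; apply: leq_trans h (lord_geD _ _ _).
have C_low l : low l -> C 'X_l by move=> hl; apply: supportedX; rewrite /lord lowdegU hl.
have low0 : low (vx 0) by apply: vx_low.
have hC m : (0 < lord a m)%N -> C (shear t c 'X_[m]).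
  move=> hm; have [hl|/lowdeg_gt0[l hl hml]] := posnP (lowdeg m); last first.
    rewrite -(mnm_subK hml) mpolyXD rmorphM; apply: (ideal_mulL _ idC); rewrite shearX.
    by apply: (idealD idC); apply: (idealZ _ idC); apply: C_low.
  have hy : (a <= m vy)%N.
    by rewrite leqNgt; apply/negP => /divn_small E; move: hm; rewrite /lord hl E.
  have E : m = (m - U_(vy) *+ a + U_(vy) *+ a)%MM.
    rewrite submK //; apply/mnm_lepP => l; rewrite mulmnE mnm1E.
    by have [<-|] := eqVneq; rewrite ?mul1n.
  rewrite E mpolyXD rmorphM; apply: (ideal_mulL _ idC).
  rewrite -mpolyXn rmorphXn shearX -[_ ^+ a](subrK ((t *: 'X_vy) ^+ a)).
  apply: (idealD idC).
    rewrite subrXX; apply: (ideal_mulR _ idC); rewrite addrC addKr.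
    by apply: (idealZ _ idC); apply: C_low.
  rewrite exprZn; apply: (idealZ _ idC); rewrite mpolyXn; apply: supportedX.
  by rewrite /lord mulmnE mnm1E eqxx mul1n divnn a_gt0 addn1.
have hm g : ideal_exp max_homog_ideal delta g -> ideal_exp max_homog_ideal delta (shear t c g).
  apply: rmorph_exp => {}g hg; apply: (hg (fun h => max_homog_ideal (shear t c h))).
    exact: preim_ideal (ideal_gen_ideal _).
  move=> _ [l ->]; rewrite shearX.
  by apply: (idealD (ideal_gen_ideal _)); apply: (idealZ _ (ideal_gen_ideal _)); apply: ideal_gen_sub;
    [exists l | exists (vx 0)].
move=> hf; have h1 : C (shear t c f).
  apply: (@supported_sub _ _ (fun h => C (shear t c h)) (fun m => 0 < lord a m)%N f _ hC).
    exact: preim_ideal idC.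
  by move=> m /hf /andP[h _]; exact: h.
have /hm/(max_homog_exp a_gt0 a_le) h2 : ideal_exp max_homog_ideal delta f.
  by apply/(max_homog_exp a_gt0 a_le) => m /hf /andP[_]; rewrite mul1n.
by move=> m hne; rewrite /Lmon mul1n; apply/andP; split; [exact: h1 | exact: h2].
Qed.

Hypotheses (delta_ge2 : (2 <= delta)%N) (char0 : [pchar k]%R =i pred0).

Lemma shear_poly c (f : R) : exists H : {poly R}, forall t, H.[t%:MP] = shear t c f.
Proof.
pose Hm : {rmorphism R -> {poly R}} :=
  mmap (polyC \o @mpolyC d k) (fun l => 'X_l *: 'X + (c l *: 'X_(vx 0))%:P).
exists (Hm f) => t.
have E : (horner_eval t%:MP \o Hm)%FUN =1 shear t c; last exact: E.
apply: (@rmorph_mpoly_eq _ _ _ (horner_eval t%:MP \o Hm)%FUN (shear t c)) => [e|l].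
  by rewrite shearC /Hm /= mmapC horner_evalE hornerC.
rewrite shearX /Hm /= mmapX mmap1U horner_evalE hornerD hornerZ hornerX hornerC.
by rewrite -!mul_mpolyC mulrC.
Qed.

Theorem core_degree_bound f : core LI f -> supported (fun m => n.+3 * delta.-1 <= mdeg m)%N f.
Proof.
move=> hf m hm; rewrite leqNgt; apply/negP => hlt.
have [l [l_lin l_J0 l_deg l_x0]] := functional_exists n a_gt0 a_le delta_ge2 char0.
move: hlt l_deg l_x0; set s := (n.+3 * delta.-1).-1 => hlt l_deg l_x0.
have hms : (mdeg m <= s)%N by rewrite /s; lia.
have l0 : l 0 = 0 by have := l_lin (-1) 0 0; rewrite scaler0 addr0 mulN1r addNr.
have l_sum (T : Type) (r : seq T) (e : T -> k) (F : T -> R) :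
    l (\sum_(i <- r) e i *: F i) = \sum_(i <- r) e i * l (F i).
  by elim: r => [|i r IH]; rewrite ?big_nil ?l0 // !big_cons l_lin IH.
(* The factor stays in the core and moves the nonzero component of degree [mdeg m] to degree [s],
   the only one seen by [l]. *)
pose g := f * 'X_(vx 0) ^+ (s - mdeg m).
have hg : core LI g by apply: (ideal_mulR _ (core_ideal _)).
have g0 : hcomp s g != 0.
  have E : s = (mdeg m + (s - mdeg m))%N by rewrite subnKC.
  rewrite /g [X in pihomog _ X]E (@compM_homog _ _ (mdeg m)); last first.
    by rewrite mpolyXn; apply/homogP/supportedX; rewrite mdegMn mdeg1 mul1n.
  apply: mulf_neq0; last first.
    rewrite mpolyXn; apply/eqP => /(congr1 (mcoeff (U_(vx 0) *+ (s - mdeg m)))).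
    by rewrite mcoeffX eqxx mcoeff0 => /eqP; rewrite oner_eq0.
  by apply: contraNneq hm => /(congr1 (mcoeff m)); rewrite mcoeff_comp eqxx mcoeff0 => ->.
have [c hc] := mpoly_nonroot char0 g0.
have [H hH] := shear_poly c g.
pose Q : {poly k} := \poly_(i < size H) l H`_i.
have hQ t : Q.[t] = l (shear t c g).
  rewrite -hH horner_poly horner_coef.
  under [in RHS]eq_bigr => i _ do rewrite -rmorphXn mulrC mul_mpolyC.
  by rewrite l_sum; apply: eq_bigr => i _; rewrite mulrC.
have Q0 : Q != 0.
  apply: contraNneq hc => E; have := hQ 0; rewrite E horner0 => /esym h.
  suff E1 : l (shear 0 c g) = (hcomp s g).@[c] * l 'X_[U_(vx 0) *+ s].
    by move/eqP: h; rewrite E1 mulf_eq0 (negPf l_x0) orbF.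
  have E1 u : shear 0 c 'X_[u] = (\prod_(i < d) c i ^+ u i) *: 'X_[U_(vx 0) *+ mdeg u].
    rewrite mpolyXE_id rmorph_prod /=.
    under eq_bigr => i _ do rewrite rmorphXn -/(shear 0 c) shearX scale0r add0r exprZn.
    by rewrite scaler_prod -mpolyXn mdegE expr_sum.
  have E2 : shear 0 c g = \sum_(u <- msupp g) (g@_u * \prod_(i < d) c i ^+ u i) *: 'X_[U_(vx 0) *+ mdeg u].
    rewrite {1}(mpolyE g) rmorph_sum; apply: eq_bigr => u _.
    by rewrite -mul_mpolyC rmorphM shearC E1 mul_mpolyC scalerA.
  rewrite E2 l_sum pihomogE raddf_sum /= mulr_suml [RHS]big_mkcond /=; apply: eq_bigr => u _.
  case: eqP => hu; first by rewrite -hu mevalZ mevalX.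
  by rewrite l_deg ?mulr0 ?mul0r // mdegMn mdeg1 mul1n; apply/eqP.
(* Invertibility of the shear also requires [t] and [t + c (vx 0)], the scaling of x_0, to be
   nonzero. *)
have [t] := nonroot_exists char0 (mulf_neq0 Q0 (mulf_neq0 (monic_neq0 (monicX k))
  (monic_neq0 (monicXaddC (c (vx 0)))))).
rewrite !hornerM !mulf_eq0 !negb_or hornerX hornerD hornerX hornerC => /and3P[hQt t0 tc].
have E1 : t^-1 * t = 1 by rewrite mulVf.
pose c' l' := - (t^-1 * c l' / (t + c (vx 0))).
have K1 : cancel (shear t^-1 c') (shear t c).
  by apply: shearK => // l'; rewrite /c' mulNr divfK // subrr.
have K2 : cancel (shear t c) (shear t^-1 c').
  apply: shearK => [|l']; first by rewrite mulfV.
  rewrite /c'; field; rewrite t0 tc //.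
have := core_automorphism K1 K2 (@shear_LI t c) (@shear_LI t^-1 c')
  (J0_reduction n k a_gt0 a_le delta_ge2) hg.
by move=> /l_J0; rewrite -hQ; apply/eqP.
Qed.

End UpperInclusion.

(** * The structure of the ideal from its height *)

Section GrowthModuloIdeal.
Variables (d : nat) (k : fieldType).
Local Notation R := {mpoly k[d]}.
Implicit Types (I J P : R -> Prop) (f g h : R) (m : 'X_{1..d}).

(* The growth of [R / I] is at least that of a polynomial ring in [N] variables;
   this replaces the transcendence degree. *)
Definition grows N I : Prop := exists D, forall e, exists (T : finType) (b : T -> R),
  [/\ #|T| = (e ^ N)%N, forall t, (msize (b t) <= (e * D).+1)%N
    & forall c : T -> k, I (\sum_t c t *: b t) -> forall t, c t = 0].

Lemma prime_mulX I g j f : is_prime_ideal I -> ~ I g -> I (g ^+ j * f) -> I f.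
Proof.
move=> [_ _ hI] hg; elim: j => [|j IH]; first by rewrite expr0 mul1r.
by rewrite exprS -mulrA => /hI[].
Qed.

(** Expansions in powers of [g]: in a relation modulo [I] the lowest power of [g] cancels because
    [I] is prime, and modulo [J] only its coefficient remains. *)
Lemma grows_step N I J g : is_prime_ideal I -> is_ideal J -> subideal I J -> ~ I g -> J g ->
  grows N J -> grows N.+1 I.
Proof.
move=> hI idJ IJ Ig Jg [D hD]; have idI : is_ideal I by case: hI.
exists (D + msize g)%N => e; have [T [b [hT hb hind]]] := hD e.
exists (T * 'I_e)%type, (fun t : T * 'I_e => b t.1 * g ^+ t.2); split.
- by rewrite card_prod hT card_ord expnSr.
- move=> [t j] /=; have [->|h0] := eqVneq (b t * g ^+ j) 0; first by rewrite msize0.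
  have := hb t; have [E|b0] := eqVneq (b t) 0; first by rewrite E mul0r eqxx in h0.
  have g0 : g != 0 by apply: contra_notN Ig => /eqP ->; apply: ideal0.
  have hg i : (msize (g ^+ i) <= (i * msize g).+1)%N.
    elim: i => [|i IH]; first by rewrite expr0 msize1.
    rewrite exprS msizeM ?expf_neq0 // mulSn; apply: leq_trans (leq_pred _) _.
    by rewrite -addnS leq_add2l.
  rewrite msizeM ?expf_neq0 // mulnDr => hbt.
  apply: (@leq_trans ((e * D).+1 + (e * msize g).+1).-1); last by rewrite addSn addnS.
  rewrite -!subn1 leq_sub2r // leq_add //.
  by apply: leq_trans (hg j) _; rewrite ltnS leq_mul2r (ltnW (ltn_ord j)) orbT.
move=> c hc.
have E : \sum_t c t *: (b t.1 * g ^+ t.2) = \sum_(j < e) (\sum_t c (t, j) *: b t) * g ^+ j.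
  under [RHS]eq_bigr => j _ do rewrite mulr_suml.
  by rewrite exchange_big pair_big /=; apply: eq_bigr => -[t j] _; rewrite scalerAl.
suff h j : (forall i : 'I_e, (i < j)%N -> forall t, c (t, i) = 0).
  by move=> [t j]; apply: (h e).
elim: j => // j IH i; rewrite ltnS leq_eqVlt => /orP[/eqP hij|]; last exact: IH.
apply: hind; move: hc; rewrite E.
have -> : \sum_(l < e) (\sum_t c (t, l) *: b t) * g ^+ l =
    g ^+ i * (\sum_t c (t, i) *: b t + g * \sum_(l < e | (i < l)%N) (\sum_t c (t, l) *: b t) * g ^+ (l - i.+1)).
  rewrite (bigID (fun l : 'I_e => l < i)%N) /= big1 ?add0r => [|l hl]; last first.
    by rewrite big1 ?mul0r // => t _; rewrite IH ?scale0r // -hij.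
  rewrite (bigD1 i) ?ltnn //= mulrDr mulrC; congr (_ + _).
  rewrite mulrA -exprSr mulr_sumr; apply: eq_big => [l|l].
    by rewrite -leqNgt ltn_neqAle -val_eqE /= eq_sym andbC.
  move=> hl; rewrite mulrCA -exprD; congr (_ * _ ^+ _); move: hl; rewrite -val_eqE /=; lia.
move: (\sum_(l < e | _) _) => w /(prime_mulX hI Ig) /IJ h.
by have := idealB idJ h (ideal_mulR w idJ Jg); rewrite addrK; apply.
Qed.

Lemma grows_bound N I : I 0 -> grows N I -> (N <= d)%N.
Proof.
move=> I0 [D hD]; rewrite leqNgt; apply/negP => hN.
(* With [(D + 1) ^ d < e], the [(e * D + 1) ^ d] exponent vectors available are fewer than
   [e ^ d.+1], so a linear relation exists. *)
pose e := (D.+1 ^ d).+1; have [T [b [hT hb hind]]] := hD e.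
pose B := (e * D).+1; pose T' := {ffun 'I_d -> 'I_B}.
pose M : 'M[k]_(#|T|, #|{: T'}|) :=
  \matrix_(i, j) (b (enum_val i))@_[multinom ((enum_val j : {ffun 'I_d -> 'I_B}) l : nat) | l < d].
have hcard : (#|{: T'}| < #|T|)%N.
  rewrite card_ffun !card_ord hT.
  have h1 : (B <= e * D.+1)%N by rewrite /B mulnS addnC -addn1 leq_add2l.
  apply: (@leq_ltn_trans ((e * D.+1) ^ d)).
    by case: (d) => [|d']; rewrite ?expn0 // leq_exp2r.
  rewrite expnMn; apply: (@leq_trans (e ^ d.+1)); last by rewrite leq_pexp2l.
  by rewrite expnS mulnC ltn_pmul2r // expn_gt0.
have hker : kermx M != 0.
  rewrite -mxrank_eq0 mxrank_ker subn_eq0 -ltnNge.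
  by apply: leq_ltn_trans hcard; apply: rank_leq_col.
have [i hi] : exists i, row i (kermx M) != 0.
  apply/existsP; rewrite -negb_forall; apply: contra hker => /forallP h.
  by apply/eqP/row_matrixP => i; rewrite row0; apply/eqP.
pose c t := row i (kermx M) 0 (enum_rank t).
have hc : \sum_t c t *: b t = 0.
  apply/mpolyP => m; rewrite mcoeff0 raddf_sum /=.
  have [hm|hm] := ltnP (mdeg m) B; last first.
    rewrite big1 // => t _; rewrite mcoeffZ memN_msupp_eq0 ?mulr0 //.
    apply: contraTN hm => /msize_mdeg_lt h; rewrite -ltnNge; exact: leq_trans h (hb t).
  have hl (l : 'I_d) : (m l < B)%N.
    by apply: leq_ltn_trans hm; rewrite mdegE (bigD1 l) //= leq_addr.
  pose F : T' := [ffun l => Ordinal (hl l)].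
  have := congr1 (fun A : 'rV[k]_(#|{: T'}|) => A 0 (enum_rank F))
    (row_mul i (kermx M) M); rewrite mulmx_ker !mxE => /esym E.
  rewrite -[RHS]E (reindex_onto enum_val enum_rank) /=; last by move=> t _; rewrite enum_rankK.
  apply: eq_big => [j|j _]; first by rewrite enum_valK eqxx.
  rewrite mcoeffZ /c !mxE enum_valK; congr (_ * _@__).
  by apply/mnmP => l; rewrite mnmE enum_rankK ffunE.
case/negP: hi; apply/eqP/rowP => j; rewrite [RHS]mxE.
have := hind c; rewrite hc => /(_ I0 (enum_val j)); by rewrite /c enum_valK.
Qed.

(** Each step down the chain raises the growth exponent by one; this bounds heights from above. *)
Lemma grows_chain N P r : grows N P -> prime_chain P r -> (r + N <= d)%N.
Proof.
move=> hP [c [hprime hlt heq]].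
have h j : (j <= r)%N -> grows (j + N) (c (r - j)%N).
  elim: j => [|j IH] hj.
    rewrite subn0 add0n; have [D hD] := hP; exists D => e; have [T [b [h1 h2 h3]]] := hD e.
    by exists T, b; split=> // c' /heq; apply: h3.
  have := IH (ltnW hj); have hr : (r - j.+1 < r)%N by lia.
  have [h1 h2] := hlt _ hr; rewrite (_ : (r - j.+1).+1 = r - j)%N in h1 h2; last by lia.
  have [g hg1 hg2] : exists2 g, c (r - j)%N g & ~ c (r - j.+1)%N g.
    apply: NNPP => hn; apply: h2 => g hg; apply: NNPP => hg'; apply: hn; by exists g.
  apply: (@grows_step _ _ _ g) => //; first by apply: hprime; lia.
  by case: (hprime (r - j)%N (leq_subr _ _)).
have := h r (leqnn r); rewrite subnn; apply: grows_bound.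
by have [[]] := hprime 0%N (leq0n _).
Qed.

End GrowthModuloIdeal.

(** * Lex-segment ideals and coordinate primes *)

Section LexMonomials.
Variables (d : nat) (k : fieldType).
Local Notation R := {mpoly k[d]}.
Implicit Types (L : R -> Prop) (f g : R) (m u : 'X_{1..d}).

Lemma monomial_idealP L f : is_monomial_ideal L -> (L f <-> forall m, f@_m != 0 -> L 'X_[m]).
Proof.
move=> [S hS]; have idL : is_ideal L.
  have [h0 hD hM] := ideal_gen_ideal (fun f => exists2 m, S m & f = 'X_[m]).
  split=> [|f1 f2 /hS h1 /hS h2|b f1 /hS h1]; apply/hS; [exact: h0 | exact: hD | exact: hM].
split; last first.
  move=> hf; rewrite (mpolyE f); apply: ideal_sum_seq => // m hm.
  by apply: idealZ => //; apply: hf; rewrite -mcoeff_msupp.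
move=> /hS hf; apply: (hf (fun f => forall m, f@_m != 0 -> L 'X_[m])).
  split=> [m|f1 f2 h1 h2 m|b f1 h1 m]; first by rewrite mcoeff0 eqxx.
    rewrite mcoeffD => hm; have [h|/h1 //] := eqVneq f1@_m 0.
    by apply: h2; move: hm; rewrite h add0r.
  rewrite -mcoeff_msupp => /msuppM_le /allpairsP[[m1 m2] /= [_ hm2 ->]].
  by rewrite mpolyXD; apply: ideal_mulL => //; apply: h1; rewrite -mcoeff_msupp.
move=> _ [u hu ->] m; rewrite mcoeffX; have [<- _|_] := eqVneq u m; last by rewrite eqxx.
by apply/hS; apply: ideal_gen_sub; exists u.
Qed.

Lemma lex_lt_anti m u : lex_lt m u -> lex_lt u m -> False.
Proof.
move=> [i [hi1 hi2]] [j [hj1 hj2]]; have [h|h|h] := ltngtP i j.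
- by move: hi2; rewrite (hj1 i h) ltnn.
- by move: hj2; rewrite (hi1 j h) ltnn.
by move: hi2; rewrite (val_inj h : i = j) ltnNge ltnW.
Qed.

Lemma lex_segment_up L m u : is_lex_segment L -> mdeg u = mdeg m -> lex_lt m u ->
  L 'X_[m] -> L 'X_[u].
Proof.
move=> [_ hL] hdeg hlt hm; have [r [s [_ [us _ hs hlex] hspan]]] := hL (mdeg m).
have span_in w : monomial_span s ('X_[w] : R) -> w \in s.
  move=> [c E]; apply: contraT => hw; have := congr1 (mcoeff w) E.
  rewrite mcoeffX eqxx raddf_sum big_seq big1 => [|v hv].
    by move/eqP; rewrite oner_eq0.
  rewrite /= mcoeffZ mcoeffX; case: eqP => [E'|]; last by rewrite mulr0.
  by rewrite -E' hv in hw.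
have hms : m \in s.
  by apply: span_in; apply/hspan; split=> //; rewrite dhomogX.
have hus : u \in s.
  by apply: contraT => hus; case: (lex_lt_anti hlt (hlex _ _ hms hdeg hus)).
have [] : graded_piece L (mdeg m) 'X_[u] => //.
apply/hspan; exists (fun w => (w == u)%:R).
rewrite (bigD1_seq u) //= eqxx scale1r big1 ?addr0 // => w hw.
by rewrite (negPf hw) scale0r.
Qed.

Lemma lex_lt_first m u (l0 : 'I_d) : (0 < m l0)%N -> (forall l : 'I_d, (l <= l0)%N -> u l = 0%N) -> lex_lt u m.
Proof.
move=> h0 hu; case: (@arg_minnP _ l0 (fun l => 0 < m l)%N (fun l : 'I_d => l : nat) h0) => l hl hmin.
exists l; split; last by rewrite hu // hmin.
move=> j hj; have hj0 : m j = 0%N.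
  by apply/eqP; rewrite -leqn0 leqNgt; apply/negP => /hmin; rewrite leqNgt hj.
by rewrite hj0 hu //; apply: ltnW; apply: leq_trans hj _; apply: hmin.
Qed.

Lemma generator_below L delta m : generated_in_degree L delta -> L 'X_[m] ->
  exists u, [/\ (u <= m)%MM, mdeg u = delta & L 'X_[u]].
Proof.
move=> hgen hm.
have [|e [u [hu hum hdeg]] hmin] := @min_nat_exists (fun e => exists u, [/\ L 'X_[u], (u <= m)%MM & mdeg u = e]).
  by exists (mdeg m), m; rewrite lepm_refl.
exists u; split=> //; apply: hgen; split=> // v hv hvu.
have hdv : (mdeg u <= mdeg v)%N.
  by rewrite hdeg; apply: hmin; exists v; split=> //; apply: lepm_trans hum.
have E : (u - v + v)%MM = u by rewrite submK.
have : mdeg (u - v)%MM = 0%N by have := congr1 (@mdeg _) E; rewrite mdegD; lia.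
by move/eqP; rewrite mdeg_eq0 => /eqP E0; rewrite -E E0 add0m.
Qed.

Definition kill i : {rmorphism R -> R} := mmap (@mpolyC d k) (fun l => if (l < i)%N then 0 else 'X_l).

Lemma killC i c : kill i c%:MP = c%:MP. Proof. exact: mmapC. Qed.

Lemma killX i l : kill i 'X_l = if (l < i)%N then 0 else 'X_l.
Proof. by rewrite /= mmapX mmap1U. Qed.

(** The prime generated by the first [i] variables, written as a kernel so that primality comes from
    the domain [R]. *)
Definition kill_ideal i f : Prop := kill i f = 0.

Lemma kill_prime i : is_prime_ideal (kill_ideal i).
Proof.
split=> [||f g]; rewrite /kill_ideal.
- split=> [|f g hf hg|b f hf]; first exact: rmorph0.
    by rewrite rmorphD hf hg addr0.
  by rewrite rmorphM hf mulr0.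
- by rewrite rmorph1 => /eqP; rewrite oner_eq0.
by rewrite rmorphM => /eqP; rewrite mulf_eq0 => /orP[/eqP|/eqP]; [left | right].
Qed.

Lemma kill_comp i f : kill i.+1 (kill i f) = kill i.+1 f.
Proof.
apply: (@rmorph_mpoly_eq _ _ _ (kill i.+1 \o kill i)%FUN (kill i.+1)) => [c|l].
  by rewrite -[LHS]/(kill i.+1 (kill i c%:MP)) !killC.
rewrite -[LHS]/(kill i.+1 (kill i 'X_l)) killX; case: ltnP => h //.
by rewrite rmorph0 killX ltnW.
Qed.

Lemma kill_chain i : (i <= d)%N -> prime_chain (kill_ideal i) i.
Proof.
move=> hi; exists kill_ideal; split=> // [j _|j hj]; first exact: kill_prime.
split; first by move=> f hf; rewrite /kill_ideal -kill_comp hf rmorph0.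
have hjd : (j < d)%N by apply: leq_trans hi.
move=> /(_ 'X_(Ordinal hjd)); rewrite /kill_ideal !killX /= ltnSn ltnn => /(_ erefl).
move=> /(congr1 (mcoeff U_(Ordinal hjd))); rewrite mcoeffX eqxx mcoeff0.
by move/eqP; rewrite oner_eq0.
Qed.

Lemma kill_X i m : kill i 'X_[m] = if [exists l : 'I_d, (l < i)%N && (0 < m l)%N] then 0 else 'X_[m].
Proof.
rewrite mpolyXE_id rmorph_prod; case: existsP => [[l /andP[hl hm]]|hn].
  rewrite (bigD1 l) //= rmorphXn -/(kill i) killX hl expr0n (gtn_eqF hm) mul0r //.
apply: eq_bigr => l _; rewrite rmorphXn killX; case: ltnP => // hl.
have [->|hm] := posnP (m l); first by rewrite !expr0.
by case: hn; exists l; rewrite hl.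
Qed.

End LexMonomials.

Lemma prime_varsP d (k : fieldType) (P : {mpoly k[d]} -> Prop) f : is_prime_ideal P ->
  (forall l, P 'X_l) -> P f <-> f@_0%MM = 0.
Proof.
move=> [idP h1 _] hX; have hf : P (f - (f@_0%MM)%:MP).
  apply: (@supported_sub _ _ _ (fun m => m != 0%MM)) => // [m /mnm_neq0[l hl]|m].
    have -> : m = (m - U_(l) + U_(l))%MM by rewrite submK // lep1mP -lt0n.
    by rewrite mpolyXD; apply: ideal_mulL.
  rewrite mcoeffB mcoeffC; apply: contraNneq => ->.
  by rewrite eqxx mulr1 subrr.
split=> [h|h]; last by move: hf; rewrite h mpolyC0 subr0.
have hc : P (f@_0%MM)%:MP by have := idealB idP h hf; rewrite opprB addrCA subrr addr0.
apply/eqP; apply: contraT => hne; case: h1.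
by rewrite -mpolyC1 -(mulVf hne) mpolyCM; apply: ideal_mulL.
Qed.

(** * The shape forced by height [d - 1] *)

Section Structure.
Variables (n delta : nat) (k : fieldType).
Local Notation d := n.+3.
Local Notation R := {mpoly k[d]}.
Local Notation vy := (vy n).
Local Notation vz := (vz n).
Implicit Types (f g : R) (m u : 'X_{1..d}).
Variable L : R -> Prop.
Hypotheses (hlex : is_lex_segment L) (hgen : generated_in_degree L delta)
  (hheight : ideal_height L n.+2).

Let hmon f : L f <-> forall m, f@_m != 0 -> L 'X_[m].
Proof. by apply: monomial_idealP; case: hlex. Qed.

Let idL : is_ideal L.
Proof.
have [[S hS] _] := hlex.
have [h0 hD hM] := ideal_gen_ideal (fun f => exists2 m, S m & f = 'X_[m]).
split=> [|f1 f2 /hS h1 /hS h2|b f1 /hS h1]; apply/hS; [exact: h0 | exact: hD | exact: hM].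
Qed.

(** The lex-smallest monomial of degree [delta] would bring in all the others, so that every prime
    over [L] would contain all variables and have height at least [d]. *)
Let zpow_notin : ~ L 'X_[U_(vz) *+ delta].
Proof.
move=> hz; have hall m : mdeg m = delta -> L 'X_[m].
  move=> hm; have [->//|hne] := eqVneq m (U_(vz) *+ delta)%MM.
  have [l hl hlz] : exists2 l, (0 < m l)%N & l != vz.
    apply: NNPP => hn; case/eqP: hne; apply/mnmP => l.
    have h0 l' : l' != vz -> m l' = 0%N.
      by move=> h; apply/eqP; rewrite -leqn0 leqNgt; apply/negP => h'; apply: hn; exists l'.
    rewrite mulmnE mnm1E; have [<-|h] := eqVneq vz l; last by rewrite h0 // eq_sym.
    by rewrite mul1n -hm mdegE (bigD1 vz) //= big1 ?addn0 // => l' /h0.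
  have hdeg : mdeg m = mdeg (U_(vz) *+ delta)%MM by rewrite mdegMn mdeg1 mul1n.
  apply: (lex_segment_up hlex hdeg _ hz); apply: (lex_lt_first hl) => j hj.
  rewrite mulmnE mnm1E; case: eqVneq => [E|] //; move: hj; rewrite -E /= => hj.
  case/eqP: hlz; apply: val_inj; apply/eqP; rewrite eqn_leq hj andbT -ltnS; exact: ltn_ord.
have [[P [hP LP [hchain hmax]]] _] := hheight.
have idP : is_ideal P by case: hP.
have hX l : P 'X_l.
  have : P ('X_l ^+ delta).
    by rewrite mpolyXn; apply/LP/hall; rewrite mdegMn mdeg1 mul1n.
  have [_ h1 hPM] := hP; elim: (delta) => [|e IH]; first by rewrite expr0 => /h1.
  by rewrite exprS => /hPM[].
have hPm f := prime_varsP f hP hX.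
have : prime_chain P d.
  have [c [h1 h2 h3]] := @kill_chain d k d (leqnn d); exists c; split=> // f.
  rewrite h3 hPm; apply: prime_varsP; first exact: kill_prime.
  by move=> l; rewrite /kill_ideal killX ltn_ord.
by move=> /hmax; rewrite ltnn.
Qed.

Let low_kill : grows 2 (kill_ideal n.+1 : R -> Prop).
Proof.
exists 2 => e; exists ('I_e * 'I_e)%type, (fun t : 'I_e * 'I_e => 'X_[U_(vy) *+ t.1 + U_(vz) *+ t.2]); split.
- by rewrite card_prod card_ord.
- move=> [i j] /=; rewrite msizeX ltnS mdegD !mdegMn !mdeg1 muln2 !mul1n -addnn.
  by apply: leq_add; apply: ltnW.
have vzy : vz != vy by rewrite -val_eqE /= neq_ltn ltnS leqnn orbT.
pose u (i j : nat) := (U_(vy) *+ i + U_(vz) *+ j)%MM.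
have uy i j : u i j vy = i by rewrite mnmDE !mulmnE !mnm1E eqxx (negPf vzy) mul1n addn0.
have uz i j : u i j vz = j by rewrite mnmDE !mulmnE !mnm1E eqxx eq_sym (negPf vzy) mul1n.
move=> c hc [i j]; move: hc; rewrite /kill_ideal rmorph_sum => E.
have := congr1 (mcoeff (u i j)) E; rewrite mcoeff0 raddf_sum (bigD1 (i, j)) //=.
have hk (i' j' : nat) x : @kill d k n.+1 (x *: 'X_[u i' j'] : R) = x *: 'X_[u i' j'].
  rewrite -!mul_mpolyC rmorphM killC kill_X; case: existsP => // -[l /andP[hl]].
  rewrite mnmDE !mulmnE !mnm1E; case: eqVneq => [E1|_]; first by move: hl; rewrite -E1 ltnn.
  by case: eqVneq => [E1|//]; move: hl; rewrite -E1 /= ltnNge leqW.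
rewrite -/(@kill d k n.+1) hk mcoeffZ mcoeffX eqxx mulr1 big1 ?addr0 // => -[i' j'] hne.
rewrite -/(@kill d k n.+1) hk mcoeffZ mcoeffX; case: eqP => [E1|]; last by rewrite mulr0.
case/eqP: hne; have := congr1 (fun m : 'X_{1..d} => m vy) E1.
have := congr1 (fun m : 'X_{1..d} => m vz) E1; rewrite /= !uy !uz => h1 h2.
by congr (_, _); apply: val_inj.
Qed.

(** Otherwise every generator involves a low variable, and [L] lies in the prime of the low
    variables, whose height is at most [d - 2] because its quotient grows like a polynomial ring in
    y and z. *)
Let ypow_in : L 'X_[U_(vy) *+ delta].
Proof.
apply: NNPP => hy.
have hsub : subideal L (kill_ideal n.+1).
  move=> f /hmon hf; rewrite /kill_ideal (mpolyE f) rmorph_sum big_seq big1 // => m hm.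
  rewrite -mul_mpolyC rmorphM kill_X; case: existsP => [_|hn]; first by rewrite mulr0.
  case: hy; have hLm : L 'X_[m] by apply: hf; rewrite -mcoeff_msupp.
  have [u [hum hdu hu]] := generator_below hgen hLm.
  have hul : lowdeg u = 0%N.
    rewrite /lowdeg big1 // => l hl; apply/eqP; rewrite -leqn0 leqNgt; apply/negP => hl0.
    apply: hn; exists l; apply/andP; split; first exact: hl.
    by apply: leq_trans hl0 _; move/mnm_lepP: hum; apply.
  have hdeg : mdeg (U_(vy) *+ delta)%MM = mdeg u by rewrite mdegMn mdeg1 mul1n.
  have := mdeg_lord u; rewrite hul hdu add0n => hd.
  have hj0 j : low j -> u j = 0%N by move=> /(lowdeg_ge u); rewrite hul leqn0 => /eqP.
  have [hz0|hz0] := posnP (u vz); last first.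
    apply: (lex_segment_up hlex hdeg _ hu); exists vy; split.
      move=> j hj; rewrite hj0 // mulmnE mnm1E; case: eqVneq => [E|] //.
      by move: hj; rewrite -E ltnn.
    by rewrite mulmnE mnm1E eqxx mul1n hd -addn1 leq_add2l.
  suff <- : u = (U_(vy) *+ delta)%MM by [].
  apply/mnmP => j; rewrite mulmnE mnm1E; case: eqVneq => [<-|hj]; first by rewrite mul1n hd hz0 addn0.
  rewrite mul0n; have [hl|hl] := boolP (low j); first exact: hj0.
  suff -> : j = vz by [].
  by apply: val_inj => /=; move: hl hj; rewrite -val_eqE /low /=; have := ltn_ord j; lia.
have hb r : prime_chain (kill_ideal n.+1 : R -> Prop) r -> (r <= n.+1)%N.
  by move=> /(grows_chain low_kill); rewrite addn2 !ltnS.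
have [|h hch hmax] := @max_nat_exists (prime_chain (kill_ideal n.+1 : R -> Prop)) n.+1 _ hb.
  by exists n.+1; apply: kill_chain; rewrite leqW.
have [_ /(_ _ h (kill_prime _ _ _) hsub (conj hch hmax))] := hheight.
by have := hb _ hch; rewrite leqNgt => /negP.
Qed.

(** The exponent [a] is the least one with y^a z^(delta-a) in [L]: [ypow_in] makes it exist and
    [zpow_notin] makes it positive. Monomials of degree [delta] with a low variable are lex-larger,
    hence also in [L]. *)
Lemma lex_structure : exists a, [/\ (0 < a)%N, (a <= delta)%N & eq_ideal L (LI a delta (k := k))].
Proof.
have [|a hya hmin] := @min_nat_exists (fun b => (b <= delta)%N /\ L 'X_[U_(vy) *+ b + U_(vz) *+ (delta - b)]).
  by exists delta; rewrite leqnn subnn mulm0n addm0.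
have [a_le hLa] := hya; have a_gt0 : (0 < a)%N.
  by rewrite lt0n; apply/eqP => E; apply: zpow_notin; move: hLa; rewrite E subn0 mulm0n add0m.
have hdeg m : mdeg m = delta -> (L 'X_[m] <-> (0 < lord a m)%N).
  move=> hm; have hml := mdeg_lord m.
  have vzy : vz != vy by rewrite -val_eqE /= neq_ltn ltnS leqnn orbT.
  have hU l : (U_(vy) *+ a + U_(vz) *+ (delta - a))%MM l = ((vy == l) * a + (vz == l) * (delta - a))%N.
    by rewrite mnmDE !mulmnE !mnm1E.
  have hdU : mdeg m = mdeg (U_(vy) *+ a + U_(vz) *+ (delta - a))%MM.
    by rewrite mdegD !mdegMn !mdeg1 !mul1n subnKC.
  have [hl|/lowdeg_gt0[l hl hml0]] := posnP (lowdeg m).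
    have Em : m = (U_(vy) *+ m vy + U_(vz) *+ (delta - m vy))%MM.
      apply/mnmP => l; rewrite mnmDE !mulmnE !mnm1E.
      case: (eqVneq vy l) => [<-|hly]; first by rewrite (negPf vzy) mul1n addn0.
      case: (eqVneq vz l) => [<-|hlz]; first by rewrite mul1n; lia.
      have hlow : low l.
        by move: hly hlz; rewrite -!val_eqE /low /=; have := ltn_ord l; lia.
      by have := lowdeg_ge m hlow; rewrite hl leqn0 => /eqP ->.
    rewrite /lord hl add0n divn_gt0 //; split=> [h|h].
      by apply: hmin; split; [lia | rewrite -Em].
    have [E|hne] := eqVneq (m vy) a; first by rewrite Em E.
    apply: (lex_segment_up hlex hdU _ hLa); exists vy; split; last first.
      by rewrite hU eqxx (negPf vzy) mul1n addn0 ltn_neqAle eq_sym hne.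
    move=> j hj; rewrite hU; have hjl : low j by rewrite /low.
    have := lowdeg_ge m hjl; rewrite hl leqn0 => /eqP ->.
    case: eqVneq => [E|_]; first by move: hj; rewrite -E ltnn.
    by case: eqVneq => [E|//]; move: hj; rewrite -E /= ltnNge leqnSn.
  split=> [_|_]; first by rewrite /lord addn_gt0; apply/orP; left; apply: leq_trans hml0 (lowdeg_ge _ _).
  apply: (lex_segment_up hlex hdU _ hLa); apply: (lex_lt_first hml0) => j hj.
  rewrite hU; have hjn : (j < n.+1)%N by apply: leq_ltn_trans hl.
  case: eqVneq => [E|_]; first by move: hjn; rewrite -E ltnn.
  by case: eqVneq => [E|//]; move: hjn; rewrite -E /= ltnNge leqW.
exists a; split=> // f; rewrite hmon; split=> hf m /hf.
  move=> /(generator_below hgen)[u [hum hdu /(hdeg u hdu) hu]].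
  have E : (m - u + u)%MM = m by rewrite submK.
  by rewrite -E addmC; apply: Lmon_up => //; rewrite /Lmon hu hdu mul1n leqnn.
move=> /(Lmon_split a_gt0 a_le)[m1 [m2 [-> h1 h2 _]]].
rewrite mpolyXD; apply: ideal_mulR => //; apply/hdeg => //.
by case/andP: h2.
Qed.

End Structure.

(* Under the hypotheses the truncated subtractions in the exponent are exact:
   d * (delta - 2) + g - delta = (d - 1) * (delta - 1) - 2 >= 0. *)
Theorem theorem6p13 (k : fieldType) (d g delta : nat)
    (L : {mpoly k[d]} -> Prop)
    (char0 : [pchar k]%R =i pred0)
    (hdelta : (2 <= delta)%N)
    (hLlex : is_lex_segment L)
    (hLgen : generated_in_degree L delta)
    (hd : (3 <= d)%N)
    (hLheight : ideal_height L g)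
    (hg : g = (d - 1)%N) :
  eq_ideal (core L)
    (ideal_mul L
       (ideal_exp max_homog_ideal (d * (delta - 2) + g - delta + 1)%N)).
Proof.
case: d hd L hLlex hLgen hLheight hg => [//|[//|[//|n]]] _ L hLlex hLgen hLheight hg.
have hg' : g = n.+2 by rewrite hg subn1.
rewrite hg' in hLheight *.
have [a [a_gt0 a_le hL]] := lex_structure hLlex hLgen hLheight.
have -> : L = LI a delta (k := k).
  by apply: functional_extensionality => f; apply: propositional_extensionality; apply: hL.
have E : (delta + (n.+3 * (delta - 2) + n.+2 - delta + 1) = n.+3 * delta.-1)%N by nia.
have idL := @LI_ideal n a delta k a_gt0.
move=> f; rewrite LI_mul_max // E; split=> [hf m hm|hf J [idJ JL [m0 hJ]]].
  rewrite (core_degree_bound a_gt0 a_le hdelta char0 hf hm) andbT.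
  by have /andP[] := core_sub idL hf m hm.
(* The exponent [m0.+1] satisfies the positivity required of [N]. *)
apply: (@lower_inclusion n a delta k a_gt0 a_le hdelta char0 J m0.+1 idJ JL) => // [h|m /hf].
  by apply: (proj1 (hJ m0.+1 (leqnSn _) h)).
by rewrite /sigma -mulSnr.
Qed.
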